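(* Let $$1=G_0\unlhd G_1\unlhd G_2\unlhd \cdots \unlhd G_{r-1}\unlhd G_r=G$$ be a normal series in a group $G$ (each $G_{i-1}$ is a normal subgroup of $G_i$) such that each factor group $G_i/G_{i-1}$, $1\leq i\leq r$, is either finite, free of finite rank or polycyclic. If $\phi:G\to G$ is a monomorphism such that $\phi(G_i)\leq G_i$ for $1\leq i\leq r$, then the ascending HNN extension $G_{\phi}$ is highly residually finite.
   Context: For a group monomorphism $\phi:G\to G$, the ascending HNN extension of $G$ with respect to $\phi$ is $G_{\phi}=\langle G,t\mid t^{-1}gt=\phi(g)\ \text{for all } g\in G\rangle$. For a group $\Gamma$, let $\hat{\Gamma}$ be its profinite completion and $c_\Gamma:\Gamma\to\hat{\Gamma}$ the completion map. For a nonnegative integer $n$, $\mathcal{A}_n$ is the class of all groups $\Gamma$ such that, for every finite discrete $\hat{\Gamma}$-module $A$, the map $H^i_c(\hat{\Gamma},A)\to H^i(\Gamma,A)$ induced by $c_\Gamma$, from continuous to ordinary (discrete) group cohomology, is bijective for $0\leq i\leq n$ and injective for $i=n+1$ (equivalently, surjective for $0\le i\le n$). A group $\Gamma$ is highly residually finite if it is residually finite and belongs to $\mathcal{A}_2$; equivalently, for every group extension $1\to F\to E\to \Gamma\to 1$ with $F$ finite, $E$ is residually finite; equivalently, for every group extension $1\to N\to E\to\Gamma\to1$ with $N$ finitely generated and residually finite, $E$ is residually finite. *)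

(* Defs.v *)
From HB Require Import structures.
From mathcomp Require Import all_boot all_order all_algebra.
From mathcomp Require Import all_classical topology function_spaces.

Set Implicit Arguments.
Unset Strict Implicit.
Unset Printing Implicit Defensive.

Import GRing.Theory.
Import Algebra.

Local Open Scope classical_set_scope.
Local Open Scope group_scope.

Definition isomorphic (G H : groupType) : Prop :=
  exists f : {multiplicative G -> H}, bijective f.

Definition finite_group (G : groupType) : Prop := finite_set [set: G].

Definition cyclic_group (G : groupType) : Prop :=
  exists c : G, forall x : G, exists n : nat, x = c ^+ n \/ x = c ^- n.

(* A subgroup of a possibly infinite group G is a [groupClosed G]: a predicate
   closed under the group operations.  Predicates are boolean, but classically
   every subset of G is of this form. *)
Section Subgroup.
Context {G : groupType}.

Definition subgroup_type (H : groupClosed G) : Type := {x : G | x \in H}.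

Variable H : groupClosed G.

HB.instance Definition _ := [isSub of subgroup_type H for @sval _ _].
HB.instance Definition _ := [Choice of subgroup_type H by <:].

Lemma groupClosed_closed : group_closed H.
Proof. by split; [exact: gpred1 | exact: gpredF]. Qed.

HB.instance Definition _ :=
  SubChoice_isSubGroup.Build G _ (subgroup_type H) groupClosed_closed.

End Subgroup.

Definition is_normal (G : groupType) (N : groupClosed G) : Prop :=
  forall x y : G, x \in N -> x ^ y \in N.

Record normal_subgroup (G : groupType) := NormalSubgroup {
  nsub :> groupClosed G;
  nsub_normal : is_normal nsub }.

Section Quotient.
Context {G : groupType}.

Definition same_coset (N : normal_subgroup G) (x y : G) : bool :=
  x^-1 * y \in nsub N.

Lemma same_coset_equiv (N : normal_subgroup G) :
  equiv_class_of (same_coset N).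
Proof.
split=> [x|x y|y x z]; rewrite /same_coset.
- by rewrite mulVg gpred1.
- by apply/idP/idP => /gpredVr; rewrite invgM invgK.
- by move=> xy yz; rewrite -[z](mulVKg y) mulgA gpredM.
Qed.

Canonical same_coset_rel (N : normal_subgroup G) :=
  EquivRelPack (same_coset_equiv N).

Definition quotient (N : normal_subgroup G) : Type :=
  {eq_quot same_coset N}%qT.

Variable N : normal_subgroup G.
Local Notation Q := (quotient N).
Local Open Scope quotient_scope.

HB.instance Definition _ := Choice.on Q.
HB.instance Definition _ := EqQuotient.on Q.

Lemma quotient_eqP (x y : G) :
  (\pi_Q x = \pi_Q y) <-> x^-1 * y \in nsub N.
Proof. by split=> [/eqquotP //|?]; apply/eqquotP. Qed.

Let repr_pi (x : G) : x^-1 * repr (\pi_Q x) \in nsub N.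
Proof. by apply/quotient_eqP; rewrite reprK. Qed.

Definition quotient_one : Q := \pi_Q 1.
Definition quotient_mul (a b : Q) : Q := \pi_Q (repr a * repr b).
Definition quotient_inv (a : Q) : Q := \pi_Q (repr a)^-1.

Lemma quotient_mulE (x y : G) :
  quotient_mul (\pi_Q x) (\pi_Q y) = \pi_Q (x * y).
Proof.
apply/esym/quotient_eqP.
set x' := repr _; set y' := repr _.
have -> : (x * y)^-1 * (x' * y') = (x^-1 * x') ^ y * (y^-1 * y').
  by rewrite /conjg invgM !mulgA mulgK.
by rewrite gpredM ?repr_pi //; apply/nsub_normal/repr_pi.
Qed.

Lemma quotient_invE (x : G) : quotient_inv (\pi_Q x) = \pi_Q x^-1.
Proof.
apply/quotient_eqP; rewrite invgK; set x' := repr _.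
have -> : x' * x^-1 = (x^-1 * x') ^ x^-1.
  by rewrite /conjg invgK !mulgA mulgV mul1g.
exact/nsub_normal/repr_pi.
Qed.

Let quotient_ind (P : Q -> Prop) : (forall x, P (\pi_Q x)) -> forall a, P a.
Proof. by move=> PG a; rewrite -[a]reprK. Qed.

Let mulqA : associative quotient_mul.
Proof.
elim/quotient_ind=> x; elim/quotient_ind=> y; elim/quotient_ind=> z.
by rewrite !quotient_mulE mulgA.
Qed.
Let mul1q : left_id quotient_one quotient_mul.
Proof. by elim/quotient_ind=> x; rewrite quotient_mulE mul1g. Qed.
Let mulq1 : right_id quotient_one quotient_mul.
Proof. by elim/quotient_ind=> x; rewrite quotient_mulE mulg1. Qed.
Let mulVq : left_inverse quotient_one quotient_inv quotient_mul.
Proof.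
by elim/quotient_ind=> x; rewrite quotient_invE quotient_mulE mulVg.
Qed.
Let mulqV : right_inverse quotient_one quotient_inv quotient_mul.
Proof.
by elim/quotient_ind=> x; rewrite quotient_invE quotient_mulE mulgV.
Qed.

HB.instance Definition _ := isGroup.Build Q mulqA mul1q mulq1 mulVq mulqV.

Definition quotient_pi (x : G) : Q := \pi_Q x.

Let quotient_piM : {morph quotient_pi : x y / x * y}.
Proof. by move=> x y; rewrite /quotient_pi -quotient_mulE. Qed.
HB.instance Definition _ :=
  isMultiplicative.Build G Q quotient_pi quotient_piM.
HB.instance Definition _ :=
  Multiplicative_isUMagmaMorphism.Build G Q quotient_pi erefl.

End Quotient.

Notation "G / N" := (quotient (G := G) N) : type_scope.

Section FactorGroup.
Context {G : groupType}.

Definition normal_in (K H : groupClosed G) : Prop :=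
  {subset K <= H} /\ forall x y : G, x \in K -> y \in H -> x ^ y \in K.

Definition restrict_subgroup (K H : groupClosed G) :
    {pred subgroup_type H} :=
  [pred x : subgroup_type H | val x \in K].
Arguments restrict_subgroup K H : clear implicits.

Section Restrict.
Variables K H : groupClosed G.

Let restrict1 : 1 \in restrict_subgroup K H.
Proof. by rewrite inE gmulf1 gpred1. Qed.
Let restrictM : mulg_closed (restrict_subgroup K H).
Proof. by move=> x y; rewrite !inE gmulfM; exact: gpredM. Qed.
Let restrictV : invg_closed (restrict_subgroup K H).
Proof. by move=> x; rewrite !inE gmulfV; exact: gpredVr. Qed.

HB.instance Definition _ :=
  isMulClosed.Build (subgroup_type H) (restrict_subgroup K H) restrictM.
HB.instance Definition _ :=
  isMul1Closed.Build (subgroup_type H) (restrict_subgroup K H) restrict1.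
HB.instance Definition _ :=
  isInvClosed.Build (subgroup_type H) (restrict_subgroup K H) restrictV.
End Restrict.

Lemma restrict_normal (K H : groupClosed G) :
  normal_in K H -> is_normal (restrict_subgroup K H).
Proof.
move=> [_ nKH] x y; rewrite !inE gmulfJ => xK.
exact: nKH xK (valP y).
Qed.

Definition factor_group (K H : groupClosed G) (nKH : normal_in K H) :
    groupType :=
  (subgroup_type H / NormalSubgroup (restrict_normal nKH))%type.

(* The series is G_0, ..., G_r; the values of [Gs] beyond r are irrelevant. *)
Definition subnormal_series (r : nat) (Gs : nat -> groupClosed G) : Prop :=
  [/\ Gs 0%N =i pred1 1, Gs r =i predT
    & forall i, (i < r)%N -> normal_in (Gs i) (Gs i.+1)].

Definition series_factors (P : groupType -> Prop) (r : nat)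
    (Gs : nat -> groupClosed G) : Prop :=
  forall i (nGs : normal_in (Gs i) (Gs i.+1)), (i < r)%N ->
    P (factor_group nGs).

End FactorGroup.

Definition polycyclic (G : groupType) : Prop :=
  exists (r : nat) (Gs : nat -> groupClosed G),
    subnormal_series r Gs /\ series_factors cyclic_group r Gs.

(* The group < X | R > is the quotient of the words in X and formal inverses of
   elements of X by the least congruence that cancels inverse letters and
   identifies both sides of each relation; [R u v] stands for "u = v". *)
Section Presentation.
Context {X : Type}.

Definition word : Type := seq (X * bool).
Definition gen (x : X) : word := [:: (x, true)].
Definition gen_inv (x : X) : word := [:: (x, false)].
Definition word_inv (u : word) : word :=
  rev [seq (a.1, ~~ a.2) | a <- u].

Inductive word_eq (R : word -> word -> Prop) : word -> word -> Prop :=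
| word_eq_refl u : word_eq R u u
| word_eq_sym u v : word_eq R u v -> word_eq R v u
| word_eq_trans u v w : word_eq R u v -> word_eq R v w -> word_eq R u w
| word_eq_cat u u' v v' :
    word_eq R u u' -> word_eq R v v' -> word_eq R (u ++ v) (u' ++ v')
| word_eq_cancel x b : word_eq R [:: (x, b); (x, ~~ b)] [::]
| word_eq_rel u v : R u v -> word_eq R u v.

Definition word_eqb (R : word -> word -> Prop) (u v : word) : bool :=
  `[< word_eq R u v >].

Lemma word_eqb_equiv (R : word -> word -> Prop) :
  equiv_class_of (word_eqb R).
Proof.
split=> [u|u v|v u w].
- exact/asboolP/word_eq_refl.
- by apply/asboolP/asboolP; exact: word_eq_sym.
- by move=> /asboolP uv /asboolP vw; apply/asboolP; exact: word_eq_trans vw.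
Qed.

Canonical word_eqb_rel (R : word -> word -> Prop) :=
  EquivRelPack (word_eqb_equiv R).

HB.instance Definition _ := gen_eqMixin word.
HB.instance Definition _ := gen_choiceMixin word.

Definition presented (R : word -> word -> Prop) : Type :=
  {eq_quot word_eqb R}%qT.

Variable R : word -> word -> Prop.
Local Notation P := (presented R).
Local Open Scope quotient_scope.

HB.instance Definition _ := Choice.on P.
HB.instance Definition _ := EqQuotient.on P.

Lemma presented_eqP (u v : word) : (\pi_P u = \pi_P v) <-> word_eq R u v.
Proof.
by split=> [/eqquotP/asboolP //|?]; apply/eqquotP/asboolP.
Qed.

Definition presented_one : P := \pi_P [::].
Definition presented_mul (a b : P) : P := \pi_P (repr a ++ repr b).
Definition presented_inv (a : P) : P := \pi_P (word_inv (repr a)).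

Let repr_pi (u : word) : word_eq R (repr (\pi_P u)) u.
Proof. by apply/presented_eqP; rewrite reprK. Qed.

Lemma presented_mulE (u v : word) :
  presented_mul (\pi_P u) (\pi_P v) = \pi_P (u ++ v).
Proof. by apply/presented_eqP/word_eq_cat; exact: repr_pi. Qed.

Let word_invK (u : word) : word_inv (word_inv u) = u.
Proof.
rewrite /word_inv map_rev revK -map_comp -[RHS]map_id.
by apply: eq_map => -[x b] /=; rewrite negbK.
Qed.

Let word_mulV (u : word) : word_eq R (u ++ word_inv u) [::].
Proof.
elim: u => [|[x b] u IHu]; first exact: word_eq_refl.
rewrite /word_inv /= rev_cons -cats1.
apply: word_eq_trans (word_eq_cancel R x b).
apply: (@word_eq_cat R [:: (x, b)] [:: (x, b)] _ [:: (x, ~~ b)]).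
  exact: word_eq_refl.
rewrite catA; apply: (@word_eq_cat R _ [::]); first exact: IHu.
exact: word_eq_refl.
Qed.

Let presented_ind (T : P -> Prop) : (forall u, T (\pi_P u)) -> forall a, T a.
Proof. by move=> TP a; rewrite -[a]reprK. Qed.

Let mulpA : associative presented_mul.
Proof.
elim/presented_ind=> u; elim/presented_ind=> v; elim/presented_ind=> w.
by rewrite !presented_mulE catA.
Qed.
Let mul1p : left_id presented_one presented_mul.
Proof. by elim/presented_ind=> u; rewrite presented_mulE. Qed.
Let mulp1 : right_id presented_one presented_mul.
Proof. by elim/presented_ind=> u; rewrite presented_mulE cats0. Qed.
Let mulpV : right_inverse presented_one presented_inv presented_mul.
Proof.
move=> a; rewrite -{1}[a]reprK presented_mulE.
exact/presented_eqP/word_mulV.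
Qed.
Let mulVp : left_inverse presented_one presented_inv presented_mul.
Proof.
move=> a; rewrite -{2}[a]reprK presented_mulE.
apply/presented_eqP; rewrite -{2}[repr a]word_invK; exact: word_mulV.
Qed.

HB.instance Definition _ := isGroup.Build P mulpA mul1p mulp1 mulVp mulpV.

End Presentation.
Arguments word : clear implicits.

Definition free_group (X : Type) : groupType :=
  presented (fun _ _ : word X => False).

Definition free_of_finite_rank (G : groupType) : Prop :=
  exists n : nat, isomorphic G (free_group 'I_n).

(* Generators: [Some g] for g in G, and the stable letter t = [None]. *)
Section HNN.
Context {G : groupType}.

Inductive hnn_rel (phi : G -> G) : word (option G) -> word (option G) -> Prop :=
| hnn_rel_mul g h :
    hnn_rel phi (gen (Some g) ++ gen (Some h)) (gen (Some (g * h)))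
| hnn_rel_conj g :
    hnn_rel phi (gen_inv None ++ gen (Some g) ++ gen None)
      (gen (Some (phi g))).

Definition ascending_hnn (phi : {multiplicative G -> G}) : groupType :=
  presented (hnn_rel phi).

End HNN.

Definition finite_index (G : groupType) (N : normal_subgroup G) : Prop :=
  finite_group (G / N)%type.

Definition residually_finite (G : groupType) : Prop :=
  forall g : G, g != 1 ->
    exists N : normal_subgroup G, finite_index N /\ g \notin nsub N.

(* The completion is the inverse limit of the G / N, N of finite index, as a
   subspace of the product of these discrete groups. *)
Section ProfiniteCompletion.
Variable G : groupType.

Definition finite_index_normal : Type :=
  {N : normal_subgroup G | finite_index N}.

Definition finite_quotients : topologicalType :=
  prod_topology (fun N : finite_index_normal =>
    discrete_topology (G / sval N)%type).

(* the projection G / N -> G / M when N <= M *)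
Definition quotient_map (N M : normal_subgroup G) (a : (G / N)%type) :
  (G / M)%type := quotient_pi M (repr a).

Definition compatible (x : finite_quotients) : Prop :=
  forall N M : finite_index_normal,
    {subset nsub (sval N) <= nsub (sval M)} ->
    quotient_map (sval M) (x N) = x M.

Definition profinite_completion : Type := set_type [set x | compatible x].

HB.instance Definition _ := Topological.on profinite_completion.

Definition profinite_proj (x : profinite_completion)
  (N : finite_index_normal) : (G / sval N)%type := set_val x N.

Lemma profinite_projP (x y : profinite_completion) :
  (forall N, profinite_proj x N = profinite_proj y N) -> x = y.
Proof. by move=> xy; apply: val_inj; apply/functional_extensionality_dep. Qed.

Definition mk_profinite (f : forall N : finite_index_normal, (G / sval N)%type)
  (cf : compatible f) : profinite_completion := SigSub (mem_set cf).

Section QuotientMap.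
Variables (N M : normal_subgroup G).
Hypothesis NM : {subset nsub N <= nsub M}.

Lemma quotient_map_pi (x : G) :
  quotient_map M (quotient_pi N x) = quotient_pi M x.
Proof.
apply/esym/quotient_eqP/NM/(@quotient_eqP _ N).
by rewrite reprK.
Qed.

Let quotient_ind (P : (G / N)%type -> Prop) :
  (forall x, P (quotient_pi N x)) -> forall a, P a.
Proof. by move=> PG a; rewrite -[a]reprK; exact: PG. Qed.

Lemma quotient_mapM : {morph @quotient_map N M : a b / a * b}.
Proof.
elim/quotient_ind=> x; elim/quotient_ind=> y.
by rewrite -gmulfM !quotient_map_pi gmulfM.
Qed.

Lemma quotient_mapV : {morph @quotient_map N M : a / a^-1}.
Proof.
elim/quotient_ind=> x.
by rewrite -gmulfV !quotient_map_pi gmulfV.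
Qed.
End QuotientMap.

Let completion_compatible (g : G) :
  compatible (fun N => quotient_pi (sval N) g).
Proof. by move=> N M NM; rewrite quotient_map_pi. Qed.

(* c_G : G -> completion of G *)
Definition completion_map (g : G) : profinite_completion :=
  mk_profinite (completion_compatible g).

Let profinite_valP (x : profinite_completion) : compatible (set_val x).
Proof. exact: set_valP. Qed.

Let mul_compatible (x y : profinite_completion) :
  compatible (fun N => profinite_proj x N * profinite_proj y N).
Proof.
move=> N M NM; rewrite quotient_mapM //.
by congr (_ * _); exact: profinite_valP.
Qed.
Let inv_compatible (x : profinite_completion) :
  compatible (fun N => (profinite_proj x N)^-1).
Proof.
by move=> N M NM; rewrite quotient_mapV //; congr _^-1; exact: profinite_valP.
Qed.

Definition profinite_one : profinite_completion := completion_map 1.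
Definition profinite_mul (x y : profinite_completion) :
  profinite_completion := mk_profinite (mul_compatible x y).
Definition profinite_inv (x : profinite_completion) : profinite_completion :=
  mk_profinite (inv_compatible x).

Let mulA : associative profinite_mul.
Proof. by move=> x y z; apply: profinite_projP => N; exact: mulgA. Qed.
Let mul1 : left_id profinite_one profinite_mul.
Proof. by move=> x; apply: profinite_projP => N; exact: mul1g. Qed.
Let mulr1 : right_id profinite_one profinite_mul.
Proof. by move=> x; apply: profinite_projP => N; exact: mulg1. Qed.
Let mulV : left_inverse profinite_one profinite_inv profinite_mul.
Proof. by move=> x; apply: profinite_projP => N; exact: mulVg. Qed.
Let mulrV : right_inverse profinite_one profinite_inv profinite_mul.
Proof. by move=> x; apply: profinite_projP => N; exact: mulgV. Qed.

HB.instance Definition _ :=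
  isGroup.Build profinite_completion mulA mul1 mulr1 mulV mulrV.

Let completion_mapM : {morph completion_map : x y / x * y}.
Proof. by move=> x y; apply: profinite_projP => N; exact: gmulfM. Qed.
HB.instance Definition _ :=
  isMultiplicative.Build G profinite_completion completion_map completion_mapM.
HB.instance Definition _ :=
  Multiplicative_isUMagmaMorphism.Build G profinite_completion completion_map
    erefl.

End ProfiniteCompletion.

Record module_action (G : groupType) (A : zmodType) := ModuleAction {
  mact :> G -> A -> A;
  mact1 : forall a, mact 1 a = a;
  mactM : forall g h a, mact (g * h) a = mact g (mact h a);
  mactD : forall g a b, mact g (a + b)%R = (mact g a + mact g b)%R }.

Section Restriction.
Context {G H : groupType} {A : zmodType}.
Variables (f : UMagmaMorphism.type G H) (act : module_action H A).

Let pull1 a : act (f 1) a = a. Proof. by rewrite gmulf1 mact1. Qed.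
Let pullM g h a : act (f (g * h)) a = act (f g) (act (f h) a).
Proof. by rewrite gmulfM mactM. Qed.
Let pullD g a b : act (f g) (a + b)%R = (act (f g) a + act (f g) b)%R.
Proof. exact: mactD. Qed.

Definition pullback_action : module_action G A :=
  ModuleAction pull1 pullM pullD.

End Restriction.

(* Inhomogeneous cochains *)
Section Cohomology.
Context {G : groupType} {A : zmodType}.
Variable act : module_action G A.
Local Open Scope ring_scope.

Definition cochain (n : nat) : Type := ('I_n -> G) -> A.

(* (g_0, ..., g_n) |-> (g_0, ..., g_j g_(j+1), ..., g_n) *)
Definition merge (n : nat) (j : 'I_n) (x : 'I_n.+1 -> G) : 'I_n -> G :=
  fun i => if (i < j)%N then x (widen_ord (leqnSn n) i)
           else if i == j then
             (x (widen_ord (leqnSn n) i) * x (lift ord0 i))%g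
           else x (lift ord0 i).

Definition coboundary (n : nat) (f : cochain n) : cochain n.+1 := fun x =>
  act (x ord0) (f (fun i => x (lift ord0 i)))
  + \sum_(j < n) f (merge j x) *~ (-1) ^+ j.+1
  + f (fun i => x (widen_ord (leqnSn n) i)) *~ (-1) ^+ n.+1.

(* [C n] is the group of n-cochains under consideration: all of them for
   discrete cohomology, the continuous ones for continuous cohomology. *)
Variable C : forall n, set (cochain n).

Definition cocycles (n : nat) : set (cochain n) :=
  [set z | C z /\ forall x, coboundary z x = 0].

Definition coboundaries (n : nat) : set (cochain n) :=
  match n with
  | 0 => [set (fun=> 0)]
  | m.+1 => @coboundary m @` @C m
  end.

Definition cohomology_class (n : nat) (z : cochain n) : set (cochain n) :=
  [set w | exists2 b, coboundaries b & w = fun x => z x + b x].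

(* H^n, as the set of cosets of the coboundaries in the cocycles *)
Definition cohomology (n : nat) : set (set (cochain n)) :=
  @cohomology_class n @` @cocycles n.

End Cohomology.
Arguments cochain : clear implicits.
Arguments cohomology_class {G A} act C {n} z.
Arguments cohomology {G A} act C n.

Section CompletionCohomology.
Variables (G : groupType) (A : finZmodType).
Local Notation Ghat := (profinite_completion G).
Variable act : module_action Ghat A.

Definition continuous_action : Prop :=
  continuous (fun p : Ghat * discrete_topology A =>
    (act p.1 p.2 : discrete_topology A)).

Definition continuous_cochains (n : nat) : set (cochain Ghat A n) :=
  [set f | continuous (f : {ptws 'I_n -> Ghat} -> discrete_topology A)].

Definition all_cochains (n : nat) : set (cochain G A n) := setT.

Definition continuous_cohomology (n : nat) : set (set (cochain Ghat A n)) :=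
  cohomology act continuous_cochains n.

Local Notation act_G := (pullback_action (@completion_map G) act).

Definition discrete_cohomology (n : nat) : set (set (cochain G A n)) :=
  cohomology act_G all_cochains n.

(* the map on cohomology classes induced by c_G : [z] |-> [z \o c_G] *)
Definition completion_cohomology_map (n : nat)
    (c : set (cochain Ghat A n)) : set (cochain G A n) :=
  \bigcup_(z in c)
    cohomology_class act_G all_cochains
      (fun x : 'I_n -> G => z (fun i => completion_map (x i))).

End CompletionCohomology.
Arguments continuous_cohomology {G A} act n.
Arguments discrete_cohomology {G A} act n.
Arguments completion_cohomology_map {G A} act n c.

Definition class_A (n : nat) (G : groupType) : Prop :=
  forall (A : finZmodType) (act : module_action (profinite_completion G) A),
    continuous_action act ->
    (forall i, (i <= n)%N ->
      set_bij (continuous_cohomology act i) (discrete_cohomology act i)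
        (completion_cohomology_map act i)) /\
    set_inj (continuous_cohomology act n.+1)
      (completion_cohomology_map act n.+1).

Definition highly_residually_finite (G : groupType) : Prop :=
  residually_finite G /\ class_A 2 G.

(* Main.v *)
(* The class of groups all of whose extensions with finite kernel are residually
   finite consists of highly residually finite groups, and an extension of an
   ascending HNN extension with finite kernel is again of that kind, the series
   starting with one more finite factor.

   Residual finiteness.  An element of the base is handled by bounded detection:
   if no phi^k g is trivial, then there is a bound m such that every phi^k g is
   excluded by a subgroup of index at most m; the intersection of all subgroups
   of index at most m has finite index and is preserved by phi.  This property
   passes up the series.  For abelian factors it comes from Noetherian
   and torsion arguments.  For free factors it is the theorem of Borisov and
   Sapir: phi induces a polynomial self-map f, over F_p, of tuples of matrices;
   modulo the relations x^Q = f, with Q a large power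
   of p, precomposition with f is the Q-th power, so that the non-scalarity of
   phi^k g is controlled by powers of one non-nilpotent polynomial.

   Cohomology.  By compactness, continuous cochains on the profinite completion
   are the cochains on the group that are periodic modulo a normal subgroup of
   finite index.  A 2-cocycle is made periodic by a finite-index subgroup of the
   corresponding group extension that avoids the finite kernel.  In degree 3 a
   periodic coboundary w also bounds, in the functions on a finite quotient Q,
   the cochain u(x,y)(q) = q.w(q^-1,x,y), which is periodic, and the 2-cocycle
   u - b is treated as before. *)

Require Import Defs.
From HB Require Import structures.
From mathcomp Require Import all_boot all_order all_algebra.
From mathcomp Require mpoly ssrcomplements.
From Stdlib Require Import Classical_Prop.
From mathcomp Require Import zify.

Set Implicit Arguments.
Unset Strict Implicit.
Unset Printing Implicit Defensive.

Import GRing.Theory.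
Import Algebra.

(** * Words in a free group *)

(** In a finite quotient of the extension, [phi] acts on the image of the base as conjugation by the
    stable letter, hence bijectively. This is why residual finiteness of the base is not enough: an
    invariant subgroup of finite index may avoid [g] and still contain some [phi^k g], and then [g]
    dies in the quotients built from it. The uniform bound yields one invariant core avoiding the
    whole orbit; its eventual preimage under [phi] avoids it too, and modulo that preimage [phi] is
    injective, hence bijective. Climbing from a term [K] of the series to the next term [H] meets a
    second obstacle: a subgroup of finite index in [K] has to contain the trace on [K] of one in
    [H]. This is easy for finite [H / K], and for free or infinite cyclic [H / K] the extension
    splits. Polycyclic factors are therefore cut into cyclic ones here, although [phi] need not
    respect the cut; for detection they are cut along derived subgroups instead. Adjugates replace
    inverses in the matrix argument so that values of words are polynomial. The price is that words
    act only projectively, and triviality is tested by being scalar. *)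

Section Words.
Variable X : eqType.
Implicit Types (u v : word X).

Definition free_rel : word X -> word X -> Prop := fun _ _ => False.

Definition letter_inv (a : X * bool) : X * bool := (a.1, ~~ a.2).

Definition noncancelling (a b : X * bool) : bool := b != letter_inv a.

Lemma word_inv_cons a u : word_inv (a :: u) = word_inv u ++ [:: letter_inv a].
Proof. by rewrite /word_inv /= rev_cons cats1. Qed.

Lemma word_eq_reduced u :
  exists2 v, sorted noncancelling v & word_eq free_rel u v.
Proof.
elim: u => [|a u [v rv uv]]; first by exists [::] => //; apply: word_eq_refl.
have auv : word_eq free_rel (a :: u) (a :: v).
  exact: (word_eq_cat (word_eq_refl _ [:: a]) uv).
case: v rv uv auv => [|b v] rv uv auv; first by exists [:: a].
have [ba|ab] := eqVneq b (letter_inv a); last first.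
  by exists (a :: b :: v) => //; apply/andP.
exists v; first exact: path_sorted rv.
apply: word_eq_trans auv _; rewrite ba.
apply: (@word_eq_cat _ _ [:: a; letter_inv a] [::] v v); last first.
  exact: word_eq_refl.
by case: (a) => x b0; apply: word_eq_cancel.
Qed.

Definition word_subst (w : X -> word X) u : word X :=
  flatten [seq (if a.2 then w a.1 else word_inv (w a.1)) | a <- u].

End Words.

(** * Two-by-two matrices: adjugates, values of words, a faithful specialization *)

Section Matrices2.
Local Open Scope ring_scope.

(** The adjugate in its Cayley-Hamilton form. It inverts [M] up to the factor [\det M] without
    requiring that factor to be a unit, and it is linear in the entries. *)
Definition adj2 (A : comNzRingType) (M : 'M[A]_2) : 'M[A]_2 := (\tr M)%:M - M.

Section Adj2.
Variable A : comNzRingType.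
Implicit Types M P : 'M[A]_2.

Lemma ord2P (P : 'I_2 -> Prop) : P 0 -> P 1 -> forall i, P i.
Proof. by move=> P0 P1 [[|[|//]] lti]; [move: P0|move: P1]; congr P; apply: val_inj. Qed.

Lemma matrix2P M P : M 0 0 = P 0 0 -> M 0 1 = P 0 1 -> M 1 0 = P 1 0 ->
  M 1 1 = P 1 1 -> M = P.
Proof.
by move=> *; apply/matrixP; elim/ord2P; elim/ord2P.
Qed.

Lemma mulmx2E M P i j : (M *m P) i j = M i 0 * P 0 j + M i 1 * P 1 j.
Proof. by rewrite mxE !big_ord_recl big_ord0 addr0; congr (_ + M i _ * P _ j); apply: val_inj. Qed.

Lemma mxtrace2 M : \tr M = M 0 0 + M 1 1.
Proof. by rewrite /mxtrace !big_ord_recl big_ord0 addr0; congr (_ + M _ _); apply: val_inj. Qed.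

Lemma adj2E M : ((adj2 M 0 0 = M 1 1) * (adj2 M 0 1 = - M 0 1) *
  (adj2 M 1 0 = - M 1 0) * (adj2 M 1 1 = M 0 0))%type.
Proof.
do !split; rewrite /adj2 !mxE mxtrace2 ?mulr1n ?mulr0n ?sub0r //.
  by rewrite [_ + M 1 1]addrC addrK.
by rewrite addrK.
Qed.

Lemma adj2M M P : adj2 (M *m P) = adj2 P *m adj2 M.
Proof.
apply: matrix2P; rewrite !(adj2E, mulmx2E) ?mulrN ?mulNr ?opprK ?opprD.
- by rewrite addrC mulrC [M 1 0 * _]mulrC.
- by rewrite addrC mulrC [M 0 0 * _]mulrC.
- by rewrite addrC mulrC [M 1 0 * _]mulrC.
- by rewrite addrC mulrC [M 0 0 * _]mulrC.
Qed.

Lemma det2 M : \det M = M 0 0 * M 1 1 - M 0 1 * M 1 0.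
Proof.
have i0 (i : 'I_1) : lift (0 : 'I_2) i = 1 by rewrite (ord1 i); apply: val_inj.
have i1 (i : 'I_1) : lift (1 : 'I_2) i = 0 by rewrite (ord1 i); apply: val_inj.
rewrite (expand_det_row M 0) !big_ord_recl big_ord0 addr0 i0.
rewrite /cofactor !det_mx11 !mxE i0 i1 /= expr0 mul1r.
by rewrite expr1 mulN1r mulrN.
Qed.

Lemma mul_adj2 M : M *m adj2 M = (\det M)%:M.
Proof.
apply: matrix2P; rewrite !(adj2E, mulmx2E) ?mulrN !mxE det2 ?mulr1n ?mulr0n.
- by [].
- by rewrite addrC mulrC subrr.
- by rewrite mulrC subrr.
- by rewrite addrC mulrC [M 1 0 * _]mulrC.
Qed.

Lemma adj2K : involutive (@adj2 A).
Proof. by move=> M; apply: matrix2P; rewrite !adj2E ?opprK. Qed.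

Lemma adj2_sub_scalar M c : adj2 (M - c%:M) = adj2 M - c%:M.
Proof.
apply: matrix2P; rewrite adj2E [RHS]mxE adj2E !mxE ?mulr1n ?mulr0n //;
  by rewrite !oppr0 !addr0.
Qed.

Lemma det_adj2 M : \det (adj2 M) = \det M.
Proof. by rewrite !det2 !adj2E mulrNN mulrC. Qed.

Lemma mul_adj2l M : adj2 M *m M = (\det M)%:M.
Proof. by rewrite -{2}[M]adj2K mul_adj2 det_adj2. Qed.

(* [M] is scalar exactly when these vanish for all [i], [j]. *)
Definition nonscalar_part (i j : 'I_2) M : A :=
  if i == j then M 0 0 - M 1 1 else M i j.

End Adj2.

Lemma map_adj2 (A B : comNzRingType) (g : {rmorphism A -> B}) (M : 'M[A]_2) :
  map_mx g (adj2 M) = adj2 (map_mx g M).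
Proof. by apply: matrix2P; rewrite adj2E mxE adj2E ?rmorphN mxE. Qed.

Section WordValue.
Variables (A : comNzRingType) (n : nat) (Z : 'I_n -> 'M[A]_2).
Implicit Types u v : word 'I_n.

Definition letter_value (a : 'I_n * bool) : 'M[A]_2 :=
  if a.2 then Z a.1 else adj2 (Z a.1).

(* inverses are replaced by adjugates, so that the value is polynomial in [Z] *)
Definition word_value u : 'M[A]_2 := \prod_(a <- u) letter_value a.

Lemma word_value_cons a u :
  word_value (a :: u) = letter_value a *m word_value u.
Proof. by rewrite /word_value big_cons. Qed.

Lemma word_value_cat u v : word_value (u ++ v) = word_value u *m word_value v.
Proof. by rewrite /word_value big_cat. Qed.

Lemma letter_value_inv a : letter_value (letter_inv a) = adj2 (letter_value a).
Proof. by case: a => x [] //=; rewrite /letter_value /= adj2K. Qed.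

Lemma adj21 : adj2 (1 : 'M[A]_2) = 1.
Proof. by apply: matrix2P; rewrite adj2E !mxE ?oppr0. Qed.

Lemma word_value_inv u : word_value (word_inv u) = adj2 (word_value u).
Proof.
elim: u => [|a u IH]; first by rewrite /word_value !big_nil adj21.
rewrite word_inv_cons word_value_cat IH word_value_cons adj2M.
by rewrite word_value_cons letter_value_inv /word_value big_nil mulmx1.
Qed.

Lemma det_letter a : \det (letter_value a) = \det (Z a.1).
Proof. by rewrite /letter_value; case: a.2; rewrite ?det_adj2. Qed.

Lemma word_value_inv_mul u :
  word_value (word_inv u) *m word_value u = (\det (word_value u))%:M.
Proof. by rewrite word_value_inv mul_adj2l. Qed.

Section Proportional.
Variable S : A -> Prop.
Hypotheses (S1 : S 1) (SM : forall a b, S a -> S b -> S (a * b)).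
Hypothesis Sdet : forall i, S (\det (Z i)).

Lemma det_word_value u : S (\det (word_value u)).
Proof.
elim: u => [|a u IH]; first by rewrite /word_value big_nil det1.
by rewrite word_value_cons det_mulmx det_letter; apply: SM.
Qed.

(** Cancelling a letter against its inverse multiplies the value by a determinant, so freely equal
    words have values that agree only up to factors from a multiplicative set containing the
    determinants. It is used with [S] the nonzero polynomials and with [S] the elements that are
    regular modulo an ideal. *)
Lemma word_eq_proportional u v : word_eq (@free_rel _) u v ->
  exists s t, [/\ S s, S t & s *: word_value u = t *: word_value v].
Proof.
elim=> {u v} [u|u v _ [s [t [Ss St st]]]|u v w _ [s [t [Ss St st]]]
  _ [s' [t' [Ss' St' st']]]|u u' v v' _ [s [t [Ss St st]]]
  _ [s' [t' [Ss' St' st']]]|x b|//].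
- by exists 1, 1.
- by exists t, s.
- exists (s' * s), (t * t'); split; try exact: SM.
  by rewrite -!scalerA st -st' !scalerA mulrC.
- exists (s * s'), (t * t'); split; try exact: SM.
  rewrite !word_value_cat -!scalerA !scalemxAr -[in LHS]scalemxAr st'.
  by rewrite scalemxAl st -scalemxAl -scalemxAr.
exists 1, (\det (letter_value (x, b))); split => //.
  by rewrite det_letter.
rewrite scale1r !word_value_cons /word_value big_nil mulmx1.
by rewrite (letter_value_inv (x, b)) mul_adj2 scalemx1.
Qed.

End Proportional.
End WordValue.

Lemma word_value_subst (A : comNzRingType) (n : nat) (Z : 'I_n -> 'M[A]_2) w u :
  word_value Z (word_subst w u) = word_value (fun i => word_value Z (w i)) u.
Proof.
elim: u => [|a u IH]; first by rewrite /word_value !big_nil.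
rewrite word_value_cons -IH /word_subst /= word_value_cat; congr (_ *m _).
by rewrite /letter_value; case: a.2; rewrite ?word_value_inv.
Qed.

Lemma map_word_value (A B : comNzRingType) (g : {rmorphism A -> B}) (n : nat)
    (Z : 'I_n -> 'M[A]_2) u :
  map_mx g (word_value Z u) = word_value (fun i => map_mx g (Z i)) u.
Proof.
elim: u => [|a u IH]; first by rewrite /word_value !big_nil map_mx1.
rewrite !word_value_cons map_mxM IH; congr (_ *m _).
by rewrite /letter_value; case: a.2 => //; rewrite map_adj2.
Qed.

Lemma eq_word_value (A : comNzRingType) (n : nat) (Z Z' : 'I_n -> 'M[A]_2) u :
  Z =1 Z' -> word_value Z u = word_value Z' u.
Proof.
by move=> ZZ; apply: eq_bigr => a _; rewrite /letter_value ZZ.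
Qed.

(* The matrices [t E_i + 1] with [E_i = (1, i) (1, i)^T] have leading
   coefficients of rank one; a reduced word is therefore a polynomial matrix
   whose leading coefficient is a nonzero matrix of rank one. *)
Section Specialization.
Variables (F : fieldType) (n : nat).
Hypothesis F_big : forall i j : 'I_n, i%:R = j%:R :> F -> i = j.
Hypothesis F_big' : forall i j : 'I_n, 1 + i%:R * j%:R != 0 :> F.

(** The adjugate of [1 + X v v^T] is [1 + X v' v'^T] with [v'] the quarter turn of [v], which sends
    [(1, i)] to [(i, -1)]. Two such vectors have product [1 + i j] or, up to sign, [i - j]; so
    orthogonality occurs only between a letter and its inverse. *)
Definition lead_vec (a : 'I_n * bool) : 'cV[F]_2 :=
  \col_r (if a.2 then (if r == 0 then 1 else (a.1 : nat)%:R)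
          else (if r == 0 then (a.1 : nat)%:R else - 1)).

Definition lead_mx a : 'M[F]_2 := lead_vec a *m (lead_vec a)^T.

Definition special (i : 'I_n) : 'M[{poly F}]_2 :=
  'X *: map_mx polyC (lead_mx (i, true)) + 1.

Lemma lead_mxE a i j : lead_mx a i j = lead_vec a i 0 * lead_vec a j 0.
Proof. by rewrite mxE big_ord1 [_^T _ _]mxE. Qed.

Lemma special_letter a :
  letter_value special a = 'X *: map_mx polyC (lead_mx a) + 1.
Proof.
case: a => i [] //; rewrite /letter_value /=.
have E (M : 'M[F]_2) r s :
    ('X *: map_mx polyC M + 1) r s = 'X * (M r s)%:P + (r == s)%:R.
  by rewrite !mxE.
apply: matrix2P; rewrite adj2E !E !lead_mxE !mxE /= ?mul1r ?mulr1 ?mulrN1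
  ?mulN1r ?opprK ?mulr0n ?addr0 //.
- by rewrite [in RHS]polyCN mulrN.
- by rewrite [in RHS]polyCN mulrN.
- by rewrite mulr1.
Qed.

Lemma lead_vec_mul a b : noncancelling a b ->
  ((lead_vec a)^T *m lead_vec b) 0 0 != 0.
Proof.
rewrite mxE !big_ord_recl big_ord0 addr0 !mxE /=.
case: a b => [i s] [j t]; rewrite /noncancelling /letter_inv /=.
rewrite xpair_eqE negb_and; case: s t => [] [] /=; rewrite ?orbT ?orbF.
- by rewrite mul1r.
- move=> ji; rewrite mul1r mulrN1 subr_eq0.
  by apply: contra_neq ji => /F_big.
- move=> ji; rewrite mulr1 mulN1r subr_eq0.
  by apply: contra_neq ji => /F_big.
- by rewrite mulrNN mulr1 addrC.
Qed.

Lemma lead_vec_neq0 a : lead_vec a != 0.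
Proof.
apply/eqP => /matrixP a0; case: a a0 => i [] a0.
  by have := a0 0 0; rewrite !mxE /= => /eqP; rewrite oner_eq0.
by have := a0 1 0; rewrite !mxE /= => /eqP; rewrite oppr_eq0 oner_eq0.
Qed.

(** A product [v_a v_a^T v_b z] of leading coefficients collapses to [(v_a . v_b) v_a z], and the
    scalar is nonzero because neighbouring letters do not cancel. *)
Lemma special_lead a u : sorted (@noncancelling _) (a :: u) ->
  exists z : 'rV[F]_2, [/\ z != 0,
    map_mx (coefp (size u).+1) (word_value special (a :: u)) = lead_vec a *m z &
    forall k, ((size u).+1 < k)%N ->
      map_mx (coefp k) (word_value special (a :: u)) = 0].
Proof.
have coefX k (M : 'M[F]_2) (P : 'M[{poly F}]_2) :
    map_mx (coefp k.+1) (('X *: map_mx polyC M + 1) *m P) =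
    M *m map_mx (coefp k) P + map_mx (coefp k.+1) P.
  rewrite mulmxDl mul1mx -scalemxAl map_mxD; congr (_ + _).
  apply/matrixP => i j; rewrite !mxE /= coefXM /= coef_sum.
  by apply: eq_bigr => l _; rewrite !mxE coefCM.
elim: u a => [|b u IH] a.
  move=> _; exists (lead_vec a)^T; split.
  - by apply: contra_neq (lead_vec_neq0 a) => a0; rewrite -[lead_vec a]trmxK a0 trmx0.
  - rewrite word_value_cons special_letter /word_value big_nil coefX.
    suff -> : map_mx (coefp 0) (1 : 'M[{poly F}]_2) = 1.
      suff -> : map_mx (coefp 1) (1 : 'M[{poly F}]_2) = 0 by rewrite addr0 mulmx1.
      by apply/matrixP => i j; rewrite !mxE /= coefMn coef1 mul0rn.
    by apply/matrixP => i j; rewrite !mxE /= coefMn coef1.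
  case=> [//|k] k1; rewrite word_value_cons special_letter /word_value big_nil.
  have coef1x l : (0 < l)%N -> map_mx (coefp l) (1 : 'M[{poly F}]_2) = 0.
    by move=> l0; apply/matrixP => i j; rewrite !mxE /= coefMn coef1 eqn0Ngt l0 mul0rn.
  by rewrite coefX !coef1x // mulmx0 addr0.
move=> /= /andP[ab bu]; have [z [z0 lead high]] := IH b bu.
exists (((lead_vec a)^T *m lead_vec b) 0 0 *: z); split.
- by rewrite scaler_eq0 negb_or lead_vec_mul.
- rewrite word_value_cons special_letter coefX lead high // addr0.
  rewrite /lead_mx -mulmxA [in LHS](mulmxA (lead_vec a)^T).
  by rewrite [X in _ *m (X *m _)]mx11_scalar mul_scalar_mx.
case=> [//|k] ku; rewrite word_value_cons special_letter coefX !high //.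
  by rewrite mulmx0 addr0.
exact: ltnW.
Qed.

(** A nonzero scalar matrix has rank two, whereas the leading coefficient has rank one. *)
Lemma special_nonscalar u : sorted (@noncancelling _) u -> u != [::] ->
  exists i j, nonscalar_part i j (word_value special u) != 0.
Proof.
case: u => [//|a u] red _; have [z [z0 lead _]] := special_lead red.
move: (word_value special _) lead => M lead.
have leadE i j : (M i j)`_(size u).+1 = lead_vec a i 0 * z 0 j.
  have := congr1 (fun P : 'M[F]_2 => P i j) lead.
  by rewrite mxE [RHS]mxE big_ord1.
apply: NNPP => scal; have part0 i j : nonscalar_part i j M = 0.
  by apply/eqP/negPn/negP => ij; apply: scal; exists i, j.
have := part0 0 1; rewrite /nonscalar_part /= => M01.
have := part0 1 0; rewrite /nonscalar_part /= => M10.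
have := part0 0 0; rewrite /nonscalar_part /= => /eqP; rewrite subr_eq0 => /eqP M00.
have := leadE 0 1; rewrite M01 coef0 => /esym/eqP; rewrite mulf_eq0 => e01.
have := leadE 1 0; rewrite M10 coef0 => /esym/eqP; rewrite mulf_eq0 => e10.
have := leadE 0 0; rewrite M00 leadE => e00.
have va : lead_vec a = 0 -> False by move/eqP; rewrite (negPf (lead_vec_neq0 a)).
have vz : z = 0 -> False by move/eqP; rewrite (negPf z0).
have zP : z 0 0 = 0 -> z 0 1 = 0 -> False.
  by move=> z1 z2; apply: vz; apply/matrixP => i j; rewrite (ord1 i) [RHS]mxE; elim/ord2P: j.
have aP : lead_vec a 0 0 = 0 -> lead_vec a 1 0 = 0 -> False.
  by move=> z1 z2; apply: va; apply/matrixP => i j; rewrite (ord1 j) [RHS]mxE; elim/ord2P: i.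
case/orP: e01 e00 => /eqP e01; rewrite e01 ?mul0r ?mulr0 => /eqP.
  rewrite mulf_eq0 => /orP[|] /eqP e2; first exact: aP.
  by case/orP: e10 => /eqP e3; [apply: aP|apply: zP].
rewrite eq_sym mulf_eq0 => /orP[|] /eqP e2; last exact: zP.
by case/orP: e10 => /eqP e3; [apply: aP|apply: zP].
Qed.

Lemma det_special i : \det (special i) != 0.
Proof.
apply/eqP => /(congr1 (fun q : {poly F} => q.[0])).
rewrite horner0 -(horner_evalE 0) -det_map_mx.
suff -> : map_mx (horner_eval 0) (special i) = 1.
  by rewrite det1 => /eqP; rewrite oner_eq0.
apply/matrixP => r s; rewrite !mxE /= horner_evalE !hornerE.
by case: (r == s); rewrite ?mulr1n ?mulr0n ?hornerE.
Qed.

End Specialization.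
End Matrices2.

(** * Iterates of a self-map of a free group, detected over a finite field *)

Module SeparatingWords.
Import mpoly ssrcomplements.
Local Open Scope ring_scope.

(** * Linear maps on polynomials prescribed on monomials *)

Section LinearExtension.
Variables (n : nat) (K : comNzRingType) (h : 'X_{1..n} -> {mpoly K[n]}).

Definition lin_ext (P : {mpoly K[n]}) : {mpoly K[n]} :=
  \sum_(m <- msupp P) P@_m *: h m.

Lemma lin_extE P k : (msize P <= k)%N ->
  lin_ext P = \sum_(m : 'X_{1..n < k}) P@_m *: h m.
Proof.
move=> le_pi; set I : subFinType _ := 'X_{1..n < k}.
rewrite /lin_ext (big_mksub I) ?msupp_uniq //=; first last.
  by move=> x /msize_mdeg_lt /leq_trans; apply.
by rewrite big_rmcond //= => j /memN_msupp_eq0 ->; rewrite scale0r.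
Qed.

Lemma lin_extB : {morph lin_ext : P P' / P - P'}.
Proof.
move=> P P'; pose k := maxn (msize (P - P')) (maxn (msize P) (msize P')).
have [k1 [k2 k3]] : (msize (P - P') <= k)%N /\ (msize P <= k)%N /\ (msize P' <= k)%N.
  by rewrite /k; lia.
rewrite (lin_extE k1) (lin_extE k2) (lin_extE k3) -sumrB.
by apply: eq_bigr => m _; rewrite mcoeffB scalerBl.
Qed.

Lemma lin_ext0 : lin_ext 0 = 0.
Proof. by have := lin_extB 0 0; rewrite !subrr. Qed.

Lemma lin_extD : {morph lin_ext : P P' / P + P'}.
Proof.
move=> P P'; have lin_extN Y : lin_ext (- Y) = - lin_ext Y.
  by rewrite -[- Y]sub0r lin_extB lin_ext0 sub0r.
by rewrite -[P' in LHS]opprK lin_extB lin_extN opprK.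
Qed.

Lemma lin_extZ c P : lin_ext (c *: P) = c *: lin_ext P.
Proof.
pose k := maxn (msize P) (msize (c *: P)).
have [k1 k2] : (msize P <= k)%N /\ (msize (c *: P) <= k)%N.
  by rewrite /k; lia.
rewrite (lin_extE k1) (lin_extE k2) scaler_sumr.
by apply: eq_bigr => m _; rewrite mcoeffZ scalerA.
Qed.

Lemma lin_extX m : lin_ext 'X_[m] = h m.
Proof. by rewrite /lin_ext msuppX big_seq1 mcoeffX eqxx scale1r. Qed.

End LinearExtension.

(** * Reduction modulo the relations [x^Q = f] *)

Section FrobeniusIdeal.
Variables (F : fieldType) (N : nat) (f : 'I_N -> {mpoly F[N]}) (Q : nat).
Local Notation R := {mpoly F[N]}.
Implicit Types P Y c : R.

Definition frob_rel (v : 'I_N) : R := 'X_v ^+ Q - f v.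

Definition in_frob (P : R) : Prop :=
  exists c : 'I_N -> R, P = \sum_v c v * frob_rel v.

Lemma in_frob0 : in_frob 0.
Proof. by exists (fun=> 0); rewrite big1 // => v _; rewrite mul0r. Qed.

Lemma in_frobD P Y : in_frob P -> in_frob Y -> in_frob (P + Y).
Proof.
move=> [c ->] [d ->]; exists (fun v => c v + d v).
by rewrite -big_split /=; apply: eq_bigr => v _; rewrite mulrDl.
Qed.

Lemma in_frobMl Y P : in_frob P -> in_frob (Y * P).
Proof.
move=> [c ->]; exists (fun v => Y * c v).
by rewrite mulr_sumr; apply: eq_bigr => v _; rewrite mulrA.
Qed.

Lemma in_frobN P : in_frob P -> in_frob (- P).
Proof. by move=> /(in_frobMl (-1)); rewrite mulN1r. Qed.

Lemma in_frobB P Y : in_frob P -> in_frob Y -> in_frob (P - Y).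
Proof. by move=> ? /in_frobN; apply: in_frobD. Qed.

Lemma in_frob_sum (I : Type) (r : seq I) (B : pred I) (G : I -> R) :
  (forall i, B i -> in_frob (G i)) -> in_frob (\sum_(i <- r | B i) G i).
Proof. by move=> GI; elim/big_ind: _ => //; [exact: in_frob0|exact: in_frobD]. Qed.

Lemma in_frob_rel v : in_frob (frob_rel v).
Proof.
exists (fun w => (w == v)%:R).
rewrite (bigD1 v) //= eqxx mul1r big1 ?addr0 // => w /negPf ->.
by rewrite mul0r.
Qed.

Hypothesis f_small : forall v, (msize (f v) <= Q)%N.

(* The span of the multiples [c * frob_rel v] of formal degree below [d];
   the truncated subtraction makes it 0 when [d <= Q]. *)
Definition frob_below (d : nat) (P : R) : Prop :=
  exists2 c : 'I_N -> R,
    P = \sum_v c v * frob_rel v & forall v, (msize (c v) <= d - Q)%N.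

Lemma frob_below0 d : frob_below d 0.
Proof.
exists (fun=> 0); first by rewrite big1 // => v _; rewrite mul0r.
by move=> v; rewrite msize0.
Qed.

Lemma frob_belowD d P Y :
  frob_below d P -> frob_below d Y -> frob_below d (P + Y).
Proof.
move=> [c -> sc] [e -> se]; exists (fun v => c v + e v).
  by rewrite -big_split /=; apply: eq_bigr => v _; rewrite mulrDl.
by move=> v; apply: leq_trans (msizeD_le _ _) _; rewrite geq_max sc se.
Qed.

Lemma frob_belowZ d a P : frob_below d P -> frob_below d (a *: P).
Proof.
move=> [c -> sc]; exists (fun v => a *: c v).
  by rewrite scaler_sumr; apply: eq_bigr => v _; rewrite scalerAl.
by move=> v; apply: leq_trans (msizeZ_le _ _) _.
Qed.

Lemma frob_below_sub d e P :
  (d <= e)%N -> frob_below d P -> frob_below e P.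
Proof.
move=> de [c -> sc]; exists c => // v.
by apply: leq_trans (sc v) _; apply: leq_sub2r.
Qed.

Lemma msize_fM v c k : (msize c <= k)%N -> (msize (f v * c) <= (Q + k).-1)%N.
Proof.
move=> ck; have [->|f0] := eqVneq (f v) 0; first by rewrite mul0r msize0.
have [->|c0] := eqVneq c 0; first by rewrite mulr0 msize0.
rewrite msizeM //; have := f_small v.
move: (msize (f v)) (msize c) ck => a b; lia.
Qed.

Lemma frob_belowM d v P : frob_below d P -> frob_below (d + Q) (f v * P).
Proof.
move=> [c -> sc]; exists (fun w => f v * c w).
  by rewrite mulr_sumr; apply: eq_bigr => w _; rewrite mulrA.
move=> w; have [->|cw0] := eqVneq (c w) 0; first by rewrite mulr0 msize0.
have cw_gt0 : (0 < msize (c w))%N by rewrite lt0n msize_poly_eq0.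
apply: leq_trans (msize_fM v (leqnn _)) _.
by move: (msize (c w)) cw_gt0 (sc w) => z; lia.
Qed.

(* [x^m |-> x^(m mod Q) * f^(m div Q)] *)
Definition rewrite_mnm (m : 'X_{1..N}) : R :=
  'X_[[multinom (m i %% Q)%N | i < N]] * \prod_i f i ^+ (m i %/ Q).

Definition frob_rewrite : R -> R := lin_ext rewrite_mnm.
Local Notation rho := frob_rewrite.

Lemma frob_rewrite0 : rho 0 = 0. Proof. exact: lin_ext0. Qed.
Lemma frob_rewriteD : {morph rho : P Y / P + Y}. Proof. exact: lin_extD. Qed.
Lemma frob_rewriteB : {morph rho : P Y / P - Y}. Proof. exact: lin_extB. Qed.
Lemma frob_rewriteZ a P : rho (a *: P) = a *: rho P.
Proof. exact: lin_extZ. Qed.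
Lemma frob_rewriteX m : rho 'X_[m] = rewrite_mnm m.
Proof. exact: lin_extX. Qed.

Hypothesis Q_gt0 : (0 < Q)%N.

Definition reduced_mnm (m : 'X_{1..N}) : bool := [forall i, (m i < Q)%N].

Lemma rewrite_reduced m : reduced_mnm m -> rewrite_mnm m = 'X_[m].
Proof.
move=> /forallP m_red; rewrite /rewrite_mnm big1 ?mulr1.
  by congr mpolyX; apply/mnmP => i; rewrite mnmE modn_small.
by move=> i _; rewrite divn_small.
Qed.

Lemma rewrite_mnmD m v :
  rewrite_mnm (U_(v) *+ Q + m) = f v * rewrite_mnm m.
Proof.
rewrite /rewrite_mnm mulrCA; congr (_ * _).
  congr mpolyX; apply/mnmP => i; rewrite !mnmE.
  by rewrite mulmnE mnm1E modnMDl.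
rewrite [in LHS](bigD1 v) // [in RHS](bigD1 v) //= mulrA.
rewrite mnmDE mulmnE mnm1E eqxx mul1n divnDl // divnn Q_gt0 exprD.
congr (_ * _); apply: eq_bigr => i iv.
by rewrite mnmDE mulmnE mnm1E eq_sym (negPf iv).
Qed.

(** All exponents are divided by [Q] simultaneously, so adding [Q] to one exponent only adds one
    factor [f v]. Hence this holds for every [P], reduced or not, although [rho] is not
    multiplicative. *)
Lemma frob_rewriteM v P : rho ('X_v ^+ Q * P) = f v * rho P.
Proof.
elim/mpolyind: P => [|c m P _ _ IH]; first by rewrite mulr0 frob_rewrite0 mulr0.
rewrite mulrDr frob_rewriteD IH [in RHS]frob_rewriteD mulrDr; congr (_ + _).
rewrite -scalerAr !frob_rewriteZ -scalerAr; congr (_ *: _).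
by rewrite mpolyXn -mpolyXD !frob_rewriteX rewrite_mnmD.
Qed.

Lemma not_reducedP m : ~~ reduced_mnm m ->
  exists v m', m = (U_(v) *+ Q + m')%MM.
Proof.
move=> /forallPn [v]; rewrite -leqNgt => Qm.
exists v, (m - U_(v) *+ Q)%MM.
rewrite addmC submK //; apply/mnm_lepP => i; rewrite mulmnE mnm1E.
by case: eqP => [<-|_]; rewrite ?mul1n.
Qed.

(** One factor [x_v^Q] is split off: the difference is a multiple of one relation plus [f v] times
    the difference for the smaller monomial. Formal degrees stay bounded because [f v] has degree
    below [Q]. *)
Lemma rewrite_mnm_below m :
  frob_below (mdeg m).+1 ('X_[m] - rho 'X_[m]).
Proof.
have [s] := ubnP (mdeg m); elim: s m => // s IH m; rewrite ltnS => ms.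
have [m_red|/not_reducedP[v [m' mE]]] := boolP (reduced_mnm m).
  by rewrite frob_rewriteX rewrite_reduced // subrr; apply: frob_below0.
have degE : mdeg m = (Q + mdeg m')%N by rewrite mE mdegD mdegMn mdeg1 mul1n.
have -> : 'X_[m] - rho 'X_[m] =
  'X_[m'] * frob_rel v + f v * ('X_[m'] - rho 'X_[m']).
  rewrite mE mpolyXD -mpolyXn frob_rewriteM /frob_rel !mulrBr [_ * f v]mulrC.
  by rewrite addrA subrK ['X_[m'] * _]mulrC.
apply: frob_belowD.
  exists (fun w => (w == v)%:R * 'X_[m']).
    rewrite (bigD1 v) //= eqxx mul1r big1 ?addr0 // => w /negPf ->.
    by rewrite !mul0r.
  move=> w; case: eqP => _; last by rewrite mul0r msize0.
  by rewrite mul1r msizeX degE; lia.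
apply: (@frob_below_sub ((mdeg m').+1 + Q)); first by lia.
by apply/frob_belowM/IH; lia.
Qed.

Lemma rewrite_below P : frob_below (msize P) (P - rho P).
Proof.
rewrite [X in X - _](mpolyE P) /rho /lin_ext -sumrB big_seq.
elim/big_ind: _ => [||m mP]; first exact: frob_below0.
  exact: frob_belowD.
rewrite -scalerBr; apply: frob_belowZ.
apply: frob_below_sub (msize_mdeg_lt mP) _.
by have := rewrite_mnm_below m; rewrite frob_rewriteX.
Qed.

Definition rewrites_to0 P := exists k, iter k rho P = 0.

Lemma iter_rho0 k : iter k rho 0 = 0.
Proof. by elim: k => //= k ->; rewrite frob_rewrite0. Qed.

Lemma iter_rhoD k : {morph iter k rho : P Y / P + Y}.
Proof. by move=> P Y; elim: k => //= k ->; rewrite frob_rewriteD. Qed.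

Lemma rewrites_to0D P Y :
  rewrites_to0 P -> rewrites_to0 Y -> rewrites_to0 (P + Y).
Proof.
move=> [k Pk] [l Yl]; exists (k + l)%N; rewrite iter_rhoD.
by rewrite addnC iterD Pk addnC iterD Yl !iter_rho0 addr0.
Qed.

Lemma rewrites_to0_sum (c : 'I_N -> R) : (forall v, rewrites_to0 (c v * frob_rel v)) ->
  rewrites_to0 (\sum_v c v * frob_rel v).
Proof.
move=> c0; elim/big_ind: _ => //; first by exists 0%N.
exact: rewrites_to0D.
Qed.

(** Applied to [c * (x_v^Q - f v)], [rho] leaves only the errors [c - rho c] and
    [f v * c - rho (f v * c)]. Both are combinations of relations, and after multiplying the first
    by [f v] all coefficients are smaller than [c], so induction on the size of [c] applies.
    Iteration is needed because the products of [f] created by [rho] need not be reduced. *)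
Lemma rewrites_to0M c v : rewrites_to0 (c * frob_rel v).
Proof.
have [s] := ubnP (msize c); elim: s c v => // s IH c v; rewrite ltnS => cs.
have [->|c0] := eqVneq c 0; first by rewrite mul0r; exists 0%N.
have c_gt0 : (0 < msize c)%N by rewrite lt0n msize_poly_eq0.
suff [k rk] : rewrites_to0 (rho (c * frob_rel v)).
  by exists k.+1; rewrite iterSr.
have -> : rho (c * frob_rel v) =
    (- f v) * (c - rho c) + (f v * c - rho (f v * c)).
  rewrite /frob_rel mulrBr [c * _]mulrC [c * f v]mulrC frob_rewriteB.
  by rewrite frob_rewriteM mulNr mulrBr opprB addrA subrK.
apply: rewrites_to0D.
  have [e -> se] := rewrite_below c.
  rewrite mulr_sumr; under eq_bigr => w _ do rewrite mulrA.
  apply: rewrites_to0_sum => w.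
  have [->|ew0] := eqVneq (e w) 0; first by exists 0%N; rewrite /= mulr0 mul0r.
  apply: IH; rewrite mulNr msizeN.
  have ew_gt0 : (0 < msize (e w))%N by rewrite lt0n msize_poly_eq0.
  apply: leq_ltn_trans (msize_fM v (leqnn _)) _.
  by move: (msize (e w)) (msize c) ew_gt0 (se w) c_gt0 cs => x y; lia.
have [e -> se] := rewrite_below (f v * c).
apply: rewrites_to0_sum => w; apply: IH.
have := msize_fM v (leqnn (msize c)); have := se w.
by move: (msize (e w)) (msize (f v * c)) (msize c) c_gt0 cs => x y z; lia.
Qed.

(* The leading monomials of the relations are pairwise coprime, so the
   reduced monomials stay independent modulo the ideal. *)
Lemma in_frob_small P : in_frob P -> (msize P <= Q)%N -> P = 0.
Proof.
move=> [c PE] sP.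
have [k] : rewrites_to0 P.
  by rewrite PE; apply: rewrites_to0_sum => v; apply: rewrites_to0M.
have rhoP : rho P = P.
  rewrite /rho /lin_ext [RHS]mpolyE big_seq [RHS]big_seq.
  apply: eq_bigr => m mP; rewrite rewrite_reduced //; apply/forallP => i.
  apply: leq_trans sP; apply: leq_ltn_trans (msize_mdeg_lt mP).
  by rewrite mdegE (bigD1 i) //= leq_addr.
suff -> : iter k rho P = P by [].
by elim: k => //= k ->.
Qed.

Definition reduced P := forall m, m \in msupp P -> reduced_mnm m.

Lemma reducedD P Y : reduced P -> reduced Y -> reduced (P + Y).
Proof.
by move=> rP rY m /msuppD_le; rewrite mem_cat => /orP[/rP|/rY].
Qed.

Lemma reduced_repr P : exists2 P0, reduced P0 & in_frob (P - P0).
Proof.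
have [s] := ubnP (msize P); elim: s P => // s IH P; rewrite ltnS => sP.
rewrite (mpolyE P) big_seq.
elim/big_ind: _ => [|Y1 Y2 [Z1 r1 i1] [Z2 r2 i2]|m mP].
- by exists 0; [move=> m; rewrite msupp0 | rewrite subrr; apply: in_frob0].
- exists (Z1 + Z2); first exact: reducedD.
  by rewrite opprD addrACA; apply: in_frobD.
suff [Y rY iY] : exists2 P0, reduced P0 & in_frob ('X_[m] - P0).
  exists (P@_m *: Y); first by move=> k /msuppZ_le /rY.
  by rewrite -scalerBr -mul_mpolyC; apply: in_frobMl.
have [m_red|/not_reducedP[v [m' mE]]] := boolP (reduced_mnm m).
  exists 'X_[m]; last by rewrite subrr; apply: in_frob0.
  by move=> k; rewrite msuppX inE => /eqP ->.
have [|Y rY iY] := IH (f v * 'X_[m']).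
  have sm := leq_trans (msize_mdeg_lt mP) sP.
  have degE : mdeg m = (Q + mdeg m')%N by rewrite mE mdegD mdegMn mdeg1 mul1n.
  have := @msize_fM v 'X_[m'] (mdeg m').+1; rewrite msizeX leqnn => /(_ isT).
  by move: (msize _) sm => z; lia.
exists Y => //.
have -> : 'X_[m] - Y = 'X_[m'] * frob_rel v + (f v * 'X_[m'] - Y).
  by rewrite mE mpolyXD -mpolyXn /frob_rel mulrBr addrA [_ * f v]mulrC subrK mulrC.
by apply: in_frobD => //; apply/in_frobMl/in_frob_rel.
Qed.

End FrobeniusIdeal.

Section Digits.
Implicit Types (n Q d : nat).

Lemma digits_lt n Q (e : 'I_n -> nat) : (forall i, (e i < Q)%N) ->
  (\sum_(i < n) e i * Q ^ i < Q ^ n)%N.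
Proof.
elim: n e => [|n IH] e eQ; first by rewrite big_ord0.
rewrite big_ord_recr /= expnS.
have := IH (fun i => e (widen_ord (leqnSn n) i)) (fun i => eQ _).
have := eQ ord_max; move: (e ord_max) (\sum_(i < n) _)%N => a b aQ bQ.
apply: (@leq_trans (a.+1 * Q ^ n)); last by rewrite leq_mul2r aQ orbT.
by rewrite mulSn -addSn leq_add2r.
Qed.

Lemma digits_inj n Q (e e' : 'I_n -> nat) :
  (forall i, (e i < Q)%N) -> (forall i, (e' i < Q)%N) ->
  (\sum_(i < n) e i * Q ^ i = \sum_(i < n) e' i * Q ^ i)%N -> e =1 e'.
Proof.
elim: n e e' => [|n IH] e e' eQ eQ'; first by move=> _ [].
rewrite !big_ord_recr /= => eqe.
have lt1 := digits_lt (fun i : 'I_n => eQ (widen_ord (leqnSn n) i)).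
have lt2 := digits_lt (fun i : 'I_n => eQ' (widen_ord (leqnSn n) i)).
have eqm : e ord_max = e' ord_max.
  move: (congr1 (fun x => x %/ Q ^ n)%N eqe).
  have Qn : (0 < Q ^ n)%N by apply: leq_ltn_trans lt1.
  by rewrite !divnDMl // !divn_small.
rewrite eqm in eqe; move/addIn: eqe => /IH eqe i.
have [j ->|->] := unliftP ord_max i; last by [].
have -> : lift ord_max j = widen_ord (leqnSn n) j.
  by apply: val_inj; rewrite /= /bump leqNgt ltn_ord.
exact: eqe.
Qed.

End Digits.

(** * Precomposition as a Frobenius power, and non-nilpotency *)

Section QuasiFixed.
Variables (p N : nat) (f : 'I_N -> {mpoly 'F_p[N]}).
Hypothesis p_pr : prime p.
Local Notation R := {mpoly 'F_p[N]}.
Implicit Types (P Y D : R).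

Definition precomp (P : R) : R := comp_mpoly [tuple f i | i < N] P.

Lemma precompM P Y : precomp (P * Y) = precomp P * precomp Y.
Proof. exact: (rmorphM (comp_mpoly _)). Qed.

Lemma precompD P Y : precomp (P + Y) = precomp P + precomp Y.
Proof. exact: (raddfD (comp_mpoly _)). Qed.

Lemma precompX i : precomp 'X_i = f i.
Proof. by rewrite /precomp comp_mpolyXU -tnth_nth tnth_mktuple. Qed.

Lemma pchar_mpoly : p \in [pchar R].
Proof.
rewrite inE p_pr /= -mpolyC_nat.
by have := pchar_Fp p_pr; rewrite inE p_pr /= => /eqP ->; rewrite mpolyC0.
Qed.

Lemma frobeniusD e P Y : (P + Y) ^+ (p ^ e) = P ^+ (p ^ e) + Y ^+ (p ^ e).
Proof. by apply: exprDn_pchar; rewrite pnatX pnatE // pchar_mpoly. Qed.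

Lemma frobenius_const e (c : 'F_p) : c ^+ (p ^ e) = c.
Proof.
elim: e => [|e IH]; first by rewrite expr1.
rewrite expnSr exprM IH -[c]natr_Zp -(pFrobenius_autE (pchar_Fp p_pr)).
exact: rmorph_nat.
Qed.

Section Exponent.
Variables (e : nat).
Local Notation Q := (p ^ e)%N.
Local Notation inI := (in_frob f Q).

Lemma in_frobM2 P P' Y Y' :
  inI (P - P') -> inI (Y - Y') -> inI (P * Y - P' * Y').
Proof.
move=> PI YI; have -> : P * Y - P' * Y' = Y * (P - P') + P' * (Y - Y').
  by rewrite !mulrBr addrA ![Y * _]mulrC subrK.
by apply: in_frobD; apply: in_frobMl.
Qed.

Lemma in_frobX P P' k : inI (P - P') -> inI (P ^+ k - P' ^+ k).
Proof.
move=> PI; elim: k => [|k IH]; first by rewrite subrr; apply: in_frob0.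
by rewrite !exprS; apply: in_frobM2.
Qed.

Lemma in_frob_trans P Y P' : inI (P - Y) -> inI (Y - P') -> inI (P - P').
Proof. by move=> PY YP; rewrite -[P](subrK Y) -addrA; apply: in_frobD. Qed.

(** Over the prime field, both precomposition with [f] and the [Q]-th power are ring endomorphisms
    fixing the constants; on a variable they give [f v] and [x_v^Q], which the ideal identifies. *)
Lemma precomp_frobenius P : inI (precomp P - P ^+ Q).
Proof.
elim/mpolyind: P => [|c m P _ _ IH].
  rewrite /precomp comp_mpoly0 expr0n expn_eq0 eqn0Ngt prime_gt0 //= subr0.
  exact: in_frob0.
rewrite precompD frobeniusD opprD addrACA; apply: in_frobD; last exact: IH.
rewrite /precomp comp_mpolyZ exprZn frobenius_const -scalerBr -mul_mpolyC.
apply: in_frobMl; rewrite comp_mpolyX mpolyXE_id -prodrXl.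
elim/big_ind2: _ => [|P1 Y1 P2 Y2 I1 I2|i _].
- by rewrite subrr; apply: in_frob0.
- exact: in_frobM2.
rewrite tnth_mktuple -exprM mulnC exprM; apply: in_frobX.
rewrite -[_ - _]opprB; apply/in_frobN; exact: in_frob_rel.
Qed.

Lemma iter_precomp_frobenius i P : inI (iter i precomp P - P ^+ (Q ^ i)).
Proof.
elim: i => [|i IH] /=; first by rewrite expr1 subrr; apply: in_frob0.
apply: (in_frob_trans (precomp_frobenius _)).
by rewrite expnSr exprM; apply: in_frobX.
Qed.

End Exponent.

Lemma msize_prod_le (n d s : nat) (G : 'I_n -> R) (k : 'I_n -> nat) :
  (forall i, (msize (G i) <= s)%N) -> (forall i, (k i <= d)%N) ->
  (msize (\prod_i G i ^+ k i) <= (n * (d * s)).+1)%N.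
Proof.
move=> Gs kd.
have msizeXle P l : (msize P <= s)%N -> (msize (P ^+ l) <= (l * s).+1)%N.
  move=> Ps; elim: l => [|l IH]; first by rewrite expr0 msize1.
  rewrite exprS; have [->|P0] := eqVneq P 0; first by rewrite mul0r msize0.
  have [->|P1] := eqVneq (P ^+ l) 0; first by rewrite mulr0 msize0.
  rewrite msizeM // mulSn; move: (msize P) (msize (P ^+ l)) Ps IH => x y; lia.
elim: n G k Gs kd => [|n IH] G k Gs kd; first by rewrite big_ord0 msize1.
rewrite big_ord_recl; set A := G _ ^+ _; set B := \prod_(i < n) _.
have [->|A0] := eqVneq A 0; first by rewrite mul0r msize0.
have [->|B0] := eqVneq B 0; first by rewrite mulr0 msize0.
have As : (msize A <= (d * s).+1)%N.
  apply: leq_trans (msizeXle _ _ (Gs ord0)) _.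
  by rewrite ltnS leq_mul2r kd orbT.
have Bs : (msize B <= (n * (d * s)).+1)%N by apply: IH.
by rewrite msizeM // mulSn; move: (msize A) (msize B) As Bs => x y; lia.
Qed.

(* More than [N] polynomials in [N] variables are algebraically dependent:
   pigeonhole on their polynomial combinations. *)
Lemma algebraic_dependence (G : 'I_N.+1 -> R) :
  exists d, exists2 c : {ffun {ffun 'I_N.+1 -> 'I_d} -> 'F_p},
    c != 0 & \sum_k c k *: (\prod_i G i ^+ k i) = 0.
Proof.
pose s := (\max_i msize (G i))%N.
have Gs i : (msize (G i) <= s)%N by apply: (leq_bigmax i).
(* Pigeonhole: there are [d^(N+1)] exponent vectors, while every combination has size at most [E]
   and so at most [E^N] coefficients. Since [E <= d B] and [d = B^N + 1], one gets
   [E^N <= d^N B^N < d^(N+1)]. *)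
pose B := (N.+1 * s).+1; pose d := (B ^ N).+1; pose E := (N.+1 * (d * s)).+1.
pose comb (c : {ffun {ffun 'I_N.+1 -> 'I_d} -> 'F_p}) : R :=
  \sum_k c k *: (\prod_i G i ^+ k i).
pose coefs c : {ffun {ffun 'I_N -> 'I_E} -> 'F_p} :=
  [ffun m : {ffun 'I_N -> 'I_E} => (comb c)@_[multinom nat_of_ord (m i) | i < N]].
have [/injectiveP coefs_inj|] := boolP (injectiveb coefs).
  have := leq_card coefs coefs_inj.
  rewrite !card_ffun card_Fp // !card_ord leq_exp2l ?prime_gt1 //.
  suff : (E ^ N < d ^ N.+1)%N by rewrite ltnNge => /negPf ->.
  have EB : (E <= d * B)%N by rewrite /E /B /d mulnCA mulnS; lia.
  apply: (@leq_ltn_trans ((d * B) ^ N)).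
    by have [->|N0] := posnP N; rewrite ?expn0 // leq_exp2r.
  by rewrite expnMn expnSr ltn_pmul2l ?expn_gt0 // /d ltnS.
move=> /injectivePn [c [c' cc' /ffunP eq_coefs]].
exists d; exists (c - c'); first by rewrite subr_eq0.
have combB : comb (c - c') = comb c - comb c'.
  rewrite /comb -sumrB; apply: eq_bigr => k _.
  by rewrite !ffunE scalerBl.
rewrite -/(comb (c - c')).
apply/mpolyP => m; rewrite mcoeff0.
have small x : (msize (comb x) <= E)%N.
  apply: leq_trans (msize_sum _ _ _) _; apply/bigmax_leqP => k _.
  apply: leq_trans (msizeZ_le _ _) _; apply: msize_prod_le => // i.
  exact/ltnW.
have [mE|Em] := ltnP (mdeg m) E; last first.
  by apply/eqP; rewrite mcoeff_eq0 (msize_mdeg_ge (leq_trans (small _) Em)).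
have mi i : (m i < E)%N.
  by apply: leq_ltn_trans mE; rewrite mdegE (bigD1 i) //= leq_addr.
have := eq_coefs [ffun i => Ordinal (mi i)].
rewrite !ffunE combB mcoeffB.
have -> : [multinom nat_of_ord ([ffun i0 => Ordinal (mi i0)] i) | i < N] = m.
  by apply/mnmP => i; rewrite mnmE ffunE.
by move=> ->; rewrite subrr.
Qed.

(* The Borisov-Sapir theorem: modulo [x^Q = f], precomposition with [f] is
   the Q-power map, so a polynomial relation between the iterates of [D] becomes
   a one-variable equation for [D], which bounds its nilpotency exponent. *)
Theorem quasi_fixed_points (D : R) : iter N precomp D != 0 ->
  exists e, [/\ (0 < e)%N, forall v, (msize (f v) <= p ^ e)%N &
    forall a, ~ in_frob f (p ^ e) (D ^+ a)].
Proof.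
move=> DN0.
have [d [c c0 rel]] := algebraic_dependence (fun i => iter i precomp D).
(* [Q = p^e] must dominate [d], so that exponents are digits in base [Q]; the degrees of the [f v],
   so that reduction lowers degrees; and the size of the [d]-th power of the last iterate, so that
   this power is already reduced. *)
pose e := (d + msize ((iter N precomp D) ^+ d) + \max_v msize (f v)).+1.
have eQ : (e < p ^ e)%N by rewrite ltn_expl // prime_gt1.
have dQ : (d <= p ^ e)%N.
  by apply: leq_trans (ltnW eQ); rewrite /e; move: (msize _) => x; lia.
have fQ v : (msize (f v) <= p ^ e)%N.
  apply: leq_trans (ltnW eQ); rewrite /e.
  have : (msize (f v) <= \max_v msize (f v))%N by apply: (leq_bigmax v).
  by move: (msize (f v)) (msize _) (\max_v _)%N => x y z; lia.
exists e; split=> // a0 nilp0.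
pose inI := in_frob f (p ^ e).
have [a [nilp a_min]] : exists a, inI (D ^+ a) /\
    forall b, (b < a)%N -> ~ inI (D ^+ b).
  elim/ltn_ind: a0 nilp0 => a0 IH nilp0.
  have [[b [ba0 nb]]|nob] := classic
      (exists b, (b < a0)%N /\ inI (D ^+ b)).
    exact: IH nb.
  by exists a0; split=> // b ba0 nb; apply: nob; exists b.
(* Replacing the [i]-th iterate by [D^(Q^i)] turns the monomial with exponents [k] into [D^(wt k)],
   and the weights of distinct monomials are distinct as numbers with distinct digits. *)
pose wt (k : {ffun 'I_N.+1 -> 'I_d}) := (\sum_(i < N.+1) k i * (p ^ e) ^ i)%N.
have wt_inj k k' : wt k = wt k' -> k = k'.
  move=> eq_wt; apply/ffunP => i; apply: val_inj.
  by apply: (digits_inj _ _ eq_wt) => {}i; apply: leq_trans dQ.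
have wt_lt k : (wt k < d * (p ^ e) ^ N)%N.
  rewrite /wt big_ord_recr /=.
  have := @digits_lt N (p ^ e) (fun i => k (widen_ord (leqnSn N) i)).
  move=> /(_ (fun i => leq_trans (ltn_ord _) dQ)).
  move: (\sum_(i < N) _)%N (ltn_ord (k ord_max)) => x kd xlt.
  apply: (@leq_trans ((k ord_max).+1 * (p ^ e) ^ N)%N).
    by rewrite mulSn -addSn leq_add2r.
  by rewrite leq_mul2r kd orbT.
have relD : inI (\sum_k c k *: D ^+ wt k).
  suff /in_frobN : inI (\sum_k (c k *: (\prod_(i < N.+1) iter i precomp D ^+ k i)
                                - c k *: D ^+ wt k)).
    by rewrite sumrB rel sub0r opprK.
  apply: in_frob_sum => k _.
  rewrite -scalerBr -mul_mpolyC; apply: in_frobMl.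
  rewrite /wt expr_sum.
  elim/big_ind2: _ => [|P1 Y1 P2 Y2 I1 I2|i _].
  - by rewrite subrr; apply: in_frob0.
  - exact: in_frobM2.
  by rewrite mulnC exprM; apply: in_frobX; apply: iter_precomp_frobenius.
have [k1 ck1] : exists k, c k != 0.
  apply/existsP; apply: contraNT c0; rewrite negb_exists => /forallP c0.
  by apply/eqP/ffunP => k; rewrite ffunE; have := c0 k; rewrite negbK => /eqP.
have [k0 ck0 k0_min] := @arg_minnP _ k1 (fun k => c k != 0) wt ck1.
(* Otherwise multiply the relation by [D^(a - 1 - wt k0)]: every term but the lowest acquires an
   exponent of at least [a] and vanishes, so [D^(a-1)] is in the ideal, against the minimality of
   [a]. *)
have a_le : (a <= wt k0)%N.
  rewrite leqNgt; apply/negP => wta.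
  apply: (a_min a.-1); first by lia.
  have := in_frobMl (D ^+ (a.-1 - wt k0)) relD.
  rewrite mulr_sumr (bigD1 k0) //= => sumI.
  have restI : inI (\sum_(k | k != k0) D ^+ (a.-1 - wt k0) * (c k *: D ^+ wt k)).
    apply: in_frob_sum => k kk0; rewrite -scalerAr -exprD.
    have [->|ck] := eqVneq (c k) 0; first by rewrite scale0r; apply: in_frob0.
    rewrite -mul_mpolyC; apply: in_frobMl.
    have wtk : (wt k0 < wt k)%N.
      by rewrite ltn_neqAle k0_min // andbT; apply: contra_neq kk0 => /wt_inj.
    have -> : (a.-1 - wt k0 + wt k = (wt k - wt k0).-1 + a)%N by lia.
    by rewrite exprD; apply: in_frobMl.
  have := in_frobB sumI restI; rewrite addrK -scalerAr -exprD.
  rewrite subnK; last by lia.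
  move=> /(in_frobMl ((c k0)^-1)%:MP).
  by rewrite mul_mpolyC scalerA mulVf // scale1r.
(* Now [a <= wt k0 < d Q^N], a bound that puts [D^(Q^N d)] in the ideal. It is congruent to the
   [d]-th power of the last iterate, which is too small to be a nonzero member. *)
have : inI ((iter N precomp D) ^+ d).
  have DI : inI (D ^+ ((p ^ e) ^ N * d)).
    have aN : (a <= (p ^ e) ^ N * d)%N.
      by apply: leq_trans a_le _; rewrite mulnC; apply/ltnW/wt_lt.
    by rewrite -(subnK aN) exprD; apply: in_frobMl.
  rewrite -[X in inI X](subrK (D ^+ ((p ^ e) ^ N * d))).
  apply: in_frobD DI; rewrite exprM; apply: in_frobX.
  exact: iter_precomp_frobenius.
move=> /(in_frob_small fQ _) small.
have /eqP : (iter N precomp D) ^+ d = 0.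
  apply: small; first by rewrite expn_gt0 prime_gt0.
  apply: leq_trans (ltnW eQ); rewrite /e.
  by move: (msize _) (\max_v _)%N => x y; lia.
by rewrite expf_eq0 (negPf DN0) andbF.
Qed.

End QuasiFixed.

(** There are finitely many reduced polynomials over ['F_p], and the table of their coefficients
    labels the classes modulo the ideal. [lab] is a relation because a reduced representative is
    only known to exist. *)
Lemma frob_label (p N e : nat) (f : 'I_N -> {mpoly 'F_p[N]}) :
  (0 < p ^ e)%N -> (forall v, (msize (f v) <= p ^ e)%N) ->
  exists (T : finType) (lab : {mpoly 'F_p[N]} -> T -> Prop),
    (forall P, exists a, lab P a) /\
    (forall P Y a, lab P a -> lab Y a -> in_frob f (p ^ e) (P - Y)).
Proof.
move=> Q_gt0 fQ; set Q := (p ^ e)%N.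
exists {ffun {ffun 'I_N -> 'I_Q} -> 'F_p}, (fun P (a : {ffun {ffun 'I_N -> 'I_Q} -> 'F_p}) =>
  exists2 P0, reduced Q P0 & in_frob f Q (P - P0) /\
    forall m : {ffun 'I_N -> 'I_Q},
      a m = P0@_[multinom nat_of_ord (m i) | i < N]).
split=> [P|P Y a [P0 rP [PI aP]] [Y0 rY [YI aY]]].
  have [P0 rP PI] := reduced_repr fQ Q_gt0 P.
  exists [ffun m : {ffun 'I_N -> 'I_Q} =>
    P0@_[multinom nat_of_ord (m i) | i < N]].
  by exists P0 => //; split=> // m; rewrite ffunE.
suff eq0 : P0 = Y0.
  rewrite -eq0 in YI; have -> : P - Y = (P - P0) - (Y - P0) by rewrite opprB addrA subrK.
  exact: in_frobB.
apply/mpolyP => m; have [/forallP m_red|m_nred] := boolP (reduced_mnm Q m).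
  have := aP [ffun i => Ordinal (m_red i)]; rewrite aY.
  have -> // : [multinom nat_of_ord ([ffun i0 => Ordinal (m_red i0)] i) | i < N] = m.
  by apply/mnmP => i; rewrite mnmE ffunE.
have zero Z : reduced Q Z -> Z@_m = 0.
  by move=> rZ; apply/memN_msupp_eq0; apply: contra m_nred => /rZ.
by rewrite !zero.
Qed.

Lemma precomp_is_additive p N (f : 'I_N -> {mpoly 'F_p[N]}) :
  zmod_morphism (precomp f).
Proof. exact: (raddfB (comp_mpoly _)). Qed.
HB.instance Definition _ p N f := GRing.isZmodMorphism.Build
  _ _ (@precomp p N f) (@precomp_is_additive p N f).
Lemma precomp_is_multiplicative p N (f : 'I_N -> {mpoly 'F_p[N]}) :
  monoid_morphism (precomp f).
Proof. by split; [exact: (rmorph1 (comp_mpoly _))|exact: precompM]. Qed.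
HB.instance Definition _ p N f := GRing.isMonoidMorphism.Build
  _ _ (@precomp p N f) (@precomp_is_multiplicative p N f).

(** * Separating an orbit in a free group from the identity *)

Section Separation.
Variables (n : nat) (w : 'I_n -> word 'I_n) (u0 : word 'I_n).
Local Notation wsub := (word_subst w).
Local Notation free_eq := (word_eq (@free_rel 'I_n)).
Hypothesis persistent : forall k, ~ free_eq (iter k wsub u0) [::].

Variable p : nat.
Hypotheses (p_pr : prime p) (p_big : (n * n + 2 < p)%N).

Local Notation I := ('I_n * ('I_2 * 'I_2))%type.
Let N := #|{: I}|.
Local Notation R := {mpoly 'F_p[N]}.

(** Generic matrices, one variable for each of the four entries. The polynomials [f] are the entries
    of the words [w i] at these matrices, so substituting [w] into a word means precomposing its
    value with [f]. *)
Let Z (i : 'I_n) : 'M[R]_2 := \matrix_(r, s) 'X_(enum_rank (i, (r, s))).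
Let value := word_value Z.
Let f (v : 'I_N) : R :=
  let: (i, (r, s)) := enum_val v in value (w i) r s.

Let map_precomp u : map_mx (precomp f) (value u) = value (wsub u).
Proof.
rewrite /value word_value_subst map_word_value; apply: eq_word_value => i.
by apply/matrixP => r s; rewrite [LHS]mxE [Z i r s]mxE [LHS](precompX f) /f enum_rankK.
Qed.

Let F_nat (k : nat) : (k < p)%N -> k%:R = 0 :> 'F_p -> k = 0%N.
Proof.
case: k => // k kp /eqP.
by rewrite -(dvdn_pcharf (pchar_Fp p_pr)) gtnNdvd.
Qed.

Let F_big (i j : 'I_n) : i%:R = j%:R :> 'F_p -> i = j.
Proof.
wlog ij : i j / (i <= j)%N.
  by move=> H; case/orP: (leq_total i j) => [/H //|/H {}H] /esym/H.
move=> eqij; apply/val_inj/eqP; rewrite eqn_leq ij /= -subn_eq0; apply/eqP/F_nat.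
  by move: p_big (ltn_ord j) (ltn_ord i); nia.
by rewrite natrB // eqij subrr.
Qed.

Let F_big' (i j : 'I_n) : 1 + i%:R * j%:R != 0 :> 'F_p.
Proof.
rewrite -natrM -[1]/(1%:R) -natrD; apply/eqP => /F_nat.
move=> H; suff /H : (1 + i * j < p)%N by rewrite add1n.
by move: p_big (ltn_ord j) (ltn_ord i); nia.
Qed.

Let ev : {rmorphism R -> {poly 'F_p}} :=
  mmap (@polyC 'F_p) (fun v : 'I_N => let: (i, (r, s)) := enum_val v in
    special 'F_p i r s).

Let ev_Z i : map_mx ev (Z i) = special 'F_p i.
Proof.
apply/matrixP => r s; rewrite [LHS]mxE [Z i r s]mxE.
by rewrite /ev /= mmapX mmap1U enum_rankK.
Qed.

Let map_ev u : map_mx ev (value u) = word_value (@special 'F_p n) u.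
Proof. by rewrite map_word_value; apply: eq_word_value => i; apply: ev_Z. Qed.

Let det_Z i : \det (Z i) != 0.
Proof.
by apply: contra_neq (det_special 'F_p i) => dZ; rewrite -ev_Z det_map_mx dZ rmorph0.
Qed.

Let ev_nonscalar i j u :
  ev (nonscalar_part i j (value u)) =
  nonscalar_part i j (word_value (@special 'F_p n) u).
Proof.
rewrite -map_ev /nonscalar_part; case: ifP => _; last by rewrite [RHS]mxE.
by rewrite rmorphB; congr (_ - _); rewrite [RHS]mxE.
Qed.

(** A nonempty reduced word is nonscalar already at the specialization [special], hence generically.
    Reducing a word changes its value only by nonzero factors in a domain. *)
Let nonscalar u : ~ free_eq u [::] ->
  exists i j, nonscalar_part i j (value u) != 0.
Proof.
move=> u1; have [v red uv] := word_eq_reduced u.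
have v1 : v != [::] by apply: contra_notN u1 => /eqP <-.
have [i [j vij]] := special_nonscalar F_big F_big' red v1.
have {}vij : nonscalar_part i j (value v) != 0.
  by apply: contra_neq vij; rewrite -ev_nonscalar => ->; rewrite rmorph0.
exists i, j.
have [|s [t [s0 t0 eqv]]] := @word_eq_proportional _ _ Z (fun a => a != 0)
  (oner_neq0 R) _ det_Z _ _ uv.
  by move=> a b a0 b0; rewrite mulf_neq0.
have : t * nonscalar_part i j (value v) != 0 by rewrite mulf_neq0.
apply: contra_neq => uij.
suff -> : t * nonscalar_part i j (value v) = s * nonscalar_part i j (value u).
  by rewrite uij mulr0.
have scaleE (c : R) (M : 'M[R]_2) k l : (c *: M) k l = c * M k l by rewrite mxE.
by rewrite /nonscalar_part /value; case: ifP => _; rewrite ?mulrBr -!scaleE eqv.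
Qed.

(** Take the ring of polynomials modulo the ideal and invert [D]; [J] is the kernel of the map to
    this finite ring, and it is proper because [D] is not nilpotent. The determinants divide [D] and
    become regular, so the words act projectively over this ring, and [L] consists of the words
    acting as scalars. *)
Lemma separating_subgroup_big :
  exists (L : word 'I_n -> Prop) (T : finType) (lab : word 'I_n -> T -> Prop),
  [/\ L [::] /\ (forall u v, L u -> L v -> L (u ++ v)),
      (forall u, L u -> L (word_inv u)) /\
      (forall u v, free_eq u v -> L u -> L v),
      forall u, exists a, lab u a,
      forall u v a, lab u a -> lab v a -> L (word_inv u ++ v) &
      forall k, ~ L (iter k wsub u0)].
Proof.
have [i0 [j0 part0]] := nonscalar (persistent (k := N)).
(* The determinants are included so that they can be cancelled modulo [J], the nonscalar part of
   [u0] so that its powers control the iterates. *)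
pose D := (\prod_i \det (Z i)) * nonscalar_part i0 j0 (value u0).
have iter_map k u : map_mx (iter k (precomp f)) (value u) = value (iter k wsub u).
  elim: k => [|k IH] /=; first by apply/matrixP => r s; rewrite mxE.
  rewrite -map_precomp -IH; apply/matrixP => r s.
  by rewrite [LHS]mxE [RHS]mxE; congr (precomp f _); rewrite mxE.
have iterM k : {morph iter k (precomp f) : P Y / P * Y}.
  by move=> P Y; elim: k => //= k ->; rewrite rmorphM.
have iterB k : {morph iter k (precomp f) : P Y / P - Y}.
  by move=> P Y; elim: k => //= k ->; rewrite rmorphB.
have iter_part k i j u :
    iter k (precomp f) (nonscalar_part i j (value u)) =
    nonscalar_part i j (value (iter k wsub u)).
  rewrite -iter_map /nonscalar_part; case: ifP => _; rewrite ?mxE //.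
  by rewrite iterB.
have iter_prod k : iter k (precomp f) (\prod_i \det (Z i)) != 0.
  have iter1 : iter k (precomp f) 1 = 1 by elim: k => //= k ->; rewrite rmorph1.
  elim/big_ind: _ => [|P Y P0 Y0|i _]; first by rewrite iter1 oner_neq0.
    by rewrite iterM mulf_neq0.
  have -> : \det (Z i) = \det (value [:: (i, true)]).
    by rewrite /value word_value_cons /word_value big_nil mulmx1.
  have -> : iter k (precomp f) (\det (value [:: (i, true)])) =
      \det (value (iter k wsub [:: (i, true)])).
    by rewrite -iter_map !det2 iterB !iterM !mxE.
  by apply: (@det_word_value _ _ Z (fun a => a != 0)) => //;
    [exact: oner_neq0|move=> *; rewrite mulf_neq0].
have DN : iter N (precomp f) D != 0 by rewrite iterM mulf_neq0 // iter_part.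
have [e [e_gt0 fQ nilD]] := quasi_fixed_points p_pr DN.
pose inI := in_frob f (p ^ e).
pose J (P : R) := exists a, inI (D ^+ a * P).
have JI P : inI P -> J P by move=> PI; exists 0%N; rewrite mul1r.
have JD P Y : J P -> J Y -> J (P + Y).
  move=> [a aP] [b bY]; exists (a + b)%N; rewrite mulrDr; apply: in_frobD.
    by rewrite addnC exprD -mulrA; apply: in_frobMl.
  by rewrite exprD -mulrA; apply: in_frobMl.
have JM P Y : J Y -> J (P * Y).
  by move=> [a aY]; exists a; rewrite mulrCA; apply: in_frobMl.
have JN P : J P -> J (- P) by move=> /(JM (-1)); rewrite mulN1r.
pose reg s := forall P, J (s * P) -> J P.
have reg1 : reg 1 by move=> P; rewrite mul1r.
have regM s t : reg s -> reg t -> reg (s * t).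
  by move=> rs rt P; rewrite -mulrA => /rs /rt.
have regZ i : reg (\det (Z i)).
  move=> P [a aP]; exists a.+1.
  pose E := (\prod_(j | j != i) \det (Z j)) * nonscalar_part i0 j0 (value u0).
  have DE : D = \det (Z i) * E by rewrite /D (bigD1 i) //= mulrA.
  clearbody E.
  have -> : D ^+ a.+1 * P = E * (D ^+ a * (\det (Z i) * P)).
    by rewrite exprSr [X in _ * X * _]DE -!mulrA [RHS]mulrCA [in RHS](mulrCA E).
  exact: in_frobMl.
pose mJ (A : 'M[R]_2) := forall i j, J (A i j).
have J0 : J 0 by apply: JI; apply: in_frob0.
have mJD A B : mJ A -> mJ B -> mJ (A + B).
  by move=> AJ BJ i j; rewrite mxE; apply: JD.
have mJN A : mJ A -> mJ (- A) by move=> AJ i j; rewrite mxE; apply: JN.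
have mJMl A B : mJ B -> mJ (A *m B).
  move=> BJ i j; rewrite mxE; elim/big_ind: _ => //= l _; exact: JM.
have mJMr A B : mJ B -> mJ (B *m A).
  move=> BJ i j; rewrite mxE; elim/big_ind: _ => //= l _.
  by rewrite mulrC; exact: JM.
have mJZ s A : mJ A -> mJ (s *: A) by move=> AJ i j; rewrite mxE; apply: JM.
have mJreg s A : reg s -> mJ (s *: A) -> mJ A.
  by move=> rs AJ i j; apply: rs; have := AJ i j; rewrite mxE.
pose scal (A : 'M[R]_2) := exists l, mJ (A - l%:M).
pose L u := scal (value u).
have scal_reg s A : reg s -> scal (s *: A) -> scal A.
  move=> rs [l AJ]; exists (A 0 0); apply: (mJreg s) => // i j.
  have := (AJ i j, AJ 0 0); rewrite !mxE eqxx mulr1n.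
  case: (i == j); rewrite ?mulr1n ?mulr0n ?subr0; last by case.
  by case=> /JD JA /JN /JA; rewrite opprB addrA subrK -mulrBr.
have scalZ s A : scal A -> scal (s *: A).
  by move=> [l AJ]; exists (s * l); rewrite -scale_scalar_mx -scalerBr; apply: mJZ.
have reg_value u : reg (\det (value u)).
  exact: (@det_word_value _ _ Z reg).
have L_eq u v : free_eq u v -> L u -> L v.
  move=> uv Lu; have [s [t [rs rt eqv]]] :=
    word_eq_proportional reg1 regM regZ uv.
  by apply: (scal_reg t) => //; rewrite -eqv; apply: scalZ.
have Q_gt0 : (0 < p ^ e)%N by rewrite expn_gt0 prime_gt0.
have [T [lab [lab_ex lab_eq]]] := frob_label Q_gt0 fQ.
exists L, {ffun 'I_2 * 'I_2 -> T}, (fun u (a : {ffun 'I_2 * 'I_2 -> T}) =>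
  forall rs, lab (value u rs.1 rs.2) (a rs)).
split.
- split; first by exists 1; rewrite /value /word_value big_nil subrr => i j; rewrite mxE.
  move=> u v [l Ju] [m Jv]; exists (l * m).
  rewrite /value word_value_cat -/value.
  have -> : value u *m value v - (l * m)%:M =
      value u *m (value v - m%:M) + m%:M *m (value u - l%:M).
    rewrite !mulmxBr mul_mx_scalar mul_scalar_mx addrA subrK.
    by rewrite -scalar_mxM mulrC.
  by apply: mJD; apply: mJMl.
- split; last exact: L_eq.
  move=> u [l Ju].
  exists l; rewrite /value word_value_inv -/value.
  rewrite -adj2_sub_scalar; apply: ord2P; apply: ord2P; rewrite adj2E.
  - exact: Ju.
  - exact/JN/Ju.
  - exact/JN/Ju.
  - exact: Ju.
- move=> u.
  have [a aP] : exists a : 'I_2 * 'I_2 -> T, forall rs, lab (value u rs.1 rs.2) (a rs).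
    exact: (fin_all_exists (fun rs => lab_ex (value u rs.1 rs.2))).
  by exists [ffun rs => a rs] => rs; rewrite ffunE.
(* Equal labels mean congruent values, and the adjugate of a matrix times that same matrix is its
   determinant. *)
- move=> u v a ua va; exists (\det (value u)).
  rewrite /value word_value_cat -[X in _ - X]word_value_inv_mul -mulmxBr.
  apply: mJMl => i j; rewrite !mxE; apply: JI.
  exact: (lab_eq _ _ _ (va (i, j)) (ua (i, j))).
move=> k [l Lk].
have : J (nonscalar_part i0 j0 (value (iter k wsub u0))).
  move: Lk; move: (value _) => A AJ.
  have AE i j : J (A i j - l *+ (i == j)) by have := AJ i j; rewrite !mxE.
  rewrite /nonscalar_part; case: eqP => [_|/eqP/negPf ij].
    have := JD _ _ (AE 0 0) (JN _ (AE 1 1)).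
    by rewrite opprB addrA subrK.
  by have := AE i0 j0; rewrite ij mulr0n subr0.
rewrite -iter_part => -[a].
set P := nonscalar_part i0 j0 (value u0) => aJ.
have congP := @iter_precomp_frobenius p N f p_pr e k P.
(* The nonscalar part of the [k]-th iterate is congruent to [P^(Q^k)], and [P] divides [D]: if it
   were killed by [D^a], then [D^(a + Q^k)] would lie in the ideal. *)
apply: (nilD (a + (p ^ e) ^ k)%N).
rewrite exprD [X in _ * X]exprMn -/P mulrCA; apply: in_frobMl.
have := in_frobB aJ (in_frobMl (D ^+ a) congP).
by rewrite -mulrBr opprB [X in _ * X]addrC subrK.
Qed.

End Separation.

Theorem separating_subgroup (n : nat) (w : 'I_n -> word 'I_n) (u0 : word 'I_n) :
  (forall k, ~ word_eq (@free_rel 'I_n) (iter k (word_subst w) u0) [::]) ->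
  exists (L : word 'I_n -> Prop) (T : finType) (lab : word 'I_n -> T -> Prop),
  [/\ L [::] /\ (forall u v, L u -> L v -> L (u ++ v)),
      (forall u, L u -> L (word_inv u)) /\
      (forall u v, word_eq (@free_rel 'I_n) u v -> L u -> L v),
      forall u, exists a, lab u a,
      forall u v a, lab u a -> lab v a -> L (word_inv u ++ v) &
      forall k, ~ L (iter k (word_subst w) u0)].
Proof.
(* The bound keeps [1 + i j], and [i - j] for distinct [i] and [j] below [n], nonzero modulo [p], as
   [special] requires. *)
move=> persistent; have [p p_big p_pr] := prime_above (n * n + 2).
exact: separating_subgroup_big p_big.
Qed.

End SeparatingWords.

From mathcomp Require Import all_classical topology function_spaces.

(** * Subgroups of finite index *)

Ltac group_simp := rewrite ?/conjg ?(invgM, invgK, invg1, mulg1, mul1g, mulgA,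
  mulgV, mulVg, mulgK, mulgVK).

Section WordsInGroups.
Local Open Scope group_scope.
Context {E : groupType} {X : Type} (s : X -> E).
Implicit Types u v : word X.

Definition word_prod u : E :=
  \prod_(a <- u) (if a.2 then s a.1 else (s a.1)^-1).

Lemma word_prod_cat u v : word_prod (u ++ v) = word_prod u * word_prod v.
Proof. by rewrite /word_prod big_cat. Qed.

Lemma word_prod_cons a u :
  word_prod (a :: u) = (if a.2 then s a.1 else (s a.1)^-1) * word_prod u.
Proof. by rewrite /word_prod big_cons. Qed.

Lemma word_prod1 a : word_prod [:: a] = if a.2 then s a.1 else (s a.1)^-1.
Proof. by rewrite /word_prod big_seq1. Qed.

Lemma word_prod_inv u : word_prod (word_inv u) = (word_prod u)^-1.
Proof.
elim: u => [|a u IH]; first by rewrite /word_prod !big_nil invg1.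
rewrite /word_inv /= rev_cons -cats1 word_prod_cat IH word_prod1.
by rewrite [in RHS]word_prod_cons invgM; case: a => x [] //=; rewrite invgK.
Qed.

Lemma word_eq_prod u v :
  word_eq (fun _ _ => False) u v -> word_prod u = word_prod v.
Proof.
elim=> {u v} [//|u v _ -> //|u v w _ -> _ -> //|u u' v v' _ e1 _ e2|x b|//].
  by rewrite !word_prod_cat e1 e2.
rewrite (word_prod_cat [:: _] [:: _]) !word_prod1 /word_prod big_nil.
by case: b; rewrite /= ?mulgV ?mulVg.
Qed.

Lemma word_mulV (R : word X -> word X -> Prop) u :
  word_eq R (u ++ word_inv u) [::].
Proof.
elim: u => [|[x b] u IHu]; first exact: word_eq_refl.
rewrite /word_inv /= rev_cons -cats1.
apply: word_eq_trans (word_eq_cancel R x b).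
apply: (@word_eq_cat _ R [:: (x, b)] [:: (x, b)] _ [:: (x, ~~ b)]).
  exact: word_eq_refl.
rewrite catA; apply: (@word_eq_cat _ R _ [::]); first exact: IHu.
exact: word_eq_refl.
Qed.

Lemma word_eq_divl (R : word X -> word X -> Prop) u v :
  word_eq R (word_inv u ++ v) [::] -> word_eq R u v.
Proof.
move=> uv; apply: word_eq_sym.
apply: (@word_eq_trans _ _ _ (u ++ (word_inv u ++ v))).
  rewrite catA; apply: word_eq_sym.
  exact: (word_eq_cat (word_mulV R u) (word_eq_refl R v)).
by rewrite -[X in word_eq _ _ X]cats0; apply: word_eq_cat uv; apply: word_eq_refl.
Qed.

End WordsInGroups.

Section GroupMorphisms.
Local Open Scope group_scope.
Context {E E' : groupType} (f : E -> E').
Hypothesis fM : {morph f : x y / x * y}.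

Lemma morph1g : f 1 = 1.
Proof. by apply: (@mulgI _ (f 1)); rewrite -fM !mulg1. Qed.

Lemma morphVg x : f x^-1 = (f x)^-1.
Proof. by apply: (@mulgI _ (f x)); rewrite -fM !mulgV morph1g. Qed.

Lemma morphXg x n : f (x ^+ n) = f x ^+ n.
Proof. by elim: n => [|n IH]; rewrite ?morph1g // !expgS fM IH. Qed.

Lemma morphJg x y : f (x ^ y) = f x ^ f y.
Proof. by rewrite /conjg !fM morphVg. Qed.

End GroupMorphisms.

Section Subgroups.
Local Open Scope classical_set_scope.
Local Open Scope group_scope.
Context {E : groupType}.
Implicit Types (H K L S : set E) (T : finType) (f : E -> E).

Record subgrp H : Prop := Subgrp {
  subgrp1 : H 1;
  subgrpM : forall x y, H x -> H y -> H (x * y);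
  subgrpV : forall x, H x -> H x^-1 }.

Definition normalized K H := forall x y, K x -> H y -> K (x ^ y).

(* [T] labels the left cosets of [L] met by [H] *)
Definition index_by H L T := exists l : E -> T,
  forall x y, H x -> H y -> l x = l y -> L (x^-1 * y).

Definition index_finite H L := exists T, index_by H L T.

Definition fin_gen H := exists (X : finType) (s : X -> E),
  (forall x, H (s x)) /\ forall h, H h -> exists u, h = word_prod s u.

Lemma subgrpX H x n : subgrp H -> H x -> H (x ^+ n).
Proof.
move=> sH Hx; elim: n => [|n IH]; first exact: subgrp1.
by rewrite expgS; apply: subgrpM.
Qed.

Lemma subgrp_word H (X : Type) (s : X -> E) u :
  subgrp H -> (forall x, H (s x)) -> H (word_prod s u).
Proof.
move=> sH Hs; elim: u => [|a u IH]; first by rewrite /word_prod big_nil; apply: subgrp1.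
rewrite -cat1s word_prod_cat word_prod1; apply: subgrpM => //.
by case: a.2; [|apply: subgrpV].
Qed.

Lemma subgrpI H L : subgrp H -> subgrp L -> subgrp (H `&` L).
Proof.
move=> sH sL; split=> [|x y [? ?] [? ?]|x [? ?]]; split;
  by [apply: subgrp1|apply: subgrpM|apply: subgrpV].
Qed.

Lemma subgrp_mulKl H x y : subgrp H -> H x -> H (x * y) -> H y.
Proof. by move=> sH /(subgrpV sH) Hx /(subgrpM sH Hx); rewrite mulKg. Qed.

Lemma subgrp_mulKr H x y : subgrp H -> H y -> H (x * y) -> H x.
Proof. by move=> sH /(subgrpV sH) Hy /(subgrpM sH)/(_ Hy); rewrite mulgK. Qed.

Lemma subgrp_swap H x y : subgrp H -> H (x^-1 * y) -> H (y^-1 * x).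
Proof. by move=> sH /(subgrpV sH); rewrite invgM invgK. Qed.

Lemma fin_gen_ext H K (Y : finType) (t : Y -> E) :
  fin_gen K -> K `<=` H -> (forall y, H (t y)) ->
  (forall h, H h -> exists k u, K k /\ h = k * word_prod t u) -> fin_gen H.
Proof.
move=> [X [s [Ks gK]]] KH Ht gH.
exists (X + Y)%type, (fun z => match z with inl x => s x | inr y => t y end).
split=> [[x|y]|h /gH[k [u [/gK[v ->] ->]]]]; [exact/KH/Ks|exact: Ht|].
exists ([seq (inl a.1, a.2) | a <- v] ++ [seq (inr a.1, a.2) | a <- u]).
by rewrite word_prod_cat /word_prod !big_map.
Qed.

Definition core T H : set E :=
  [set x | H x /\ forall L, subgrp L -> L `<=` H -> index_by H L T -> L x].

Lemma core_sub T H : core T H `<=` H.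
Proof. by move=> x []. Qed.

Lemma core_subgrp T H : subgrp H -> subgrp (core T H).
Proof.
move=> sH; split.
- by split=> [|L sL _ _]; exact: subgrp1.
- move=> x y [Hx cx] [Hy cy]; split; first exact: subgrpM.
  by move=> L sL LH iL; apply: subgrpM => //; [apply: cx|apply: cy].
- move=> x [Hx cx]; split; first exact: subgrpV.
  by move=> L sL LH iL; apply: subgrpV => //; apply: cx.
Qed.

Section Morphism.
Variables (f : E -> E).
Hypothesis fM : {morph f : x y / x * y}.

Lemma subgrp_preim H L : subgrp H -> subgrp L -> subgrp (H `&` f @^-1` L).
Proof.
move=> sH sL; apply: subgrpI => //; split=> /=.
- by rewrite morph1g //; apply: subgrp1.
- by move=> x y Lx Ly; rewrite fM; apply: subgrpM.
- by move=> x Lx; rewrite (morphVg fM); apply: subgrpV.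
Qed.

Lemma index_preim H H' L T : subgrp H -> (forall x, H x -> H' (f x)) ->
  index_by H' L T -> index_by H (H `&` f @^-1` L) T.
Proof.
move=> sH fH [l lP]; exists (l \o f) => x y Hx Hy /= lxy; split=> /=.
  by apply: subgrpM => //; apply: subgrpV.
by rewrite fM (morphVg fM); apply: lP => //; apply: fH.
Qed.

(** A labelling pulls back along [f] with the same [T], so the family of subgroups that defines the
    core is closed under preimages. Conjugations are a special case and give normality. *)
Lemma core_morph T H x : subgrp H -> (forall x, H x -> H (f x)) ->
  core T H x -> core T H (f x).
Proof.
move=> sH fH [Hx cx]; split; first exact: fH.
move=> L sL LH iL; have [] // := cx (H `&` f @^-1` L).
- exact: subgrp_preim.
- exact: (index_preim sH fH iL).
Qed.

End Morphism.

Lemma conjg_morph y : {morph (fun x : E => x ^ y) : x z / x * z}.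
Proof. by move=> x z; rewrite conjMg. Qed.

Lemma core_normalized T H K : subgrp H -> normalized H K ->
  normalized (core T H) K.
Proof.
move=> sH nHK x y cx Ky.
apply: (core_morph (conjg_morph y)) cx => // z Hz; exact: nHK.
Qed.

(** The new label of a coset is some value taken by [l] on it. It is chosen by [pick] from a
    predicate depending only on the coset; [None] does not occur on [H]. *)
Lemma index_by_exact H L T : subgrp H -> subgrp L -> index_by H L T ->
  exists l : E -> option T, forall x y, H x -> H y -> l x = l y <-> L (x^-1 * y).
Proof.
move=> sH sL [l lP].
exists (fun x => [pick a | `[< exists y, [/\ H y, L (x^-1 * y) & l y = a] >]]).
move=> x y Hx Hy; split.
  case: pickP => [a /asboolP[z [Hz xz <-]]|/(_ (l x))].
    case: pickP => [b /asboolP[t [Ht yt <-]] [] lz|//].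
    have := subgrpM sL (subgrpM sL xz (lP _ _ Hz Ht lz)) (subgrp_swap sL yt).
    by rewrite !mulgA mulgK mulgK.
  case/asboolP; exists x; split=> //; rewrite mulVg; exact: subgrp1.
move=> Lxy; apply: eq_pick => a; apply/asboolP/asboolP => -[z [Hz xz <-]].
  exists z; split=> //.
  by have := subgrpM sL (subgrp_swap sL Lxy) xz; rewrite mulgA mulgK.
exists z; split=> //.
by have := subgrpM sL Lxy xz; rewrite mulgA mulgK.
Qed.

Section CosetAutomaton.
Variables (H L : set E) (T : finType) (l : E -> T).
Hypothesis sH : subgrp H.
Hypothesis lP : forall x y, H x -> H y -> l x = l y <-> L (x^-1 * y).

Variables (X : finType) (s : X -> E).
Hypothesis Hs : forall x, H (s x).

Definition run (d : {ffun (X * bool) * T -> T}) q (u : word X) :=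
  foldr (fun a q => d (a, q)) q u.

(** The letters permute the left cosets of [L] in [H], so a word read from its right end by a finite
    automaton with state set [T] ends in the label of the coset of its product. *)
Lemma run_coset : exists d q, forall u v,
  run d q u = run d q v -> L ((word_prod s u)^-1 * word_prod s v).
Proof.
pose step (a : X * bool) x := word_prod s [:: a] * x.
pose d : {ffun (X * bool) * T -> T} :=
  [ffun aq => l (step aq.1 (xget 1 [set x | H x /\ l x = aq.2]))].
have Hw u : H (word_prod s u) by apply: subgrp_word.
exists d, (l 1); have runE u : run d (l 1) u = l (word_prod s u).
  elim: u => [|a u IH]; first by rewrite /run /= /word_prod big_nil.
  rewrite /run /= -/(run _ _ _) IH ffunE /=.
  case: xgetP => [x _ [Hx lx]|/(_ (word_prod s u)) []]; last by [].
  rewrite -cat1s word_prod_cat; apply/lP.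
  - by apply: subgrpM.
  - by apply: subgrpM.
  have -> : (step a x)^-1 * (word_prod s [:: a] * word_prod s u) =
    x^-1 * word_prod s u by rewrite /step; group_simp.
  exact/lP.
by move=> u v; rewrite !runE => /lP; apply.
Qed.

End CosetAutomaton.

(** For a fixed label type there are only finitely many automata with a given start state. Labelling
    an element by the final states of all of them, on a word representing it, separates it modulo
    every subgroup in the intersection at once. *)
Lemma core_index T H : subgrp H -> fin_gen H -> index_finite H (core T H).
Proof.
move=> sH [X [s [Hs gH]]].
pose D := ({ffun (X * bool) * option T -> option T} * option T)%type.
pose w x : word X := xget [::] [set u | x = word_prod s u].
have wP x : H x -> x = word_prod s (w x).
  move=> /gH [u xu]; rewrite /w; case: xgetP => [v _ //|/(_ u)]; by case.
exists {ffun D -> option T}, (fun x => [ffun dq : D => run dq.1 dq.2 (w x)]).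
move=> x y Hx Hy /ffunP eq_lab; split.
  by apply: subgrpM => //; apply: subgrpV.
move=> L sL LH /(index_by_exact sH sL) [l lP].
have [d [q run_inj]] := run_coset sH lP Hs.
by rewrite (wP _ Hx) (wP _ Hy); apply: run_inj; have := eq_lab (d, q); rewrite !ffunE.
Qed.

(** * Bounded detection and its passage up an extension *)

Definition bounded f H K := forall g, H g -> (forall k, ~ K (iter k f g)) ->
  exists T, forall k, exists L,
    [/\ subgrp L, L `<=` H, index_by H L T & ~ L (iter k f g)].

(* Finite extensions of the quotient [H / K] are residually finite. *)
Definition fin_ext_rf H K := forall K1, subgrp K1 -> K1 `<=` K ->
  normalized K1 H -> index_finite K K1 ->
  exists L, [/\ subgrp L, L `<=` H, index_finite H L &
    forall x, L x -> K x -> K1 x].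

Lemma iter_morph f k : {morph f : x y / x * y} -> {morph iter k f : x y / x * y}.
Proof. by move=> fM x y; elim: k => //= k ->; rewrite fM. Qed.

Lemma iter_sub f k H x : (forall x, H x -> H (f x)) -> H x -> H (iter k f x).
Proof. by move=> fH Hx; elim: k => //= k; apply: fH. Qed.

(** An orbit that never meets [K] is detected modulo [K]. One that enters [K] at time [k0] is
    detected there with some bound [T]; the core of [K] for [T] is normal in [H], and a subgroup of
    finite index in [H] whose trace on [K] lies in this core excludes all iterates from [k0] on. Its
    preimage under [f^k0] excludes every iterate. *)
Lemma bounded_step f H K : {morph f : x y / x * y} ->
  subgrp H -> subgrp K -> K `<=` H -> normalized K H -> fin_gen K ->
  (forall x, H x -> H (f x)) -> (forall x, K x -> K (f x)) ->
  bounded f K [set 1] -> bounded f H K -> fin_ext_rf H K ->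
  bounded f H [set 1].
Proof.
move=> fM sH sK KH nKH gK fH fK bK bHK rf g Hg g1.
have [[k0 Kg]|nKg] := pselect (exists k, K (iter k f g)); last first.
  by apply: bHK => // k Kk; apply: nKg; exists k.
have [|T bT] := bK _ Kg; first by move=> k; rewrite -iterD; apply: g1.
have [L0 [sL0 L0H [T0 iL0] L0K]] := rf (core T K) (core_subgrp T sK)
  (@core_sub T K) (core_normalized sK nKH) (core_index T sK gK).
exists T0 => k; exists (H `&` iter k0 f @^-1` L0); split.
- by apply: subgrp_preim => //; apply: iter_morph.
- by move=> x [].
- by apply: index_preim iL0 => //; [exact: iter_morph|move=> x; apply: iter_sub].
move=> [_ /=]; rewrite -iterD addnC iterD => /L0K coreK.
have [L [sL LK iL nL]] := bT k.
by apply: nL; have [] := coreK (iter_sub _ fK Kg) => _; apply.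
Qed.

Lemma index_trans H K K1 : subgrp H -> subgrp K -> index_finite H K ->
  index_finite K K1 -> index_finite H K1.
Proof.
move=> sH sK [T [l lP]] [T1 [l1 l1P]].
pose r a := xget 1 [set x | H x /\ l x = a].
have rP x : H x -> H (r (l x)) /\ l (r (l x)) = l x.
  by move=> Hx; rewrite /r; case: xgetP => [y _ //|/(_ x) []].
exists (T * T1)%type, (fun x => (l x, l1 ((r (l x))^-1 * x))).
move=> x y Hx Hy [lxy]; have [Hr lr] := rP _ Hx.
rewrite -lxy => /l1P.
have -> : ((r (l x))^-1 * x)^-1 * ((r (l x))^-1 * y) = x^-1 * y by group_simp.
by apply; [exact: lP|apply: lP => //; rewrite lr].
Qed.

Lemma fin_ext_rf_finite H K : subgrp H -> subgrp K -> K `<=` H ->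
  index_finite H K -> fin_ext_rf H K.
Proof.
move=> sH sK KH iK K1 sK1 K1K _ iK1; exists K1; split=> //.
- exact: subset_trans KH.
- exact: index_trans iK1.
Qed.

(** With a complement [S] of [K], the product [K1 S] is a subgroup because [K1] is normalized by
    [H]. Cosets are labelled through their component in [K], and the product meets [K] in [K1]. *)
Lemma fin_ext_rf_split H K S : subgrp H -> subgrp K -> K `<=` H ->
  subgrp S -> S `<=` H ->
  (forall h, H h -> exists k s, [/\ K k, S s & h = k * s]) ->
  (forall x, S x -> K x -> x = 1) -> fin_ext_rf H K.
Proof.
move=> sH sK KH sS SH dec SK K1 sK1 K1K nK1 [T [l lP]].
exists [set x | exists k s, [/\ K1 k, S s & x = k * s]]; split.
- split.
  + by exists 1, 1; rewrite mulg1; split=> //; exact: subgrp1.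
  + move=> _ _ [k [s [Kk Ss ->]]] [k' [s' [Kk' Ss' ->]]].
    exists (k * k' ^ s^-1), (s * s'); split; last first.
    * by rewrite /conjg invgK !mulgA mulgVK.
    * exact: subgrpM.
    * by apply: subgrpM => //; apply: nK1 => //; apply: SH; apply: subgrpV.
  + move=> _ [k [s [Kk Ss ->]]]; exists (k^-1 ^ s), s^-1; split; last first.
    * by rewrite /conjg invgM !mulgA mulgK.
    * exact: subgrpV.
    by apply: nK1; [apply: subgrpV|apply: SH].
- by move=> _ [k [s [Kk Ss ->]]]; apply: subgrpM => //; [apply/KH/K1K|apply: SH].
- exists T, (fun x => l (xget 1 [set k | K k /\ S (k^-1 * x)])).
  have pick h : H h -> let k := xget 1 [set k | K k /\ S (k^-1 * h)] in
      K k /\ S (k^-1 * h).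
    move=> /dec [k [s [Kk Ss hE]]] /=; case: xgetP => [x _ //|/(_ k) []].
    by split=> //; rewrite hE mulKg.
  move=> x y /pick; set k := xget _ _ => -[Kk Sx] /pick; set k' := xget _ _.
  move=> [Kk' Sy] /lP-/(_ Kk Kk') K1kk.
  exists ((k^-1 * k') ^ (k^-1 * x)), ((k^-1 * x)^-1 * (k'^-1 * y)); split.
  + by apply: nK1 => //; apply: SH.
  + by apply: subgrpM => //; apply: subgrpV.
  by group_simp.
- move=> _ [k [s [Kk Ss ->]]] Kks.
  by rewrite (SK s Ss) ?mulg1 //; apply: subgrp_mulKl Kks => //; apply: K1K.
Qed.

(** The subgroup [L] found in [H1] need not be normalized by [H2]. The core of [H1] for the labels
    of [L] is, it lies in [L], and it has finite index because [H1] is finitely generated. *)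
Lemma fin_ext_rf_trans H1 H2 K : subgrp H1 -> fin_gen H1 -> H1 `<=` H2 ->
  normalized H1 H2 -> K `<=` H1 ->
  fin_ext_rf H1 K -> fin_ext_rf H2 H1 -> fin_ext_rf H2 K.
Proof.
move=> sH1 gH1 H12 nH1 KH1 rf1 rf2 K1 sK1 K1K nK1 iK1.
have nK11 : normalized K1 H1 by move=> x y Kx /H12; apply: nK1.
have [L [sL LH1 [T iL] LK]] := rf1 K1 sK1 K1K nK11 iK1.
have [L2 [sL2 LH2 iL2 L2K]] := rf2 (core T H1) (core_subgrp T sH1)
  (@core_sub T H1) (core_normalized sH1 nH1) (core_index T sH1 gH1).
exists L2; split=> // x L2x Kx; apply: LK => //.
by have [_] := L2K x L2x (KH1 x Kx); apply.
Qed.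

End Subgroups.

(** * Cyclic and polycyclic extensions *)

Section CyclicExtensions.
Local Open Scope classical_set_scope.
Local Open Scope group_scope.
Context {E : groupType}.
Implicit Types (H K L S X : set E) (T : finType) (f : E -> E).

Definition signed_pow (c : E) (b : bool) n : E := if b then c ^+ n else c ^- n.

Lemma signed_powM c b n b' n' : exists b0 n0,
  signed_pow c b n * signed_pow c b' n' = signed_pow c b0 n0.
Proof.
have div m k : exists b0 n0, c ^+ m * c ^- k = signed_pow c b0 n0.
  have [km|/ltnW mk] := leqP k m; first by exists true, (m - k)%N; rewrite -expgnFr.
  by exists false, (k - m)%N; rewrite /= expgnFr // invgF.
case: b b' => [] [] /=; first by exists true, (n + n')%N; rewrite /= expgnDr.
- exact: div.
- have [b0 [n0 eq0]] := div n' n; exists b0, n0; rewrite -eq0.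
  apply: commute_sym; apply: commuteV; exact: commuteX2 (commute_refl c).
by exists false, (n' + n)%N; rewrite /= expgnDr invgM.
Qed.

Lemma signed_powV c b n : (signed_pow c b n)^-1 = signed_pow c (~~ b) n.
Proof. by case: b; rewrite /= ?invgK. Qed.

Lemma signed_powMn c b n m : signed_pow c b (n * m) = signed_pow c b n ^+ m.
Proof. by case: b; rewrite /= ?expgnA // expVgn. Qed.

Lemma signed_powC c b n m : signed_pow c b n ^+ m = signed_pow (c ^+ m) b n.
Proof. by case: b; rewrite /= ?expVgn -!expgnA mulnC. Qed.

Lemma subgrp_signed_pow H c b n : subgrp H -> H c -> H (signed_pow c b n).
Proof.
by move=> sH Hc; case: b => /=; [|apply: subgrpV => //]; apply: subgrpX.
Qed.

Record cyc_ext H1 H (c : E) : Prop := CycExt {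
  cyc_sub : H1 `<=` H;
  cyc_gen : H c;
  cyc_normal : normalized H1 H;
  cyc_dec : forall h, H h -> exists x b n, H1 x /\ h = x * signed_pow c b n }.

Inductive polyc K : nat -> set E -> Prop :=
| polyc0 : polyc K 0 K
| polycS n H1 H c : polyc K n H1 -> subgrp H -> cyc_ext H1 H c ->
    polyc K n.+1 H.

Lemma polyc_subgrp K n H : subgrp K -> polyc K n H -> subgrp H.
Proof. by move=> sK []. Qed.

Lemma polyc_sub K n H : polyc K n H -> K `<=` H.
Proof. by elim=> {n H} [//|n H1 H c _ KH1 _ [H1H _ _ _]]; apply: subset_trans H1H. Qed.

Lemma word_prod_nseq (c : E) n b :
  word_prod (fun _ : unit => c) (nseq n (tt, b)) = signed_pow c b n.
Proof.
elim: n => [|n IH]; first by rewrite /word_prod big_nil; case: b; rewrite /= ?invg1.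
rewrite /= word_prod_cons IH /=; case: b {IH}; rewrite /= ?expgS // -expgS.
by rewrite expgSr invgM.
Qed.

Lemma cyc_ext_fin_gen H1 H c : cyc_ext H1 H c -> fin_gen H1 -> fin_gen H.
Proof.
move=> [H1H Hc nH dec] gH1; apply: (fin_gen_ext (t := fun _ : unit => c) gH1) => //.
move=> h /dec [x [b [n [Hx ->]]]]; exists x, (nseq n (tt, b)).
by rewrite word_prod_nseq.
Qed.

Lemma polyc_fin_gen K n H : polyc K n H -> fin_gen K -> fin_gen H.
Proof.
by elim=> {n H} [//|n H1 H c _ IH _ ext gK]; apply: cyc_ext_fin_gen ext (IH gK).
Qed.

Lemma cyc_ext_index H1 H c m : subgrp H1 -> subgrp H -> cyc_ext H1 H c ->
  (0 < m)%N -> H1 (c ^+ m) -> index_finite H H1.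
Proof.
move=> sH1 sH [H1H Hc nH dec] m0 Hcm.
have dec' h : H h -> exists (bn : bool * 'I_m) x,
    H1 x /\ h = x * signed_pow c bn.1 bn.2.
  move=> /dec [x [b [n [Hx ->]]]].
  exists (b, Ordinal (ltn_pmod n m0)), (x * signed_pow (c ^+ m) b (n %/ m)).
  split; first by apply: subgrpM => //; apply: subgrp_signed_pow.
  rewrite -mulgA; congr (_ * _); rewrite [in LHS](divn_eq n m) /=.
  case: b; rewrite /= -expgnA ?[(m * _)%N]mulnC ?expgnDr //.
  by rewrite -expgnDr addnC expgnDr invgM.
exists (option (bool * 'I_m)%type), (fun h => [pick bn : bool * 'I_m | `[< exists x,
    H1 x /\ h = x * signed_pow c bn.1 bn.2 >]]).
move=> x y Hx Hy.
case: pickP => [bn /asboolP[x' [Hx' xE]]|/(_ _)]; last first.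
  by have [bn bnP] := dec' x Hx => /(_ bn) /asboolP; case.
case: pickP => [bn' /asboolP[y' [Hy' yE]] [eqbn]|/(_ _)]; last first.
  by have [bn0 bnP] := dec' y Hy => /(_ bn0) /asboolP; case.
rewrite -eqbn in yE; rewrite xE yE.
set z := signed_pow _ _ _.
have -> : (x' * z)^-1 * (y' * z) = (x'^-1 * y') ^ z by group_simp.
apply: nH; last exact: subgrp_signed_pow.
by apply: subgrpM => //; apply: subgrpV.
Qed.

(** Either a positive power of [c] lies in [H1] and the index is finite, or the powers of [c] form a
    complement of [H1]. *)
Lemma fin_ext_rf_cyclic H1 H c : subgrp H1 -> subgrp H -> cyc_ext H1 H c ->
  fin_ext_rf H H1.
Proof.
move=> sH1 sH ext; have [H1H Hc nH dec] := ext.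
have [[m [m0 Hcm]]|ncm] := pselect (exists m, (0 < m)%N /\ H1 (c ^+ m)).
  by apply: fin_ext_rf_finite => //; apply: cyc_ext_index ext m0 Hcm.
apply: (fin_ext_rf_split (S := [set x | exists b n, x = signed_pow c b n])) => //.
- split; first by exists true, 0%N.
  + by move=> _ _ [b [n ->]] [b' [n' ->]]; apply: signed_powM.
  + by move=> _ [b [n ->]]; exists (~~ b), n; rewrite signed_powV.
- by move=> _ [b [n ->]]; apply: subgrp_signed_pow.
- move=> h /dec [x [b [n [Hx ->]]]]; exists x, (signed_pow c b n).
  by split=> //; exists b, n.
move=> _ [b [n ->]] Hcn; case: n Hcn => [|n]; first by case: b; rewrite /= ?invg1.
move=> Hcn; case: ncm; exists n.+1; split=> //.
by case: b Hcn => //= /(subgrpV sH1); rewrite invgK.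
Qed.

Lemma fin_ext_rf_polyc K n H : subgrp K -> fin_gen K -> polyc K n H ->
  fin_ext_rf H K.
Proof.
move=> sK gK; elim=> {n H} [|n H1 H c pH1 IH sH ext].
  move=> K1 sK1 K1K _ iK1; by exists K1.
have sH1 := polyc_subgrp sK pH1; have [H1H _ nH _] := ext.
apply: (fin_ext_rf_trans sH1 (polyc_fin_gen pH1 gK) H1H nH (polyc_sub pH1) IH).
exact: fin_ext_rf_cyclic ext.
Qed.

Lemma mulg_pow_mod H1 H x c q : subgrp H1 -> subgrp H -> normalized H1 H ->
  H1 x -> H c -> exists2 x', H1 x' & (x * c) ^+ q = x' * c ^+ q.
Proof.
move=> sH1 sH nH Hx Hc; elim: q => [|q [x' Hx' IH]].
  by exists 1; [exact: subgrp1|rewrite mulg1].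
exists (x * x' ^ c^-1); last by rewrite expgS IH expgS; group_simp.
by apply: subgrpM => //; apply: nH => //; apply: subgrpV.
Qed.

(** The generator is an element [x0 c^m] of [S] with [x0] in [H1] and [m] the least positive
    exponent that occurs; division with remainder reduces every other element to it. If no positive
    exponent occurs, then [S] lies in [H1] and the generator is 1. *)
Lemma cyc_ext_sub H1 H c S : subgrp H1 -> subgrp H -> subgrp S -> S `<=` H ->
  cyc_ext H1 H c -> exists c', cyc_ext (S `&` H1) S c'.
Proof.
move=> sH1 sH sS SH [H1H Hc nH dec].
have nS : normalized (S `&` H1) S.
  move=> x y [Sx Hx] Sy; split; last by apply: nH => //; apply: SH.
  by apply: subgrpM => //; [apply: subgrpV|apply: subgrpM].
have dec' h : S h -> exists x n, H1 x /\ (h = x * c ^+ n \/ h^-1 = x * c ^+ n).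
  move=> /SH /dec [x [[] [n [Hx hE]]]]; first by exists x, n; split=> //; left.
  exists (x^-1 ^ c ^- n), n; split.
    by apply: nH; [apply: subgrpV|apply: subgrpV => //; apply: subgrpX].
  by right; rewrite hE /=; group_simp.
pose P m := (0 < m)%N && `[< exists2 x, H1 x & S (x * c ^+ m) >].
have [exP|nP] := pselect (exists m, P m); last first.
  have nm x m : H1 x -> S (x * c ^+ m) -> m = 0%N.
    move=> Hx Sx; case: m Sx => // m Sx; case: nP; exists m.+1.
    by apply/andP; split=> //; apply/asboolP; exists x.
  exists 1; split=> //; first exact: subgrp1.
  move=> h Sh; exists h, true, 0%N; rewrite /= mulg1; do !split=> //.
  have [x [n [Hx [hE|hE]]]] := dec' h Sh.
    rewrite hE (nm x n) ?mulg1 // -hE //.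
  rewrite -[h]invgK; apply: subgrpV => //.
  by rewrite hE (nm x n) ?mulg1 // -hE; apply: subgrpV.
case: (ex_minnP exP) => m /andP[m0 /asboolP[x0 Hx0 Sx0]] m_min.
have key x n : H1 x -> S (x * c ^+ n) ->
    exists2 y, (S `&` H1) y & x * c ^+ n = y * (x0 * c ^+ m) ^+ (n %/ m).
  move=> Hx Sx; set q := (n %/ m)%N.
  have [x' Hx' qE] := mulg_pow_mod q sH1 sH nH Hx0 (subgrpX m sH Hc).
  exists (x * c ^+ n * ((x0 * c ^+ m) ^+ q)^-1); last by rewrite mulgVK.
  have Sy : S (x * c ^+ n * ((x0 * c ^+ m) ^+ q)^-1).
    by apply: subgrpM => //; apply: subgrpV => //; apply: subgrpX.
  split=> //; move: Sy; rewrite qE -expgnA.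
  have -> : c ^+ n = c ^+ (n %% m) * c ^+ (m * q).
    by rewrite -expgnDr addnC mulnC -divn_eq.
  set r := (n %% m)%N.
  have -> : x * (c ^+ r * c ^+ (m * q)) * (x' * c ^+ (m * q))^-1 =
     x * x'^-1 ^ (c ^- r) * c ^+ r by group_simp.
  have Hy : H1 (x * x'^-1 ^ (c ^- r)).
    apply: subgrpM => //; apply: nH; first exact: subgrpV.
    by apply: subgrpV => //; apply: subgrpX.
  move: (x * _) Hy => y Hy Sr; suff r0 : r = 0%N by rewrite r0 mulg1.
  apply/eqP; rewrite -leqn0 leqNgt; apply/negP => r0.
  suff : (m <= r)%N by rewrite leqNgt ltn_mod m0.
  by apply: m_min; apply/andP; split=> //; apply/asboolP; exists y.
exists (x0 * c ^+ m); split=> //.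
move=> h Sh; have [x [n [Hx [hE|hE]]]] := dec' h Sh.
  have [|y yP yE] := key x n Hx; first by rewrite -hE.
  by exists y, true, (n %/ m)%N; rewrite hE yE.
have [|y [Sy Hy] yE] := key x n Hx; first by rewrite -hE; apply: subgrpV.
set z := x0 * c ^+ m in yE *; set q := (n %/ m)%N in yE *.
exists (y^-1 ^ (z ^+ q)), false, q; split.
  apply: nS; last exact: subgrpX.
  by split; apply: subgrpV.
by rewrite -[h]invgK hE yE /=; group_simp.
Qed.

(** The Noetherian property in the form used below: an intermediate subgroup has a cyclic series
    over [K] of the same length, hence is finitely generated over [K]. *)
Lemma polyc_noether K n H S : subgrp K -> polyc K n H -> subgrp S ->
  K `<=` S -> S `<=` H -> polyc K n S.
Proof.
move=> sK pH; elim: pH S => {n H} [|n H1 H c pH1 IH sH ext] S sS KS SH.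
  suff -> : S = K by exact: polyc0.
  by apply/seteqP.
have sH1 := polyc_subgrp sK pH1.
have [c' ext'] := cyc_ext_sub sH1 sH sS SH ext.
apply: (polycS _ sS ext'); apply: IH; first exact: subgrpI.
  by move=> x Kx; split; [apply: KS|apply: polyc_sub pH1 x Kx].
by move=> x [].
Qed.

Definition abelian_mod H K := forall x y, H x -> H y -> K [~ x, y].

Section AbelianMod.
Variables (H K : set E).
Hypotheses (sH : subgrp H) (sK : subgrp K) (KH : K `<=` H).
Hypothesis abHK : abelian_mod H K.

Lemma abelian_mod_normalized X : subgrp X -> K `<=` X -> X `<=` H ->
  normalized X H.
Proof.
move=> sX KX XH x y Xx Hy; have -> : x ^ y = x * [~ x, y].
  by rewrite commgEl; group_simp.
by apply: subgrpM => //; apply/KX/abHK => //; apply: XH.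
Qed.

Lemma abelian_mod_pow x y n : H x -> H y ->
  exists2 k, K k & (x * y) ^+ n = x ^+ n * y ^+ n * k.
Proof.
move=> Hx Hy; elim: n => [|n [k Kk IH]].
  by exists 1; [exact: subgrp1|rewrite !mulg1].
have nK : normalized K H by exact: abelian_mod_normalized.
exists ([~ y, x ^+ n] ^ (y ^+ n) * k).
  apply: subgrpM => //; apply: nK; last exact: subgrpX.
  by apply: abHK => //; apply: subgrpX.
rewrite [in LHS]expgS IH [x ^+ n.+1]expgS [y ^+ n.+1]expgS commgEl; group_simp.
by rewrite -!mulgA.
Qed.

Lemma abelian_mod_pow_in X x y n : subgrp X -> K `<=` X -> H x -> H y ->
  X (x ^+ n) -> X (y ^+ n) -> X ((x * y) ^+ n).
Proof.
move=> sX KX Hx Hy Xx Xy; have [k Kk ->] := abelian_mod_pow n Hx Hy.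
by do !apply: subgrpM => //; apply: KX.
Qed.

Lemma torsion_subgrp X : subgrp X -> K `<=` X ->
  subgrp [set x | H x /\ exists m, (0 < m)%N /\ X (x ^+ m)].
Proof.
move=> sX KX; split.
- by split; [exact: subgrp1|exists 1%N; split=> //; apply: subgrp1].
- move=> x y [Hx [m [m0 Xx]]] [Hy [m' [m0' Xy]]]; split; first exact: subgrpM.
  exists (m * m')%N; split; first by rewrite muln_gt0 m0.
  apply: abelian_mod_pow_in => //; first by rewrite expgnA; apply: subgrpX.
  by rewrite mulnC expgnA; apply: subgrpX.
- move=> x [Hx [m [m0 Xx]]]; split; first exact: subgrpV.
  by exists m; split=> //; rewrite expVgn; apply: subgrpV.
Qed.

Lemma torsion_exponent X n S : subgrp X -> K `<=` X -> S `<=` H ->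
  polyc K n S -> (forall x, S x -> exists m, (0 < m)%N /\ X (x ^+ m)) ->
  exists N, (0 < N)%N /\ forall x, S x -> X (x ^+ N).
Proof.
move=> sX KX SH pS; elim: pS SH => {n S} [|n H1 S c pH1 IH sS [H1S Sc nH dec]] SH tors.
  by exists 1%N; split=> // x Kx; apply: KX.
have [||N [N0 XN]] := IH; first exact: subset_trans SH.
  by move=> x /H1S /tors.
have [m [m0 Xc]] := tors c Sc.
exists (N * m)%N; split; first by rewrite muln_gt0 N0.
move=> h /dec [x [b [z [Hx ->]]]].
apply: abelian_mod_pow_in => //; [exact/SH/H1S| |by rewrite expgnA; apply: subgrpX => //; apply: XN|].
  by apply: SH; apply: subgrp_signed_pow.
rewrite mulnC expgnA signed_powC; apply: subgrpX => //.
exact: subgrp_signed_pow.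
Qed.

(** The preimage in [H] of the [p]-th powers of the abelian group [H / K]. It has finite index for
    every positive [p] when [H / K] is finitely generated, and [p] need not be prime. *)
Definition pow_set p : set E := [set x | exists a k, [/\ H a, K k & x = a ^+ p * k]].

Lemma pow_set_subgrp p : subgrp (pow_set p).
Proof.
have nK : normalized K H by exact: abelian_mod_normalized.
split.
- by exists 1, 1; rewrite expg1n mulg1; split=> //; exact: subgrp1.
- move=> _ _ [a [k [Ha Kk ->]]] [b [l [Hb Kl ->]]].
  have [d Kd dE] := abelian_mod_pow p Ha Hb.
  exists (a * b), (d^-1 * (k ^ (b ^+ p) * l)); split; last first.
  + by rewrite dE; group_simp.
  + apply: subgrpM => //; first exact: subgrpV.
    by apply: subgrpM => //; apply: nK => //; apply: subgrpX.
  + exact: subgrpM.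
- move=> _ [a [k [Ha Kk ->]]]; exists a^-1, (k^-1 ^ (a ^- p)); split.
  + exact: subgrpV.
  + by apply: nK; apply: subgrpV => //; apply: subgrpX.
  by rewrite expVgn; group_simp.
Qed.

Lemma pow_set_sub p : K `<=` pow_set p.
Proof.
by move=> k Kk; exists 1, k; rewrite expg1n mul1g; split=> //; apply: subgrp1.
Qed.

Lemma pow_set_subH p : pow_set p `<=` H.
Proof.
by move=> _ [a [k [Ha Kk ->]]]; apply: subgrpM => //; [apply: subgrpX|apply: KH].
Qed.

Lemma pow_set_index p n S : (0 < p)%N -> S `<=` H -> polyc K n S ->
  index_finite S (pow_set p).
Proof.
move=> p0 SH pS; elim: pS SH => {n S} [|n H1 S c pH1 IH sS [H1S Sc nH dec]] SH.
  exists unit, (fun=> tt) => x y Kx Ky _; apply: pow_set_sub.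
  by apply: subgrpM => //; apply: subgrpV.
have sP := pow_set_subgrp p.
have nP : normalized (pow_set p) H.
  by apply: abelian_mod_normalized => //; [apply: pow_set_sub|apply: pow_set_subH].
have [T [l lP]] := IH (subset_trans H1S SH).
have /choice [d dP] : forall h : E, exists xbn : E * (bool * nat),
    S h -> H1 xbn.1 /\ h = xbn.1 * signed_pow c xbn.2.1 xbn.2.2.
  move=> h; have [Sh|] := pselect (S h); last by exists (1, (true, 0%N)).
  by have [x [b [z P]]] := dec h Sh; exists (x, (b, z)).
exists (T * (bool * 'I_p))%type, (fun h =>
  (l (d h).1, ((d h).2.1, Ordinal (ltn_pmod (d h).2.2 p0)))).
move=> h h' /dP + /dP.
case: (d h) (d h') => [x [b z]] [x' [b' z']] /= [Hx ->] [Hx' ->] [/lP lxx -> zz'].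
have {lxx} lxx := lxx Hx Hx'.
have Hc : H c by apply: SH.
have Pc q : pow_set p (signed_pow c b' (p * q)).
  exists (signed_pow c b' q), 1; rewrite mulg1; split=> //; last first.
  + by rewrite mulnC signed_powMn.
  + exact: subgrp1.
  + exact: subgrp_signed_pow.
have main y y' w w' : (w <= w')%N -> w = w' %[mod p] ->
    pow_set p (y^-1 * y') ->
    pow_set p ((y * signed_pow c b' w)^-1 * (y' * signed_pow c b' w')).
  move=> ww' eqw Py.
  have -> : signed_pow c b' w' = signed_pow c b' w * signed_pow c b' (p * ((w' - w) %/ p)).
    rewrite mulnC divnK; last by rewrite -eqn_mod_dvd // eqw.
    by case: (b') => /=; rewrite -?invgM -expgnDr ?subnKC // subnK.
  rewrite invgM !mulgA; apply: subgrpM => //.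
  rewrite -mulgA -mulgA [y^-1 * _]mulgA; apply: nP => //.
  exact: subgrp_signed_pow.
have [ww'|/ltnW ww'] := leqP z z'; first exact: main.
apply: subgrp_swap => //; apply: main => //; exact: subgrp_swap.
Qed.

End AbelianMod.

Lemma polyc_quotient H K X n S : subgrp H -> subgrp K -> abelian_mod H X ->
  subgrp X -> K `<=` X -> X `<=` H -> S `<=` H ->
  polyc K n S -> polyc X n [set z | exists x s, [/\ X x, S s & z = x * s]].
Proof.
move=> sH sK abHX sX KX XH SH pS; elim: pS SH => {n S} [|n H1 S c pH1 IH sS ext] SH.
  suff -> : [set z | exists x s, [/\ X x, K s & z = x * s]] = X by exact: polyc0.
  apply/seteqP; split=> [_ [x [k [Xx Kk ->]]]|x Xx].
    by apply: subgrpM => //; apply: KX.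
  by exists x, 1; rewrite mulg1; split=> //; apply: subgrp1.
have [H1S Sc nS dec] := ext.
have nX : normalized X H by exact: (abelian_mod_normalized abHX).
have prod_sub Y : subgrp Y -> Y `<=` H ->
    subgrp [set z | exists x s, [/\ X x, Y s & z = x * s]].
  move=> sY YH; split.
  - by exists 1, 1; rewrite mulg1; split=> //; exact: subgrp1.
  - move=> _ _ [x [s [Xx Ys ->]]] [x' [s' [Xx' Ys' ->]]].
    exists (x * x' ^ s^-1), (s * s'); split; last by group_simp.
      by apply: subgrpM => //; apply: nX => //; apply: subgrpV => //; apply: YH.
    exact: subgrpM.
  - move=> _ [x [s [Xx Ys ->]]]; exists (x^-1 ^ s), s^-1; split; last by group_simp.
      by apply: nX; [apply: subgrpV|apply: YH].
    exact: subgrpV.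
have sH1 : subgrp H1 by exact: polyc_subgrp pH1.
have subH Y : Y `<=` H -> [set z | exists x s, [/\ X x, Y s & z = x * s]] `<=` H.
  by move=> YH _ [x [s [Xx Ys ->]]]; apply: subgrpM => //; [apply: XH|apply: YH].
apply: (@polycS _ _ _ _ c (IH (subset_trans H1S SH)) (prod_sub S sS SH)); split.
- by move=> _ [x [s [Xx Ss ->]]]; exists x, s; split=> //; apply: H1S.
- by exists 1, c; rewrite mul1g; split=> //; apply: subgrp1.
- move=> z y Xz Yy.
  apply: (abelian_mod_normalized abHX (prod_sub H1 sH1 (subset_trans H1S SH))) => //.
  + by move=> k Xk; exists k, 1; rewrite mulg1; split=> //; exact: subgrp1.
  + exact/subH/(subset_trans H1S SH).
  + exact: (subH S SH).
- move=> _ [x [s [Xx Ss ->]]]; have [y [b [m [Hy ->]]]] := dec s Ss.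
  by exists (x * y), b, m; rewrite mulgA; split=> //; exists x, y.
Qed.

End CyclicExtensions.

(** * Bounded detection *)

Section BoundedDetection.
Local Open Scope classical_set_scope.
Local Open Scope group_scope.
Context {E : groupType}.
Implicit Types (H K L S X : set E) (T : finType).
Variable f : E -> E.
Hypothesis fM : {morph f : x y / x * y}.

Lemma bounded_finite H K : subgrp K -> K `<=` H -> index_finite H K ->
  bounded f H K.
Proof.
by move=> sK KH [T iK] g Hg nK; exists T => k; exists K; split.
Qed.

(** As [H / K] is Noetherian, the kernels of the iterates of [f] modulo [K] stabilize at some [j],
    and [f] is injective modulo [K] on [A = f^j(H) K]. There a single subgroup [A^p K], for suitable
    [p], avoids the whole orbit of [w = f^j g]. *)
Lemma bounded_abelian H K n : subgrp H -> subgrp K -> K `<=` H ->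
  abelian_mod H K -> polyc K n H ->
  (forall x, H x -> H (f x)) -> (forall x, K x -> K (f x)) -> bounded f H K.
Proof.
move=> sH sK KH ab pH fH fK g Hg nKg.
have fkM k : {morph iter k f : x y / x * y} by exact: iter_morph.
have nK : normalized K H by apply: (abelian_mod_normalized ab) => //.
have [j jP] : exists j, forall x, H x -> (exists k, K (iter k f x)) -> K (iter j f x).
  pose U : set E := [set x | H x /\ exists k, K (iter k f x)].
  have fKk k x : K x -> K (iter k f x) by exact: iter_sub.
  have sU : subgrp U.
    split.
    - by split; [exact: subgrp1|exists 0%N; exact: subgrp1].
    - move=> x y [Hx [k Kx]] [Hy [l Ky]]; split; first exact: subgrpM.
      exists (k + l)%N; rewrite fkM; apply: subgrpM => //.
        by rewrite addnC iterD; apply: fKk.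
      by rewrite iterD; apply: fKk.
    - move=> x [Hx [k Kx]]; split; first exact: subgrpV.
      by exists k; rewrite morphVg //; apply: subgrpV.
  have pU : polyc K n U.
    apply: (polyc_noether sK pH sU); last by move=> x [].
    by move=> x Kx; split; [exact: KH|exists 0%N].
  suff [j jP] : exists j, forall x, U x -> K (iter j f x).
    by exists j => x Hx kx; apply: jP.
  have : forall m S, polyc K m S -> S `<=` U ->
      exists j, forall x, S x -> K (iter j f x).
    move=> m S; elim=> {m S} [|m H1 S c _ IH sS [H1S Sc nS dec]] SU.
      by exists 0%N.
    have [j1 j1P] := IH (subset_trans H1S SU).
    have [_ [j2 j2P]] := SU c Sc.
    exists (j1 + j2)%N => _ /dec [x [b [z [Hx ->]]]].
    rewrite fkM; apply: subgrpM => //.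
      by rewrite addnC iterD; apply/fKk/j1P.
    rewrite iterD; apply: fKk; case: b; rewrite /= ?morphVg // morphXg //.
      exact: subgrpX.
    by apply: subgrpV => //; apply: subgrpX.
  by move=> /(_ n U pU); apply.
pose A : set E := [set x | exists h k, [/\ H h, K k & x = iter j f h * k]].
have prod_subgrp B : subgrp B -> B `<=` H ->
    subgrp [set x | exists b k, [/\ B b, K k & x = b * k]].
  move=> sB BH; split.
  - by exists 1, 1; rewrite mulg1; split=> //; exact: subgrp1.
  - move=> _ _ [b [k [Bb Kk ->]]] [b' [k' [Bb' Kk' ->]]].
    exists (b * b'), (k ^ b' * k'); split; [exact: subgrpM| |by group_simp].
    by apply: subgrpM => //; apply: nK => //; apply: BH.
  - move=> _ [b [k [Bb Kk ->]]]; exists b^-1, (k^-1 ^ b^-1).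
    split; [exact: subgrpV| |by group_simp].
    by apply: nK; apply: subgrpV => //; apply: BH.
have im_subgrp k B : subgrp B -> subgrp [set x | exists2 b, B b & x = iter k f b].
  move=> sB; split.
  - by exists 1; [exact: subgrp1|rewrite morph1g].
  - by move=> _ _ [x Bx ->] [y By ->]; exists (x * y); [exact: subgrpM|rewrite fkM].
  - by move=> _ [x Bx ->]; exists x^-1; [exact: subgrpV|rewrite morphVg].
have fkH k x : H x -> H (iter k f x) by exact: iter_sub.
have A_im k x : H x -> K k -> A (iter j f x * k) by move=> ? ?; exists x, k.
have sA : subgrp A.
  have imH : [set x | exists2 b, H b & x = iter j f b] `<=` H.
    by move=> _ [x Hx ->]; apply: fkH.
  suff -> : A = [set x | exists b k, [/\ [set x | exists2 b, H b & x = iter j f b] b,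
      K k & x = b * k]] by apply: prod_subgrp => //; apply: im_subgrp.
  apply/seteqP; split=> [_ [h [k [Hh Kk ->]]]|_ [_ [k [[h Hh ->] Kk ->]]]].
    by exists (iter j f h), k; split=> //; exists h.
  by exists h, k.
have AH : A `<=` H.
  by move=> _ [h [k [Hh Kk ->]]]; apply: subgrpM => //; [exact: fkH|exact: KH].
have KA : K `<=` A.
  move=> k Kk; have := A_im k 1 (subgrp1 sH) Kk.
  by rewrite (morph1g (fkM j)) mul1g.
have fA_inj x : A x -> K (f x) -> K x.
  move=> [h [k [Hh Kk ->]]]; rewrite fM => Kf.
  apply: subgrpM => //; apply: jP => //; exists j.+1 => /=.
  exact: (subgrp_mulKr sK (fK k Kk)).
have fA x : A x -> A (f x).
  move=> [h [k [Hh Kk ->]]]; rewrite fM -iterS iterSr.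
  by apply: A_im; [exact: fH|exact: fK].
have abA : abelian_mod A K by move=> x y /AH Hx /AH; apply: ab.
have pA : polyc K n A by apply: (polyc_noether sK pH sA).
pose w := iter j f g.
have Aw : A w by have := A_im 1 g Hg (subgrp1 sK); rewrite mulg1.
have Kw k : ~ K (iter k f w) by rewrite /w -iterD.
(* A subgroup of [A] avoiding the orbit of [w] pulls back along [f^j]. *)
suff [L [sL LA [T iL] nL]] : exists L,
    [/\ subgrp L, L `<=` A, index_finite A L & forall k, ~ L (iter k f w)].
  exists T => k; exists (H `&` iter j f @^-1` L); split.
  - exact: subgrp_preim.
  - by move=> x [].
  - apply: (index_preim (fkM j) sH _ iL) => x Hx.
    by have := A_im 1 x Hx (subgrp1 sK); rewrite mulg1.
  by move=> [_ /=]; rewrite -iterD addnC iterD => /nL.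
(* If [w] is torsion modulo [K], the exponent [N] of the torsion of [A / K] serves: when an iterate
   of [w] equals [a^N] modulo [K], then [a] is torsion as well, so [a^N] and the iterate lie in
   [K]. *)
have [[m [m0 Kwm]]|ntw] := pselect (exists m, (0 < m)%N /\ K (w ^+ m)).
  pose t : set E := [set x | A x /\ exists m, (0 < m)%N /\ K (x ^+ m)].
  have st : subgrp t by apply: (torsion_subgrp sA sK KA abA) => //.
  have tA : t `<=` A by move=> x [].
  have pt : polyc K n t.
    apply: (polyc_noether sK pA st) => // k Kk; split; first exact: KA.
    by exists 1%N.
  have [|N [N0 tN]] := torsion_exponent sA sK KA abA sK (fun x => id) tA pt.
    by move=> x [].
  exists (pow_set A K N); split.
  - exact: pow_set_subgrp.
  - exact: pow_set_subH.
  - exact: (pow_set_index _ _ _ _ N0 _ pA).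
  move=> k [a [c [Aa Kc eqw]]]; apply: (Kw k); rewrite eqw.
  apply: subgrpM => //; apply: tN; split=> //.
  have KwN : K (a ^+ N ^+ m).
    have [d Kd] := abelian_mod_pow sA sK KA abA m (subgrpX N sA Aa) (KA _ Kc).
    rewrite -eqw => /esym wE.
    apply: (subgrp_mulKr sK (subgrpX m sK Kc)).
    apply: (subgrp_mulKr sK Kd); rewrite wE.
    by rewrite -(morphXg (fkM k)); apply: iter_sub.
  by exists (N * m)%N; rewrite muln_gt0 N0 m0 expgnA.
(* [X1] is [f(A) K] and, below, [X2] is the product of the cyclic group of [w] with [K]; [N1] and
   [N2] are exponents for the torsion of [A] modulo each of them. *)
pose X1 : set E := [set x | exists a k, [/\ A a, K k & x = f a * k]].
have sX1 : subgrp X1.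
  have imH : [set x | exists2 b, A b & x = iter 1 f b] `<=` H.
    by move=> _ [x Ax ->]; apply/fH/AH.
  suff -> : X1 = [set x | exists b k, [/\ [set x | exists2 b, A b & x = iter 1 f b] b,
      K k & x = b * k]] by apply: prod_subgrp => //; apply: im_subgrp.
  apply/seteqP; split=> [_ [h [k [Hh Kk ->]]]|_ [_ [k [[h Hh ->] Kk ->]]]].
    by exists (f h), k; split=> //; exists h.
  by exists h, k.
have KX1 : K `<=` X1.
  by move=> k Kk; exists 1, k; rewrite morph1g // mul1g; split=> //; apply: subgrp1.
pose W : set E := [set x | exists b z, x = signed_pow w b z].
have sW : subgrp W.
  split; first by exists true, 0%N.
  - by move=> _ _ [b [z ->]] [b' [z' ->]]; apply: signed_powM.
  - by move=> _ [b [z ->]]; exists (~~ b), z; rewrite signed_powV.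
have WA : W `<=` A by move=> _ [b [z ->]]; apply: subgrp_signed_pow.
pose X2 : set E := [set x | exists b k, [/\ W b, K k & x = b * k]].
have sX2 : subgrp X2 by apply: prod_subgrp => // x /WA /AH.
have KX2 : K `<=` X2.
  by move=> k Kk; exists 1, k; rewrite mul1g; split=> //; apply: subgrp1.
have exponent X : subgrp X -> K `<=` X -> exists N, (0 < N)%N /\
    forall x, A x -> (exists m, (0 < m)%N /\ X (x ^+ m)) -> X (x ^+ N).
  move=> sX KX; pose t : set E := [set x | A x /\ exists m, (0 < m)%N /\ X (x ^+ m)].
  have st : subgrp t by apply: (torsion_subgrp sA sK KA abA).
  have tA : t `<=` A by move=> x [].
  have pt : polyc K n t.
    apply: (polyc_noether sK pA st) => // k Kk; split; first exact: KA.
    by exists 1%N; split=> //; apply: KX.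
  have [|N [N0 tN]] := torsion_exponent sA sK KA abA sX KX tA pt.
    by move=> x [].
  by exists N; split=> // x Ax tx; apply: tN.
have [N1 [N1_gt0 N1P]] := exponent X1 sX1 KX1.
have [N2 [N2_gt0 N2P]] := exponent X2 sX2 KX2.
have [p pN p_pr] := prime_above (N1 + N2).
have p0 := prime_gt0 p_pr.
exists (pow_set A K p); split.
- exact: pow_set_subgrp.
- exact: pow_set_subH.
- exact: (pow_set_index _ _ _ _ p0 _ pA).
(* If [w = a^p] modulo [K], then [a^N2] is [w^z] modulo [K] with [z] an integer, so
   [w^N2 = w^(z p)]; as [w] has infinite order modulo [K], this contradicts [p > N2 > 0]. If a later
   iterate is [a^p] modulo [K], then [a] is torsion modulo [f(A) K], and [p] is coprime to [N1], so
   [a = f(b)] modulo [K]. Injectivity of [f] modulo [K] makes the previous iterate equal to [b^p]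
   modulo [K]. *)
elim=> [|k IH] [a [c [Aa Kc eqw]]].
  rewrite /= in eqw; have X2a : X2 (a ^+ N2).
    apply: N2P => //; exists p; split=> //.
    exists w, c^-1; split; last by rewrite eqw mulgK.
    - by exists true, 1%N.
    - exact: subgrpV.
  case: X2a => _ [d [[b [z ->]] Kd aN2]].
  have [e Ke eE] := abelian_mod_pow sA sK KA abA N2 (subgrpX p sA Aa) (KA _ Kc).
  have [e' Ke' eE'] := abelian_mod_pow sA sK KA abA p
    (subgrp_signed_pow b z sA Aw) (KA _ Kd).
  have wN2 : w ^+ N2 = signed_pow w b (z * p) * d ^+ p * e' * c ^+ N2 * e.
    rewrite [in LHS](eqw : w = _) eE -expgnA mulnC expgnA aN2 eE'.
    by rewrite signed_powMn.
  have Kdiff : K ((signed_pow w b (z * p))^-1 * w ^+ N2).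
    rewrite wN2 !mulgA mulVg mul1g.
    by do !apply: subgrpM => //; apply: subgrpX.
  case: b Kdiff {wN2 aN2 eE'} => /= Kdiff; last first.
    apply: ntw; exists (z * p + N2)%N; split; first by rewrite addn_gt0 N2_gt0 orbT.
    by rewrite expgnDr; move: Kdiff; rewrite invgK.
  have [zp|] := leqP (z * p) N2; last first.
    move=> /ltnW zp; have [zN|] := ltnP N2 (z * p); last first.
      move=> pz; have eqz : (z * p = N2)%N by apply/eqP; rewrite eqn_leq zp pz.
      by move: pN; rewrite -eqz; case: (z) eqz N2_gt0 => [<-//|z0] _ _; nia.
    apply: ntw; exists (z * p - N2)%N; split; first by rewrite subn_gt0.
    rewrite expgnFr //; move: Kdiff => /(subgrpV sK); rewrite invgM invgK => Kd'.
    have -> : w ^+ (z * p) / w ^+ N2 = w ^- N2 * w ^+ (z * p).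
      by apply: commute_sym; apply: commute_sym; apply: commuteV; exact: commuteX2 (commute_refl w).
    exact: Kd'.
  have [z0|z0] := posnP z.
    apply: ntw; exists N2; split=> //.
    by move: Kdiff; rewrite z0 mul0n invg1 mul1g.
  by move: pN zp; nia.
have AyF : A (iter k f w) by apply: iter_sub.
have X1a : X1 (a ^+ p).
  exists (iter k f w), c^-1; split=> //; first exact: subgrpV.
  by rewrite -iterS eqw mulgK.
have X1aN : X1 (a ^+ N1) by apply: N1P => //; exists p.
have cop : coprime p N1.
  rewrite prime_coprime //; apply/negP => /dvdn_leq -/(_ N1_gt0).
  by move: pN; lia.
have X1a1 : X1 a.
  have [u [v uv]] : exists u v, (u * p = v * N1 + 1)%N.
    case: (egcdnP N1 p0) => u v uv _; exists u, v.
    by rewrite uv (eqP (cop : gcdn p N1 == 1%N)).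
  have -> : a = (a ^+ N1 ^+ v)^-1 * a ^+ p ^+ u.
    by rewrite -!expgnA [(p * u)%N]mulnC uv [(N1 * v)%N]mulnC expgnDr mulKg.
  apply: subgrpM => //; last exact: subgrpX.
  by apply: subgrpV => //; apply: subgrpX.
case: X1a1 => b [e [Ab Ke aE]].
apply: IH; exists b.
exists ((b ^+ p)^-1 * iter k f w); split=> //; last by rewrite mulVKg.
apply: fA_inj; first by apply: subgrpM => //; apply: subgrpV => //; apply: subgrpX.
rewrite fM morphVg // morphXg // -iterS eqw aE.
have [e' Ke' ->] := abelian_mod_pow sA sK KA abA p (fA b Ab) (KA _ Ke).
rewrite !mulgA mulVg mul1g.
by do !apply: subgrpM => //; apply: subgrpX.
Qed.

End BoundedDetection.

(** * Bounded detection for polycyclic and free factors and for a whole series *)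

Section Series.
Local Open Scope classical_set_scope.
Local Open Scope group_scope.
Context {E : groupType}.
Implicit Types (H K L S X : set E) (T : finType).

Lemma cyc_ext_abelian_mod H1 H c : subgrp H1 -> subgrp H -> cyc_ext H1 H c ->
  abelian_mod H H1.
Proof.
move=> sH1 sH [H1H Hc nH dec].
have cent z : H z -> subgrp [set x | H x /\ H1 [~ x, z]].
  move=> Hz; split.
  - by split; [exact: subgrp1|rewrite comm1g; exact: subgrp1].
  - move=> x y [Hx xz] [Hy yz]; split; first exact: subgrpM.
    have -> : [~ x * y, z] = [~ x, z] ^ y * [~ y, z] by rewrite !commgEl; group_simp.
    by apply: subgrpM => //; apply: nH.
  - move=> x [Hx xz]; split; first exact: subgrpV.
    have -> : [~ x^-1, z] = [~ x, z]^-1 ^ x^-1 by rewrite !commgEl; group_simp.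
    by apply: nH; apply: subgrpV.
have in1 x z : H1 x -> H z -> H1 [~ x, z].
  by move=> Hx Hz; rewrite commgEl; apply: subgrpM => //; [apply: subgrpV|apply: nH].
have all z : H z -> H1 [~ c, z] -> forall x, H x -> H1 [~ x, z].
  move=> Hz cz x /dec [y [b [n [Hy ->]]]].
  have [] // : [set x | H x /\ H1 [~ x, z]] (y * signed_pow c b n).
  apply: (subgrpM (cent z Hz)); first by split; [exact: H1H|exact: in1].
  by apply: (subgrp_signed_pow _ _ (cent z Hz)).
move=> x z Hx Hz; apply: (all z) => //.
rewrite -invgR; apply: subgrpV => //; apply: (all c) => //.
by rewrite commgg; apply: subgrp1.
Qed.

Definition derived H K : set E := [set x | forall X, subgrp X -> K `<=` X ->
  (forall a b, H a -> H b -> X [~ a, b]) -> X x].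

Lemma derived_subgrp H K : subgrp (derived H K).
Proof.
split=> [X sX _ _|x y Dx Dy X sX KX cX|x Dx X sX KX cX]; first exact: subgrp1.
  by apply: subgrpM => //; [apply: Dx|apply: Dy].
by apply: subgrpV => //; apply: Dx.
Qed.

Section PolycyclicFactor.
Variable f : E -> E.
Hypothesis fM : {morph f : x y / x * y}.

Lemma derived_morph H K x : (forall x, H x -> H (f x)) ->
  (forall x, K x -> K (f x)) -> derived H K x -> derived H K (f x).
Proof.
move=> fH fK Dx X sX KX cX; apply: (Dx (f @^-1` X)).
- split=> /=; first by rewrite morph1g //; exact: subgrp1.
    by move=> y z Xy Xz; rewrite fM; apply: subgrpM.
  by move=> y Xy; rewrite morphVg //; apply: subgrpV.
- by move=> k /fK; apply: KX.
move=> a b Ha Hb; rewrite /= commgEl fM morphVg // morphJg // -commgEl.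
by apply: cX; apply: fH.
Qed.

(** [f] preserves [H] and [K] but not the cyclic series between them. The subgroup [D] generated by
    [K] and the commutators of [H] is preserved, and it lies in the last proper term of the series
    because the quotient by that term is cyclic. So [D] has smaller length over [K], and [H / D] is
    abelian. *)
Lemma bounded_polyc n H K : polyc K n H -> subgrp H -> subgrp K ->
  normalized K H -> fin_gen K -> (forall x, H x -> H (f x)) ->
  (forall x, K x -> K (f x)) -> bounded f K [set 1] -> bounded f H [set 1].
Proof.
move=> pH sH sK nK gK fH fK bK.
elim: n H pH sH nK fH => [|n IH] H pH sH nK fH; first by inversion pH; subst.
inversion pH as [|n' H1 H' c pH1 _ ext]; subst.
have sH1 := polyc_subgrp sK pH1; have [H1H _ _ _] := ext.
have KH1 := polyc_sub pH1.
pose D := derived H K.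
have sD : subgrp D by exact: derived_subgrp.
have KD : K `<=` D by move=> x Kx X _ KX _; apply: KX.
have abD : abelian_mod H D by move=> x y Hx Hy X _ _; apply.
have DH1 : D `<=` H1.
  by move=> x; apply=> //; exact: cyc_ext_abelian_mod ext.
have DH : D `<=` H by exact: subset_trans H1H.
have pD : polyc K n D by apply: polyc_noether pH1 sD KD DH1.
have gD : fin_gen D by exact: polyc_fin_gen pD gK.
have nD : normalized D H by exact: (abelian_mod_normalized abD).
have fD x : D x -> D (f x) by exact: derived_morph.
have pDH : polyc D n.+1 H.
  have := polyc_quotient sH sK abD sD KD DH (fun x Hx => Hx) pH.
  suff -> : [set z | exists x s, [/\ D x, H s & z = x * s]] = H by [].
  apply/seteqP; split=> [_ [x [s [Dx Hs ->]]]|x Hx].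
    by apply: subgrpM => //; apply: DH.
  by exists 1, x; rewrite mul1g; split=> //; apply: subgrp1.
apply: (bounded_step fM sH sD DH nD gD fH fD).
- by apply: IH => // x y Kx Dy; apply: nK => //; apply: DH.
- exact: (bounded_abelian fM sH sD DH abD pDH fH fD).
- exact: fin_ext_rf_polyc pDH.
Qed.

End PolycyclicFactor.

Definition free_mod H K := exists n (s : 'I_n -> E),
  [/\ forall i, H (s i),
      forall h, H h -> exists k u, K k /\ h = k * word_prod s u &
      forall u, K (word_prod s u) -> word_eq (fun _ _ => False) u [::]].

Lemma fin_ext_rf_free H K : subgrp H -> subgrp K -> K `<=` H -> free_mod H K ->
  fin_ext_rf H K.
Proof.
move=> sH sK KH [n [s [Hs gH fr]]].
apply: (fin_ext_rf_split (S := [set x | exists u, x = word_prod s u])) => //.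
- split; first by exists [::]; rewrite /word_prod big_nil.
    by move=> _ _ [u ->] [v ->]; exists (u ++ v); rewrite word_prod_cat.
  by move=> _ [u ->]; exists (word_inv u); rewrite word_prod_inv.
- by move=> _ [u ->]; apply: subgrp_word.
- by move=> h /gH [k [u [Kk ->]]]; exists k, (word_prod s u); split=> //; exists u.
by move=> _ [u ->] /fr /(word_eq_prod s) ->; rewrite /word_prod big_nil.
Qed.

(** Modulo [K], elements of [H] are words in the free generators and [f] is the substitution of the
    words [w i]. The subgroup of separating words pulls back to [H], and the same one serves every
    [k]. *)
Lemma bounded_free f H K : {morph f : x y / x * y} -> subgrp H -> subgrp K ->
  K `<=` H -> normalized K H -> free_mod H K ->
  (forall x, H x -> H (f x)) -> (forall x, K x -> K (f x)) -> bounded f H K.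
Proof.
move=> fM sH sK KH nK [n [s [Hs gH fr]]] fH fK g Hg nKg.
have Hw u : H (word_prod s u) by apply: subgrp_word.
have /choice [w wP] : forall i, exists u, K (f (s i) * (word_prod s u)^-1).
  by move=> i; have [k [u [Kk ->]]] := gH _ (fH _ (Hs i)); exists u; rewrite mulgK.
have congM x x' y y' : H x' -> H y -> K (x * x'^-1) -> K (y * y'^-1) ->
    K ((x * y) * (x' * y')^-1).
  move=> Hx Hy Kx Ky.
  have -> : (x * y) * (x' * y')^-1 = (x * x'^-1) * (y * y'^-1) ^ x'^-1 by group_simp.
  by apply: subgrpM => //; apply: nK => //; apply: subgrpV.
have congV x y : H x -> K (x * y^-1) -> K (x^-1 * y^-1^-1).
  move=> Hx Kxy; have -> : x^-1 * y^-1^-1 = (x * y^-1)^-1 ^ x by group_simp.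
  by apply: nK => //; apply: subgrpV.
have sub1 u : K (f (word_prod s u) * (word_prod s (word_subst w u))^-1).
  elim: u => [|a u IH].
    rewrite /word_subst /= /word_prod !big_nil morph1g // invg1 mulg1.
    exact: subgrp1.
  rewrite word_prod_cons /word_subst /= -/(word_subst _ _) fM word_prod_cat.
  apply: (congM) => //; first exact: fH.
  case: a.2 => //; rewrite word_prod_inv (morphVg fM).
  by apply: (congV) => //; apply: fH.
have [k0 [u0 [Kk0 gE]]] := gH g Hg.
have orbit k : K (iter k f g * (word_prod s (iter k (word_subst w) u0))^-1).
  elim: k => [|k IH] /=; first by rewrite gE mulgK.
  set u := iter k (word_subst w) u0 in IH *.
  have -> : f (iter k f g) * (word_prod s (word_subst w u))^-1 =
      f (iter k f g * (word_prod s u)^-1) *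
      (f (word_prod s u) * (word_prod s (word_subst w u))^-1).
    by rewrite fM (morphVg fM); group_simp.
  by apply: subgrpM => //; apply: fK.
have [|L [T [lab [[L1 LM] [LV Leq] lab_ex lab_eq nL]]]] :=
    SeparatingWords.separating_subgroup (w := w) (u0 := u0).
  move=> k /(word_eq_prod s); rewrite [X in _ = X]/word_prod big_nil => triv.
  by apply: (nKg k); have := orbit k; rewrite triv invg1 mulg1.
exists T => k; exists [set x | H x /\ exists u, L u /\ K (x * (word_prod s u)^-1)].
split.
- split.
  + split; first exact: subgrp1.
    exists [::]; split=> //; rewrite /word_prod big_nil mulgV; exact: subgrp1.
  + move=> x y [Hx [u [Lu Kx]]] [Hy [v [Lv Ky]]]; split; first exact: subgrpM.
    exists (u ++ v); split; first exact: LM.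
    by rewrite word_prod_cat; apply: (congM).
  + move=> x [Hx [u [Lu Kx]]]; split; first exact: subgrpV.
    exists (word_inv u); split; first exact: LV.
    by rewrite word_prod_inv; apply: (congV).
- by move=> x [].
- have /choice [d dP] : forall h, exists ua : word 'I_n * T,
      lab ua.1 ua.2 /\ (H h -> K (h * (word_prod s ua.1)^-1)).
    move=> h; have [/gH [c [u [Kc hE]]]|nH] := pselect (H h).
      have [a ua] := lab_ex u; exists (u, a); split=> //= _.
      by rewrite hE mulgK.
    by have [a ua] := lab_ex [::]; exists ([::], a).
  exists (fun h => (d h).2) => x y Hx Hy.
  have [] := dP x; have [] := dP y.
  case: (d x) (d y) => [u a] [v b] /= vb Ky ua Kx ab.
  split; first by apply: subgrpM => //; apply: subgrpV.
  exists (word_inv u ++ v); split; first by apply: lab_eq ua _; rewrite ab.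
  rewrite word_prod_cat word_prod_inv; apply: (congM); last exact: Ky.
  + by apply: subgrpV.
  + exact: Hy.
  + by apply: (congV) => //; apply: Kx.
move=> [_ [v [Lv Kv]]]; apply: (nL k).
apply: (Leq v) => //; apply: word_eq_divl; apply: fr.
rewrite word_prod_cat word_prod_inv.
set p := word_prod s v in Kv *; set q := word_prod s _; set x := iter k f g in Kv.
have Kq : K (x * q^-1) by exact: orbit.
have -> : p^-1 * q = ((x * q^-1)^-1 * (x * p^-1)) ^ q.
  by group_simp.
apply: nK; last exact: Hw.
by apply: subgrpM => //; apply: subgrpV.
Qed.

Definition good_factor H K :=
  index_finite H K \/ free_mod H K \/ exists n, polyc K n H.

Lemma fin_gen1 : fin_gen [set 1 : E].
Proof.
exists void, (of_void E); split=> [[]|h ->].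
by exists [::]; rewrite /word_prod big_nil.
Qed.

Lemma subgrp_set1 : subgrp [set 1 : E].
Proof.
by split=> [//|x y -> ->|x ->] /=; rewrite ?mulg1 ?invg1.
Qed.

Lemma index_finite_fin_gen H K : subgrp H -> K `<=` H -> index_finite H K ->
  subgrp K -> fin_gen K -> fin_gen H.
Proof.
move=> sH KH [T [l lP]] sK gK.
pose r a := xget 1 [set x | H x /\ l x = a].
have rP x : H x -> H (r (l x)) /\ l (r (l x)) = l x.
  by move=> Hx; rewrite /r; case: xgetP => [y _ //|/(_ x) []].
apply: (fin_gen_ext (t := r) gK KH).
  move=> a; rewrite /r; case: xgetP => [y _ [] //|_]; exact: subgrp1.
move=> h Hh; have Hh' := subgrpV sH Hh; have [Hr lr] := rP _ Hh'.
exists ((r (l h^-1))^-1 * h^-1)^-1, [:: (l h^-1, false)]; split.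
  by apply: subgrpV => //; apply: lP.
by rewrite word_prod1 /= invgM !invgK mulgK.
Qed.

Lemma bounded_series f r (Gs : nat -> set E) : {morph f : x y / x * y} ->
  Gs 0%N = [set 1] ->
  (forall i, (i < r)%N -> [/\ subgrp (Gs i.+1), Gs i `<=` Gs i.+1,
     normalized (Gs i) (Gs i.+1) & good_factor (Gs i.+1) (Gs i)]) ->
  (forall i x, (i <= r)%N -> Gs i x -> Gs i (f x)) ->
  [/\ subgrp (Gs r), fin_gen (Gs r) & bounded f (Gs r) [set 1]].
Proof.
move=> fM G0 Gser fG; elim: r Gser fG => [|r IH] Gser fG.
  rewrite G0; split; [exact: subgrp_set1|exact: fin_gen1|].
  by move=> g -> /(_ 0%N) /=; case.
have [||sK gK bK] := IH; first by move=> i ir; apply: Gser; apply: ltnW.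
  by move=> i x ir; apply: fG; apply: leqW.
have [sH KH nK gf] := Gser r (ltnSn r).
have fK x : Gs r x -> Gs r (f x) by apply: fG.
have fH x : Gs r.+1 x -> Gs r.+1 (f x) by apply: fG.
split=> //.
  case: gf => [iK|[[n [s [Hs gH _]]]|[n pH]]].
  - exact: index_finite_fin_gen gK.
  - exact: (fin_gen_ext gK KH Hs gH).
  - exact: polyc_fin_gen pH gK.
case: gf => [iK|[fr|[n pH]]].
- apply: (bounded_step fM sH sK) => //; first exact: bounded_finite.
  exact: fin_ext_rf_finite.
- apply: (bounded_step fM sH sK) => //; first exact: bounded_free.
  exact: fin_ext_rf_free.
- exact: (bounded_polyc fM pH).
Qed.

End Series.

(** * Ascending HNN extensions *)

Section FiniteIndex.
Local Open Scope classical_set_scope.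
Local Open Scope group_scope.
Context {E : groupType}.
Implicit Types (H K L : set E) (T : finType).

Definition set_group (N : set E) (sN : subgrp N) : {pred E} := [pred x | `[< N x >]].

Lemma set_groupE N (sN : subgrp N) x : (x \in set_group sN) = `[< N x >].
Proof. by []. Qed.

Lemma set_groupM N (sN : subgrp N) : mulg_closed (set_group sN).
Proof.
move=> x y; rewrite !set_groupE => /asboolP Nx /asboolP Ny.
by apply/asboolP; apply: subgrpM.
Qed.

Lemma set_group1 N (sN : subgrp N) : 1 \in set_group sN.
Proof. by rewrite set_groupE; apply/asboolP; apply: subgrp1. Qed.

Lemma set_groupV N (sN : subgrp N) : invg_closed (set_group sN).
Proof.
by move=> x; rewrite !set_groupE => /asboolP Nx; apply/asboolP; apply: subgrpV.
Qed.

HB.instance Definition _ N (sN : subgrp N) :=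
  isMulClosed.Build E (set_group sN) (@set_groupM N sN).
HB.instance Definition _ N (sN : subgrp N) :=
  isMul1Closed.Build E (set_group sN) (@set_group1 N sN).
HB.instance Definition _ N (sN : subgrp N) :=
  isInvClosed.Build E (set_group sN) (@set_groupV N sN).

Lemma set_group_normal N (sN : subgrp N) : normalized N [set: E] ->
  is_normal (set_group sN : groupClosed E).
Proof.
by move=> nN x y; rewrite !set_groupE => /asboolP Nx; apply/asboolP; apply: nN.
Qed.

Definition set_normal_subgroup N (sN : subgrp N) (nN : normalized N [set: E]) :
  normal_subgroup E := NormalSubgroup (set_group_normal (sN := sN) nN).

Lemma finite_set_injective (Q : choiceType) (T : finType) (l : Q -> T) :
  injective l -> finite_set [set: Q].
Proof.
move=> l_inj; rewrite -(preimage_setT l).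
by apply: finite_preimage => // x y _ _; apply: l_inj.
Qed.

Lemma index_finite_quotient (N : normal_subgroup E) :
  index_finite [set: E] [set x | x \in nsub N] -> finite_index N.
Proof.
move=> [T [l lP]]; rewrite /finite_index /finite_group.
apply: (finite_set_injective (l := fun q : (E / N)%type => l (repr q))).
move=> q q' /lP-/(_ I I) /= qq'.
by rewrite -[q]reprK -[q']reprK; apply/quotient_eqP.
Qed.

Lemma finite_set_label (Q : choiceType) : finite_set [set: Q] ->
  exists (T : finType) (l : Q -> T), injective l.
Proof.
move=> /finite_seqP [s sE]; exists 'I_(size s).+1, (fun q => inord (index q s)).
have sP q : q \in s by have : [set: Q] q by []; rewrite sE.
move=> q q' /(congr1 val) /=; rewrite !inordK ?ltnS ?index_size // => eqi.
by rewrite -(nth_index q (sP q)) eqi nth_index.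
Qed.

Lemma quotient_index_finite (N : normal_subgroup E) :
  finite_index N -> index_finite [set: E] [set x | x \in nsub N].
Proof.
move=> /finite_set_label [T [l l_inj]].
exists T, (l \o @quotient_pi _ N) => x y _ _ /l_inj.
by move/quotient_eqP.
Qed.

(** The label of [y] records how left multiplication by [y] moves chosen representatives of the left
    cosets of [L]; the normal core is the kernel of this action. No finite generation is
    required. *)
Lemma normal_core_index L : subgrp L -> index_finite [set: E] L ->
  exists N, [/\ subgrp N, normalized N [set: E], N `<=` L & index_finite [set: E] N].
Proof.
move=> sL [T [l lP]]; exists [set y | forall z, L (y ^ z)]; split.
- split=> [z|x y Lx Ly z|x Lx z]; first by rewrite conj1g; apply: subgrp1.
    by rewrite conjMg; apply: subgrpM.
  by rewrite conjVg; apply: subgrpV.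
- by move=> x y Lx _ z; rewrite -conjgM; apply: Lx.
- by move=> x /(_ 1); rewrite conjg1.
pose r a := xget 1 [set x | l x = a].
have rP x : l (r (l x)) = l x by rewrite /r; case: xgetP => [y _ //|/(_ x) []].
exists {ffun T -> T}, (fun y => [ffun a => l (y * r a)]).
move=> y y' _ _ /ffunP eq_lab z.
have Lr : L ((r (l z))^-1 * z) by apply: lP.
have := eq_lab (l z); rewrite !ffunE => /lP-/(_ I I) Lyy.
set h := (r (l z))^-1 * z in Lr.
have -> : (y^-1 * y') ^ z = h^-1 * ((y * r (l z))^-1 * (y' * r (l z))) * h.
  by rewrite /h; group_simp.
by apply: subgrpM => //; apply: subgrpM => //; apply: subgrpV.
Qed.

Lemma rf_of_index (x : E) L : subgrp L -> index_finite [set: E] L -> ~ L x ->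
  exists N : normal_subgroup E, finite_index N /\ x \notin nsub N.
Proof.
move=> sL /(normal_core_index sL) [N [sN nN NL iN]] nLx.
exists (set_normal_subgroup sN nN); split.
  apply: index_finite_quotient; case: iN => T [l lP]; exists T, l => y z _ _ lyz.
  by apply/asboolP; apply: lP.
by apply/negP => /asboolP /NL.
Qed.

(** [f] induces an injective map on the cosets of [L] in [H]. They are finite in number, so the map
    is surjective. *)
Lemma injective_surjective_mod f H L : {morph f : x y / x * y} -> subgrp H ->
  subgrp L -> index_finite H L -> (forall x, H x -> H (f x)) ->
  (forall x, H x -> L x -> L (f x)) ->
  (forall x, H x -> L (f x) -> L x) ->
  forall g, H g -> exists2 g0, H g0 & L ((f g0)^-1 * g).
Proof.
move=> fM sH sL [T iL] fH fL fL_inj g Hg.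
have [l lP] := index_by_exact sH sL iL.
pose A := [set a | `[< exists2 x, H x & l x = a >]]%SET.
pose r a := xget 1 [set x | H x /\ l x = a].
have rP a : a \in A -> H (r a) /\ l (r a) = a.
  rewrite inE => /asboolP[x Hx lx]; rewrite /r.
  by case: xgetP => [y _ //|/(_ x) []].
pose F a := l (f (r a)).
have FA : [set F a | a in A]%SET \subset A.
  apply/fintype.subsetP => _ /imsetP[a /rP[Hr lr] ->]; rewrite inE; apply/asboolP.
  by exists (f (r a)) => //; apply: fH.
have F_inj : {in A &, injective F}.
  move=> a b /rP[Ha la] /rP[Hb lb] /lP; rewrite -(morphVg fM) -fM.
  move=> /(_ (fH _ Ha) (fH _ Hb)) /fL_inj Lab.
  rewrite -[LHS]la -[RHS]lb; apply/lP => //; apply: Lab.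
  by apply: subgrpM => //; apply: subgrpV.
have FE : [set F a | a in A]%SET = A.
  by apply/eqP; rewrite eqEcard FA card_in_imset //=.
have : l g \in A by rewrite inE; apply/asboolP; exists g.
rewrite -{1}FE => /imsetP[a /rP[Ha la] lg].
by exists (r a) => //; apply/lP; [exact: fH| |].
Qed.

End FiniteIndex.

(** * Residual finiteness of a group with the shape of an ascending HNN extension *)

Section InternalHNN.
Local Open Scope classical_set_scope.
Local Open Scope group_scope.
Variables (E : groupType) (G : set E) (t : E) (chi : E -> int).
Hypotheses (sG : subgrp G) (gG : fin_gen G).
Hypothesis Gt : forall x, G x -> G (x ^ t).
Hypothesis decE : forall x, exists i j g, G g /\ x = t ^+ i * g * t ^- j.
Hypothesis chiM : forall x y, chi (x * y) = (chi x + chi y)%R.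
Hypothesis chit : chi t = 1%R.
Hypothesis chiG : forall x, G x -> chi x = 0%R.
Let f (x : E) := x ^ t.
Hypothesis bG : bounded f G [set 1].

Let fM : {morph f : x y / x * y}. Proof. exact: conjg_morph. Qed.

Let iter_f k x : iter k f x = x ^ (t ^+ k).
Proof.
elim: k => [|k IH]; first by rewrite conjg1.
by rewrite iterS IH /f -conjgM -expgSr.
Qed.

Let chi1 : chi 1 = 0%R.
Proof. by apply: chiG; apply: subgrp1. Qed.

Let chiV x : chi x^-1 = (- chi x)%R.
Proof. by apply/eqP; rewrite -addr_eq0 addrC -chiM mulgV chi1. Qed.

Let chiX n : chi (t ^+ n) = Posz n.
Proof.
by elim: n => [|n IH]; rewrite ?chi1 // expgS chiM IH chit intS.
Qed.

Let chi_dec i j g : G g -> chi (t ^+ i * g * t ^- j) = (Posz i - Posz j)%R.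
Proof. by move=> Gg; rewrite !chiM chiV !chiX (chiG Gg) addr0. Qed.

Let detect_chi x : chi x <> 0%R ->
  exists L, [/\ subgrp L, index_finite [set: E] L & ~ L x].
Proof.
move=> cx; pose m := `|chi x|.+1.
have m0 : (0 < Posz m)%R by [].
have m0' : (Posz m != 0)%R by [].
exists [set y | (Posz m %| chi y)%Z]; split.
- split=> /= [|y z my mz|y my]; first by rewrite chi1 dvdz0.
    by rewrite chiM rpredD.
  by rewrite chiV rpredN.
- exists 'I_m.+1, (fun y => inord `|(chi y %% m)%Z|) => y z _ _ /(congr1 (@nat_of_ord _)).
  have lt_m w : (`|(w %% m)%Z| < m.+1)%N.
    have := ltz_pmod w m0; have := modz_ge0 w m0'.
    by case: (w %% m)%Z => // k _; rewrite ltz_nat; apply: ltnW.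
  rewrite !inordK // => eqm; rewrite /= chiM chiV addrC -eqz_mod_dvd.
  have /eqP := congr1 Posz eqm; rewrite !gez0_abs ?modz_ge0 // eq_sym.
  by [].
rewrite /= dvdzE /= => /dvdn_leq; rewrite absz_gt0 => /(_ _).
by move=> H; have := H (introN eqP cx); rewrite ltnn.
Qed.

(** [f] preserves the core but may fail to be injective modulo it; [K] is its closure under
    preimages, and modulo [K] the map is injective, hence bijective. [L] is the subgroup generated
    by [K] and [t]. It meets [G] in [K], since [chi] forces [i = j] in [t^i k t^-j]. *)
Let detect_G g : G g -> g <> 1 ->
  exists L, [/\ subgrp L, index_finite [set: E] L & ~ L g].
Proof.
move=> Gg g1.
have [|T bT] := bG Gg.
  move=> k; rewrite iter_f => /eqP; rewrite conjg_eq1 => /eqP; exact: g1.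
pose K : set E := [set x | G x /\ exists k, core T G (iter k f x)].
have fG k x : G x -> G (iter k f x) by apply: iter_sub.
have fcore k x : core T G x -> core T G (iter k f x).
  by apply: iter_sub => y; apply: core_morph.
have fkM k : {morph iter k f : x y / x * y} by exact: iter_morph.
have sC := core_subgrp T sG.
have sK : subgrp K.
  split.
  - split; [exact: subgrp1|exists 0%N; exact: subgrp1].
  - move=> x y [Gx [k Kx]] [Gy [l Ky]]; split; first exact: subgrpM.
    exists (k + l)%N; rewrite fkM; apply: subgrpM => //.
      by rewrite addnC iterD; apply: fcore.
    by rewrite iterD; apply: fcore.
  - move=> x [Gx [k Kx]]; split; first exact: subgrpV.
    by exists k; rewrite (morphVg (fkM k)); apply: subgrpV.
have KG : K `<=` G by move=> x [].
have iK : index_finite G K.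
  have [T0 [l lP]] := core_index T sG gG; exists T0, l => x y Gx Gy /lP K0.
  by split; [apply: subgrpM => //; apply: subgrpV|exists 0%N; apply: K0].
have fK x : K x -> K (f x).
  move=> [Gx [k Kx]]; split; first exact: Gt.
  by exists k; rewrite -iterSr iterS; apply: (fcore 1%N).
have fK_inj k x : G x -> K (iter k f x) -> K x.
  by move=> Gx [_ [l Kl]]; split=> //; exists (l + k)%N; rewrite iterD.
have fkK k x : K x -> K (iter k f x) by apply: iter_sub.
have nKg : ~ K g.
  move=> [_ [k [_ ck]]]; have [L [sL LG iL nL]] := bT k.
  by apply: nL; apply: ck.
have push k x : x * t ^+ k = t ^+ k * iter k f x by rewrite iter_f -conjgC.
have pushV k x : t ^- k * x = iter k f x * t ^- k.
  by rewrite iter_f; group_simp.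
pose L : set E := [set x | exists i j k, K k /\ x = t ^+ i * k * t ^- j].
have KL : K `<=` L.
  by move=> k Kk; exists 0%N, 0%N, k; rewrite /= invg1 mul1g mulg1.
have sL : subgrp L.
  split; first by apply: KL; apply: subgrp1.
  - move=> _ _ [i [j [k [Kk ->]]]] [i' [j' [k' [Kk' ->]]]].
    have [ji|/ltnW ij] := leqP j i'.
      exists (i + (i' - j))%N, j', (iter (i' - j) f k * k'); split.
        by apply: subgrpM => //; apply: fkK.
      rewrite -[in LHS](subnKC ji) !expgnDr; group_simp.
      by rewrite -(mulgA _ k) push !mulgA.
    exists i, (j' + (j - i'))%N, (k * iter (j - i') f k'); split.
      by apply: subgrpM => //; apply: fkK.
    have -> : t ^- j = t ^- (j - i') * t ^- i' by rewrite -invgM -expgnDr subnKC.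
    rewrite expgnDr invgM; group_simp.
    by rewrite -(mulgA _ (t ^- (j - i'))) pushV !mulgA.
  - move=> _ [i [j [k [Kk ->]]]]; exists j, i, k^-1; split; first exact: subgrpV.
    by group_simp.
exists L; split=> //; last first.
  move=> [i [j [k [Kk gE]]]]; apply: nKg.
  have ij : i = j.
    have := chi_dec i j (KG k Kk); rewrite -gE (chiG Gg) => /esym/eqP.
    by rewrite subr_eq0 => /eqP [].
  apply: (fK_inj i) => //.
  by rewrite iter_f gE ij; have -> : (t ^+ j * k * t ^- j) ^ (t ^+ j) = k by group_simp.
(* Surjectivity of [f^i] modulo [K] moves the middle factor of [t^i h t^-j] to the left of [t^i], so
   [G] meets every left coset of [L] and the index is bounded by that of [K] in [G]. *)
have rep x : exists2 g0, G g0 & L (g0^-1 * x).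
  have [i [j [h [Gh ->]]]] := decE x.
  have [||g0 Gg0 Kg0] := injective_surjective_mod (fkM i) sG sK iK (fG i) _ _ Gh.
  - by move=> y _; apply: fkK.
  - by move=> y; apply: fK_inj.
  exists g0 => //; exists i, j, ((iter i f g0)^-1 * h); split=> //.
  rewrite -[in LHS](mulVKg (iter i f g0) h) iter_f; group_simp.
  by [].
have /choice [d dP] : forall x, exists g0, G g0 /\ L (g0^-1 * x).
  by move=> x; have [g0] := rep x; exists g0.
case: iK => T0 [l lP]; exists T0, (l \o d) => x y _ _ /=.
have [Gx Lx] := dP x; have [Gy Ly] := dP y.
move=> /(lP _ _ Gx Gy) /KL Kxy.
have -> : x^-1 * y = ((d x)^-1 * x)^-1 * (((d x)^-1 * d y) * ((d y)^-1 * y)).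
  by group_simp.
by apply: subgrpM => //; [apply: subgrpV|apply: subgrpM].
Qed.

Lemma internal_hnn_rf : residually_finite E.
Proof.
move=> x x1; suff [L [sL iL nL]] :
    exists L, [/\ subgrp L, index_finite [set: E] L & ~ L x].
  exact: rf_of_index nL.
have [cx|cx] := pselect (chi x = 0%R); last exact: detect_chi.
have [i [j [g [Gg xE]]]] := decE x.
(* With exponent zero, [x] is a conjugate of an element of the base. *)
have ij : i = j.
  by move: cx; rewrite xE chi_dec // => /eqP; rewrite subr_eq0 => /eqP [].
have g1 : g <> 1.
  by move=> g1; move: x1; rewrite xE g1 ij mulg1 mulgV eqxx.
have [L [sL iL nL]] := detect_G Gg g1.
have [N [sN nN NL iN]] := normal_core_index sL iL.
exists N; split=> // Nx; apply/nL/NL.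
have -> : g = x ^ (t ^+ j) by rewrite xE ij; group_simp.
exact: nN.
Qed.

End InternalHNN.

Section Presentations.
Local Open Scope classical_set_scope.
Local Open Scope group_scope.
Context {X : Type} (R : word X -> word X -> Prop).
Local Notation P := (presented R).

Definition word_class (u : word X) : P := (\pi_P u)%qT.

Lemma word_class_eq u v : word_class u = word_class v <-> word_eq R u v.
Proof. exact: presented_eqP. Qed.

Lemma word_class_cat u v : word_class (u ++ v) = word_class u * word_class v.
Proof. exact/esym/presented_mulE. Qed.

Lemma word_class_nil : word_class [::] = 1. Proof. by []. Qed.

Lemma word_class_repr (a : P) : word_class (repr a) = a. Proof. exact: reprK. Qed.

Lemma word_class_gen_inv x : word_class (gen_inv x) = (word_class (gen x))^-1.
Proof.
apply: (@mulgI _ (word_class (gen x))); rewrite -word_class_cat mulgV -word_class_nil.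
by apply/word_class_eq; apply: (word_eq_cancel R x true).
Qed.

Lemma word_class_prod u : word_class u = word_prod (fun x => word_class (gen x)) u.
Proof.
elim: u => [|[x b] u IH]; first by rewrite /word_prod big_nil.
rewrite word_prod_cons -IH -cat1s word_class_cat; congr (_ * _).
by case: b => //=; rewrite word_class_gen_inv.
Qed.

End Presentations.

(** * Normal form, exponent sum and embedded base of the ascending HNN extension *)

Section AscendingHNN.
Local Open Scope classical_set_scope.
Local Open Scope group_scope.
Variables (G : groupType) (phi : {multiplicative G -> G}).
Local Notation Gamma := (ascending_hnn phi).
Local Notation cls := (@word_class _ (hnn_rel phi)).

Definition hnn_base (g : G) : Gamma := cls (gen (Some g)).
Definition hnn_stable : Gamma := cls (gen None).
Local Notation t := hnn_stable.

Lemma hnn_baseM : {morph hnn_base : g h / g * h}.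
Proof.
move=> g h; rewrite /hnn_base -word_class_cat; apply/word_class_eq/word_eq_sym.
exact/word_eq_rel/hnn_rel_mul.
Qed.

Lemma hnn_baseJ g : hnn_base g ^ t = hnn_base (phi g).
Proof.
have -> : hnn_base g ^ t = cls (gen_inv None ++ (gen (Some g) ++ gen None)).
  by rewrite !word_class_cat word_class_gen_inv.
exact/word_class_eq/word_eq_rel/hnn_rel_conj.
Qed.

Lemma hnn_base_iterJ n g : hnn_base g ^ (t ^+ n) = hnn_base (iter n phi g).
Proof.
elim: n => [|n IH]; first by rewrite conjg1.
by rewrite expgSr conjgM IH hnn_baseJ.
Qed.

(** Elements of this form are stable under left multiplication by letters, since
    [g t^i = t^i phi^i(g)] and [t^-1 g = phi(g) t^-1]. *)
Lemma hnn_dec (x : Gamma) : exists i j g, x = t ^+ i * hnn_base g * t ^- j.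
Proof.
rewrite -[x]word_class_repr; elim: (repr x) => [|[[g|] b] u [i [j [h IH]]]].
- by exists 0%N, 0%N, 1; rewrite (morph1g hnn_baseM) mulg1 mulgV.
- rewrite word_class_prod word_prod_cons -word_class_prod IH /= -/(hnn_base g).
  have shift k : hnn_base k * (t ^+ i * hnn_base h * t ^- j) =
      t ^+ i * hnn_base (iter i phi k * h) * t ^- j.
    by rewrite hnn_baseM -hnn_base_iterJ; group_simp.
  case: b; first by exists i, j, (iter i phi g * h).
  by exists i, j, (iter i phi g^-1 * h); rewrite -(morphVg hnn_baseM).
rewrite word_class_prod word_prod_cons -word_class_prod IH /= -/t.
case: b; first by exists i.+1, j, h; rewrite expgS !mulgA.
case: i IH => [|i] IH; last by exists i, j, h; rewrite expgS !mulgA mulVg mul1g.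
exists 0%N, j.+1, (phi h); rewrite expg0 mul1g mul1g -hnn_baseJ expgSr invgM.
by group_simp.
Qed.

Definition letter_exponent (a : option G * bool) : int :=
  if a is (None, b) then (if b then 1 else -1)%R else 0%R.

Definition word_exponent (u : word (option G)) : int :=
  (\sum_(a <- u) letter_exponent a)%R.

Lemma word_exponent_eq u v :
  word_eq (hnn_rel phi) u v -> word_exponent u = word_exponent v.
Proof.
rewrite /word_exponent.
elim=> {u v} [//|u v _ -> //|u v w _ -> _ -> //|u u' v v' _ e1 _ e2|x b|u v [g h|g]].
- by rewrite !big_cat /= e1 e2.
- by rewrite !big_cons !big_nil; case: x b => [g|] [].
- by rewrite /= !big_cons !big_nil.
- by rewrite /= !big_cons !big_nil.
Qed.

Definition hnn_exponent (x : Gamma) : int := word_exponent (repr x).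

Lemma hnn_exponentE u : hnn_exponent (cls u) = word_exponent u.
Proof. by apply: word_exponent_eq; apply/word_class_eq; rewrite word_class_repr. Qed.

Lemma hnn_exponentM x y :
  hnn_exponent (x * y) = (hnn_exponent x + hnn_exponent y)%R.
Proof.
rewrite -[x]word_class_repr -[y]word_class_repr -word_class_cat !hnn_exponentE.
by rewrite /word_exponent big_cat.
Qed.

(* The extension acts on sequences in [G] modulo eventual equality: [g] by
   pointwise multiplication by [phi^n g], the stable letter by shifting. *)
Definition germ_act (a : option G * bool) (x : nat -> G) : nat -> G :=
  match a with
  | (Some g, b) => fun n => iter n phi (if b then g else g^-1) * x n
  | (None, true) => fun n => x n.-1
  | (None, false) => fun n => x n.+1
  end.

Definition germ_eq (x y : nat -> G) := exists m, forall n, (m <= n)%N -> x n = y n.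

Definition word_germ_act (u : word (option G)) (x : nat -> G) := foldr germ_act x u.

Lemma germ_act_eq a x y : germ_eq x y -> germ_eq (germ_act a x) (germ_act a y).
Proof.
move=> [m xy]; exists m.+1 => n mn; case: a => [[g|] []] /=; rewrite xy //; lia.
Qed.

Lemma word_germ_act_eq u x y :
  germ_eq x y -> germ_eq (word_germ_act u x) (word_germ_act u y).
Proof. by move=> xy; elim: u => //= a u; apply: germ_act_eq. Qed.

Lemma germ_eq_trans x y z : germ_eq x y -> germ_eq y z -> germ_eq x z.
Proof.
move=> [m xy] [k yz]; exists (maxn m k) => n; rewrite geq_max => /andP[mn kn].
by rewrite xy // yz.
Qed.

Lemma word_eq_germ_act u v x y : word_eq (hnn_rel phi) u v -> germ_eq x y ->
  germ_eq (word_germ_act u x) (word_germ_act v y).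
Proof.
have phik k : {morph iter k phi : g h / g * h}.
  by apply: iter_morph => g h; rewrite gmulfM.
have refl z : germ_eq z z by exists 0%N.
suff actP : word_eq (hnn_rel phi) u v ->
    forall x, germ_eq (word_germ_act u x) (word_germ_act v x).
  by move=> uv xy; apply: germ_eq_trans (actP uv x) (word_germ_act_eq v xy).
elim=> {u v x y} [//|u v _ IH x|u v w _ IH1 _ IH2 x|u u' v v' _ IH1 _ IH2 x|[g|] b x|u v [g h|g] x].
- by have [m IHm] := IH x; exists m => n /IHm.
- exact: germ_eq_trans (IH1 x) (IH2 x).
- rewrite /word_germ_act !foldr_cat.
  exact: germ_eq_trans (IH1 _) (word_germ_act_eq _ (IH2 x)).
- exists 0%N => n _; case: b => /=; rewrite mulgA -phik ?mulgV ?mulVg;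
    by rewrite (morph1g (phik n)) mul1g.
(* The two shifts are inverse to each other only away from index 0, where [n.-1] is truncated; this
   is why sequences are taken up to eventual equality. *)
- by exists 1%N => -[//|n] _; case: b.
- by exists 0%N => n _ /=; rewrite mulgA -phik.
- by exists 0%N => n _ /=; rewrite -iterSr iterS.
Qed.

(** Acting on the constant sequence 1, equal base elements give [phi^m g = phi^m h] for some [m],
    and [phi] is injective. *)
Lemma hnn_base_inj : injective phi -> injective hnn_base.
Proof.
move=> phi_inj g h /word_class_eq /(@word_eq_germ_act _ _ (fun=> 1) (fun=> 1)).
move=> [|m /(_ m (leqnn m))]; first by exists 0%N.
by rewrite /= !mulg1; elim: m => //= m IH /phi_inj.
Qed.

End AscendingHNN.

(** * Pulling the type of a factor group back to an extension *)

Section Transfer.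
Local Open Scope classical_set_scope.
Local Open Scope group_scope.
Variables (E Q : groupType) (R : E -> Q -> Prop).
Hypotheses (R1 : R 1 1) (RM : forall x q y q', R x q -> R y q' -> R (x * y) (q * q')).
Hypothesis RV : forall x q, R x q -> R x^-1 q^-1.
Hypothesis R_fun : forall x q q', R x q -> R x q' -> q = q'.
Hypothesis R_onto : forall q, exists x, R x q.

(** [R] is the graph of a homomorphism onto [Q] defined only on a subgroup of [E]. The domain is
    [pull setT] and the kernel is [pull [set 1]]; a relation avoids a separate type for the
    domain. *)
Definition pull (S : set Q) : set E := [set x | exists2 q, S q & R x q].

Lemma pull_subgrp S : subgrp S -> subgrp (pull S).
Proof.
move=> sS; split; first by exists 1; [exact: subgrp1|].
- by move=> x y [q Sq xq] [q' Sq' yq']; exists (q * q'); [exact: subgrpM|exact: RM].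
- by move=> x [q Sq xq]; exists q^-1; [exact: subgrpV|exact: RV].
Qed.

Lemma RX x q n : R x q -> R (x ^+ n) (q ^+ n).
Proof. by move=> xq; elim: n => [//|n IH]; rewrite !expgS; apply: RM. Qed.

Lemma pull_index : finite_group Q -> index_finite (pull setT) (pull [set 1]).
Proof.
move=> /finite_set_label [T [l l_inj]].
have /choice [d dP] : forall x, exists q, (exists q, R x q) -> R x q.
  move=> x; have [[q xq]|nq] := pselect (exists q, R x q); first by exists q.
  by exists 1.
exists T, (l \o d) => x y [q _ xq] [q' _ yq'] /l_inj eqd; exists 1 => //.
have xd := dP x (ex_intro _ q xq); have yd := dP y (ex_intro _ q' yq').
by rewrite -(mulVg (d x)); apply: RM; [exact: RV|rewrite eqd].
Qed.

Lemma pull_free : free_of_finite_rank Q -> free_mod (pull setT) (pull [set 1]).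
Proof.
move=> [n [h [k hK kK]]]; exists n.
have kM : {morph k : a b / a * b}.
  by move=> a b; apply: (can_inj hK); rewrite gmulfM !kK.
have /choice [s sP] : forall i, exists x, R x (k (word_class _ (gen i))).
  by move=> i; apply: R_onto.
have wordP u : R (word_prod s u) (k (word_class _ u)).
  elim: u => [|a u IH].
    by rewrite /word_prod big_nil word_class_nil (morph1g kM).
  rewrite word_prod_cons word_class_prod word_prod_cons -word_class_prod kM.
  apply: RM => //; case: a.2 => //; rewrite (morphVg kM); exact: RV.
exists s; split=> [i|x [q _ xq]|u [_ -> u1]].
- by exists (k (word_class _ (gen i))).
- pose u := repr (h q); exists (x * (word_prod s u)^-1), u.
  rewrite mulgVK; split=> //; exists 1 => //; rewrite -(mulgV q).
  apply: RM => //; apply: RV; have := wordP u; rewrite word_class_repr.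
  by rewrite hK.
have := R_fun u1 (wordP u) => /(congr1 h); rewrite kK => h1.
apply/word_class_eq; rewrite -h1.
have hM : {morph h : a b / a * b} by move=> a b; rewrite gmulfM.
by rewrite (morph1g hM).
Qed.

Lemma pull_polyc : polycyclic Q -> exists n, polyc (pull [set 1]) n (pull setT).
Proof.
move=> [r [Qs [[Q0 Qr Qn] Qcyc]]]; exists r.
have sQ j : subgrp [set q | q \in Qs j].
  split=> /= [|x y|x]; [exact: gpred1|exact: gpredM|exact: gpredVr].
have <- : pull [set q | q \in Qs r] = pull setT.
  by congr pull; apply/seteqP; split=> // q _ /=; rewrite Qr.
suff : forall j, (j <= r)%N -> polyc (pull [set 1]) j (pull [set q | q \in Qs j]).
  by apply.
elim=> [_|j IH jr].
  suff -> : [set q | q \in Qs 0%N] = [set 1] by exact: polyc0.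
  by apply/seteqP; split=> q /=; rewrite Q0 inE => /eqP.
have nQ := Qn j jr; have [sub nrm] := nQ.
have [c cP] := Qcyc j nQ jr.
pose c0 := val (repr c).
have c0P : c0 \in Qs j.+1 by exact: valP.
have cyc q : q \in Qs j.+1 -> exists n, q^-1 * c0 ^+ n \in Qs j \/ q^-1 * c0 ^- n \in Qs j.
  move=> qP; pose q' : subgroup_type (Qs j.+1) := exist _ q qP.
  have [n qn] := cP (quotient_pi (NormalSubgroup (restrict_normal nQ)) q').
  rewrite -[c]reprK -[(\pi _)%qT]/(quotient_pi (NormalSubgroup (restrict_normal nQ)) (repr c)) in qn.
  exists n; case: qn => qn; [left|right]; move: qn.
    rewrite -gmulfXn => /quotient_eqP /=.
    by rewrite inE gmulfM gmulfV gmulfXn.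
  rewrite -gmulfXVn => /quotient_eqP /=.
  by rewrite inE gmulfM gmulfV gmulfXVn.
have [x0 x0P] := R_onto c0.
apply: (polycS (IH (ltnW jr)) (pull_subgrp (sQ j.+1)) (c := x0)); split.
- by move=> x [q Sq xq]; exists q => //; apply: sub.
- by exists c0.
- move=> x y [q Sq xq] [q' Sq' yq']; exists (q ^ q'); first exact: nrm.
  by apply: RM; [exact: RV|exact: RM].
move=> x [q Sq xq]; have [n [qn|qn]] := cyc q Sq.
  exists (x * (x0 ^+ n)^-1), true, n; rewrite mulgVK; split=> //.
  exists (q * (c0 ^+ n)^-1); last by apply: RM => //; apply: RV; apply: RX.
  have -> : q * (c0 ^+ n)^-1 = (q^-1 * c0 ^+ n)^-1 ^ (q^-1) by group_simp.
  by apply: nrm; rewrite gpredV.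
exists (x * x0 ^+ n), false, n; rewrite mulgK; split=> //.
exists (q * c0 ^+ n); last by apply: RM => //; apply: RX.
have -> : q * c0 ^+ n = (q^-1 * c0 ^- n)^-1 ^ (q^-1) by group_simp.
by apply: nrm; rewrite gpredV.
Qed.

End Transfer.

(** * Extensions of the ascending HNN extension by a finite kernel *)

Section FiniteExtensions.
Local Open Scope classical_set_scope.
Local Open Scope group_scope.
Variables (G : groupType) (r : nat) (Gs : nat -> groupClosed G).
Hypothesis Gs_series : subnormal_series r Gs.
Hypothesis Gs_factors : series_factors
  (fun Q => finite_group Q \/ free_of_finite_rank Q \/ polycyclic Q) r Gs.
Variable phi : {multiplicative G -> G}.
Hypothesis phi_inj : injective phi.
Hypothesis phi_Gs : forall i : nat, (1 <= i <= r)%N ->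
  forall x : G, x \in Gs i -> phi x \in Gs i.

Variables (E : groupType) (p : {multiplicative E -> ascending_hnn phi}).
Hypothesis p_onto : forall y, exists x, p x = y.
Hypothesis p_fin : finite_set [set x | p x = 1].

Local Notation base := (hnn_base phi).
Let base_inj : injective base. Proof. exact: hnn_base_inj. Qed.
Let baseM : {morph base : g h / g * h}. Proof. exact: hnn_baseM. Qed.
Let pM : {morph p : x y / x * y}. Proof. by move=> x y; rewrite gmulfM. Qed.

Let lift (i : nat) : set E := [set x | exists2 g, g \in Gs i & p x = base g].

Let lift_subgrp i : subgrp (lift i).
Proof.
split.
- by exists 1; [exact: gpred1|rewrite (morph1g pM) (morph1g baseM)].
- move=> x y [g Gg xg] [h Gh yh]; exists (g * h); first exact: gpredM.
  by rewrite pM baseM xg yh.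
- move=> x [g Gg xg]; exists g^-1; first by rewrite gpredV.
  by rewrite (morphVg pM) (morphVg baseM) xg.
Qed.

Let lift0 : lift 0 = [set x | p x = 1].
Proof.
case: Gs_series => G0 _ _; apply/seteqP; split=> x /=.
  by move=> [g]; rewrite G0 inE => /eqP -> ->; rewrite (morph1g baseM).
move=> px; exists 1; first exact: gpred1.
by rewrite px (morph1g baseM).
Qed.

Let lift_factor i : (i < r)%N -> good_factor (lift i.+1) (lift i).
Proof.
case: Gs_series => _ _ nGs ir; have nG := nGs i ir; have [sub nrm] := nG.
pose N := NormalSubgroup (restrict_normal nG).
pose R (x : E) (q : factor_group nG) := exists g : subgroup_type (Gs i.+1),
  p x = base (val g) /\ q = quotient_pi N g.
have R1 : R 1 1.
  by exists 1; rewrite (morph1g pM) gmulf1 (morph1g baseM) gmulf1.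
have RM x q y q' : R x q -> R y q' -> R (x * y) (q * q').
  move=> [g [xg ->]] [h [yh ->]]; exists (g * h); split; last by rewrite gmulfM.
  by rewrite pM xg yh gmulfM baseM.
have RV x q : R x q -> R x^-1 q^-1.
  move=> [g [xg ->]]; exists g^-1; split; last by rewrite gmulfV.
  by rewrite (morphVg pM) xg gmulfV (morphVg baseM).
have R_fun x q q' : R x q -> R x q' -> q = q'.
  move=> [g [xg ->]] [h [xh ->]]; congr quotient_pi.
  by apply/val_inj/base_inj; rewrite -xg.
have R_onto q : exists x, R x q.
  have [x xq] := p_onto (base (val (repr q))).
  exists x, (repr q); split=> //.
  by rewrite -[LHS]reprK.
have liftT : lift i.+1 = pull R setT.
  apply/seteqP; split=> [x [g Gg xg]|x [q _ [g [xg _]]]].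
    by exists (quotient_pi N (exist _ g Gg)) => //; exists (exist _ g Gg).
  by exists (val g) => //; exact: valP.
have lift1 : lift i = pull R [set 1].
  apply/seteqP; split=> [x [g Gg xg]|x [q -> [g [xg g1]]]].
    pose g' : subgroup_type (Gs i.+1) := exist _ g (sub g Gg).
    exists 1 => //; exists g'; split=> //.
    apply/esym/quotient_eqP; rewrite /= mulg1 gpredV /=.
    by rewrite inE.
  exists (val g) => //; move/esym/quotient_eqP: g1; rewrite /= mulg1 gpredV /=.
  by rewrite inE.
rewrite liftT lift1; have [Qf|[Qf|Qp]] := Gs_factors nG ir.
- by left; apply: pull_index.
- by right; left; apply: pull_free.
- by right; right; apply: pull_polyc.
Qed.

Lemma hnn_finite_extension_rf : residually_finite E.
Proof.
have [t tE] := p_onto (hnn_stable phi).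
have [G0 Gr nGs] := Gs_series.
(* The index is shifted by one: the bottom factor is [lift 0], the kernel of [p]. Conjugation by a
   lift [t] of the stable letter plays the role of [phi]. *)
pose Hs i := if i is j.+1 then lift j else [set 1 : E].
have Hs_morph i x : (i <= r.+1)%N -> Hs i x -> Hs i (x ^ t).
  case: i => [_ ->|i ir [g Gg xg]]; first by rewrite conj1g.
  exists (phi g); last by rewrite (morphJg pM) xg tE hnn_baseJ.
  (* The invariance hypothesis starts at index 1; at index 0 the term of the series is trivial. *)
  case: i ir Gg => [|i] ir Gg; last by apply: phi_Gs.
  have phiM : {morph phi : g h / g * h} by move=> a b; rewrite gmulfM.
  by move: Gg; rewrite !G0 !inE => /eqP ->; rewrite (morph1g phiM).
have Hs_series i : (i < r.+1)%N -> [/\ subgrp (Hs i.+1), Hs i `<=` Hs i.+1,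
    normalized (Hs i) (Hs i.+1) & good_factor (Hs i.+1) (Hs i)].
  case: i => [_|i ir]; split.
  - exact: lift_subgrp.
  - by move=> x ->; apply: (subgrp1 (lift_subgrp 0)).
  - by move=> x y -> _ /=; rewrite conj1g.
  - left; rewrite /= lift0; have /finite_seqP [s sE] := p_fin.
    exists 'I_(size s).+1, (fun x => inord (index x s)) => x y.
    rewrite sE /= => xs ys /(congr1 (@nat_of_ord _)).
    rewrite !inordK ?ltnS ?index_size // => eqi.
    by rewrite -(nth_index x xs) eqi nth_index // mulVg.
  - exact: lift_subgrp.
  - by move=> x [g Gg xg]; exists g => //; case: (nGs i ir) => sub _; apply: sub.
  - move=> x y [g Gg xg] [h Gh yh]; exists (g ^ h).
      by case: (nGs i ir) => _; apply.
    by rewrite (morphJg pM) xg yh (morphJg baseM).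
  - exact: lift_factor.
have [sG gG bG] := bounded_series (conjg_morph t) (erefl : Hs 0%N = _) Hs_series Hs_morph.
apply: (internal_hnn_rf (t := t) (chi := @hnn_exponent _ phi \o p) sG gG).
- by move=> x; apply: Hs_morph.
- move=> x; have [i [j [g xE]]] := hnn_dec (p x).
  exists i, j, (t ^- i * x * t ^+ j); split; last by group_simp.
  exists g; first by rewrite Gr.
  by rewrite !pM (morphVg pM) !(morphXg pM) tE xE; group_simp.
- by move=> x y; rewrite /= pM hnn_exponentM.
- by rewrite /= tE hnn_exponentE /word_exponent big_seq1.
- by move=> x [g _ xg]; rewrite /= xg hnn_exponentE /word_exponent big_seq1.
- exact: bG.
Qed.

End FiniteExtensions.

(** * Periodic cochains *)

(** These tactics lead to [zmod_eq], which proves an identity in an abelian group by collecting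
    everything on one side and cancelling each summand against its opposite. *)
Ltac zmod_pull u :=
  lazymatch goal with
  | |- (_ + (?v + _))%R = _ =>
    tryif unify v u then idtac else (rewrite (addrCA _ u); zmod_pull u)
  end.
Ltac zmod_cancel :=
  lazymatch goal with
  | |- (0 + _)%R = _ => rewrite add0r; zmod_cancel
  | |- (- ?t + _)%R = _ => zmod_pull t; rewrite addKr; zmod_cancel
  | |- (?t + _)%R = _ => zmod_pull (- t)%R; rewrite addNKr; zmod_cancel
  | |- _ => reflexivity
  end.
Ltac zmod_eq :=
  apply/eqP; rewrite -GRing.subr_eq0; apply/eqP; rewrite -[LHS]addr0;
  rewrite ?(opprD, opprK, oppr0) -?addrA; zmod_cancel.

Section ModuleAction.
Local Open Scope ring_scope.
Context {G : groupType} {A : zmodType}.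
Variable act : module_action G A.

Lemma mact0 x : act x 0 = 0.
Proof. by apply: (addrI (act x 0)); rewrite -mactD !addr0. Qed.

Lemma mactN x a : act x (- a) = - act x a.
Proof. by apply: (addrI (act x a)); rewrite -mactD !subrr mact0. Qed.

Lemma mactB x a b : act x (a - b) = act x a - act x b.
Proof. by rewrite mactD mactN. Qed.

Lemma mactK x : cancel (act x) (act x^-1%g).
Proof. by move=> a; rewrite -mactM mulVg mact1. Qed.

Lemma mactVK x : cancel (act x^-1%g) (act x).
Proof. by move=> a; rewrite -mactM mulgV mact1. Qed.

Definition diff1 (b : G -> A) x y := act x (b y) - b (x * y)%g + b x.

Definition diff2 (z : G -> G -> A) x y t :=
  act x (z y t) - z (x * y)%g t + z x (y * t)%g - z x y.

Definition diff3 (w : G -> G -> G -> A) x y t v :=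
  act x (w y t v) - w (x * y)%g t v + w x (y * t)%g v - w x y (t * v)%g
  + w x y t.

Lemma diff21 b x y t : diff2 (diff1 b) x y t = 0.
Proof.
rewrite /diff2 /diff1 !mactD !mactN -mactM !mulgA.
zmod_eq.
Qed.

Lemma diff32 z x y t v : diff3 (diff2 z) x y t v = 0.
Proof.
rewrite /diff3 /diff2 !(mactD, mactN) -mactM !mulgA.
zmod_eq.
Qed.

End ModuleAction.

Section Periodic.
Local Open Scope classical_set_scope.
Local Open Scope group_scope.
Context {G : groupType}.
Implicit Types N M : set G.

Record fin_index N : Prop := FinIndex {
  fin_index_subgrp : subgrp N;
  fin_index_normal : normalized N [set: G];
  fin_index_index : index_finite [set: G] N }.

Lemma fin_indexT : fin_index [set: G].
Proof.
split; first by split.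
  by [].
by exists unit, (fun=> tt).
Qed.

Lemma fin_indexI N M : fin_index N -> fin_index M -> fin_index (N `&` M).
Proof.
move=> [sN nN [T [l lP]]] [sM nM [U [k kP]]]; split.
- exact: subgrpI.
- by move=> x y [Nx Mx] _; split; [apply: nN|apply: nM].
- exists (T * U)%type, (fun x => (l x, k x)) => x y _ _ [xy xy'].
  by split; [apply: lP|apply: kP].
Qed.

Lemma fin_index_core L : subgrp L -> index_finite [set: G] L ->
  exists2 N, fin_index N & N `<=` L.
Proof.
by move=> sL iL; have [N [sN nN NL iN]] := normal_core_index sL iL; exists N.
Qed.

Lemma fin_index_refl N x : fin_index N -> N (x^-1 * x).
Proof. by move=> [sN _ _]; rewrite mulVg; apply: (subgrp1 sN). Qed.

Lemma fin_index_sym N x y : fin_index N -> N (x^-1 * y) -> N (y^-1 * x).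
Proof. by move=> [sN _ _]; apply: subgrp_swap. Qed.

Lemma fin_index_trans N y x z : fin_index N -> N (x^-1 * y) -> N (y^-1 * z) -> N (x^-1 * z).
Proof.
by move=> [sN _ _] xy yz; have := subgrpM sN xy yz; rewrite mulgA mulgK.
Qed.

Lemma fin_index_mul N x x' y y' : fin_index N -> N (x^-1 * x') ->
  N (y^-1 * y') -> N ((x * y)^-1 * (x' * y')).
Proof.
move=> [sN nN _] xx yy.
have -> : (x * y)^-1 * (x' * y') = (x^-1 * x') ^ y * (y^-1 * y').
  by rewrite /conjg invgM !mulgA mulgK.
by apply: (subgrpM sN) => //; apply: nN.
Qed.

Lemma fin_index_inv N x y : fin_index N -> N (x^-1 * y) -> N (x^-1^-1 * y^-1).
Proof.
move=> fN xy; have [sN nN _] := fN.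
have -> : x^-1^-1 * y^-1 = (y^-1 * x) ^ x^-1 by group_simp.
by apply: nN => //; apply: fin_index_sym.
Qed.

(* The labels are made surjective so that they carry an action of [G]. *)
Lemma fin_index_coset N : fin_index N ->
  exists (Q : finType) (lab : G -> Q) (rep : Q -> G),
    cancel rep lab /\ forall x y, lab x = lab y <-> N (x^-1 * y).
Proof.
move=> [sN nN [T iT]].
have sT : subgrp [set: G] by [].
have [l lP] := index_by_exact sT sN iT.
pose Q := {t : option T | `[< exists x, l x = t >]}.
have labP x : `[< exists y, l y = l x >] by apply/asboolP; exists x.
pose lab x : Q := exist _ (l x) (labP x).
have labE x : val (lab x) = l x by [].
have repP (q : Q) : {x | l x = val q}.
  by apply: cid; apply/asboolP; apply: (valP q).
exists Q, lab, (fun q => sval (repP q)); split.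
  by move=> q; apply: val_inj; rewrite labE; case: repP.
move=> x y; rewrite -lP // -!labE; split=> [->//|]; exact: val_inj.
Qed.

Variable A : Type.

Definition periodic1 N (b : G -> A) := forall x x', N (x^-1 * x') -> b x = b x'.

Definition periodic2 N (z : G -> G -> A) := forall x x' y y',
  N (x^-1 * x') -> N (y^-1 * y') -> z x y = z x' y'.

Definition periodic3 N (w : G -> G -> G -> A) := forall x x' y y' t t',
  N (x^-1 * x') -> N (y^-1 * y') -> N (t^-1 * t') -> w x y t = w x' y' t'.

End Periodic.

Lemma action_kernel_fin_index (G : groupType) (A : finZmodType)
    (act : module_action G A) :
  fin_index [set x | forall a, act x a = a]%classic.
Proof.
split; first split.
- by move=> a; rewrite mact1.
- by move=> x y xa ya a; rewrite mactM ya xa.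
- by move=> x xa a; rewrite -{1}[a]xa mactK.
- by move=> x y xa _ a; rewrite /conjg !mactM xa mactK.
- exists {ffun A -> A}, (fun x => [ffun a => act x a]) => x y _ _ /ffunP xy a /=.
  by move: (xy a); rewrite !ffunE mactM => <-; rewrite mactK.
Qed.

Definition finite_type (A : Type) := exists (T : finType) (l : A -> T), injective l.

Lemma finite_type_ffun (Q : finType) A : finite_type A -> finite_type {ffun Q -> A}.
Proof.
move=> [T [l l_inj]]; exists {ffun Q -> T}, (fun f => [ffun q => l (f q)]).
by move=> f g /ffunP fg; apply/ffunP => q; apply: l_inj; have := fg q; rewrite !ffunE.
Qed.

Section Degree1.
Local Open Scope classical_set_scope.
Local Open Scope ring_scope.
Context {G : groupType} {A : zmodType}.
Variable act : module_action G A.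
Hypothesis A_fin : finite_type A.

Variable B : set A.
Hypothesis B0 : B 0.
Hypothesis BB : forall a b, B a -> B b -> B (a - b).
Hypothesis Bact : forall x a, B a -> B (act x a).

(** The hypothesis says that [b(x m) - b(x)] equals [x (b(m) - b(1))] modulo [B] for [m] in [N]. So
    the [m] in [N] with [b(m) = b(1)] modulo [B] form a subgroup of right periods, and its index is
    finite because [b] has finitely many values. Submodules [B] other than 0 are needed in degree
    3. *)
Lemma diff1_periodic_mod N b : fin_index N ->
  (forall x m, N m -> B (diff1 act b x m - diff1 act b x 1%g)) ->
  exists2 M, fin_index M & forall x y, M (x^-1 * y)%g -> B (b x - b y).
Proof.
move=> fN db; have [sN nN iN] := fN.
have BN a : B a -> B (- a) by move=> Ba; rewrite -sub0r; apply: BB.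
have BD a c : B a -> B c -> B (a + c) by move=> Ba Bc; rewrite -[c]opprK; apply/BB/BN.
have key x m : N m -> B (act x (b m - b 1%g) - (b (x * m)%g - b x)).
  move=> Nm; have := db x m Nm; congr B; rewrite /diff1 mactB mulg1.
  zmod_eq.
pose N' := [set m | N m /\ B (b m - b 1%g)].
have perN' x m : N' m -> B (b (x * m)%g - b x).
  move=> [Nm Bm]; have := BB (Bact x Bm) (key x m Nm); congr B; zmod_eq.
have N'P x m : N m -> B (b (x * m)%g - b x) -> N' m.
  move=> Nm Bm; split=> //; have := Bact x^-1%g (BD _ _ (key x m Nm) Bm).
  by rewrite subrK mactK.
have sN' : subgrp N'.
  split.
  - by split; [apply: (subgrp1 sN)|rewrite subrr].
  - move=> x y Nx Ny; apply: (N'P 1%g); first by apply: (subgrpM sN) Nx.1 Ny.1.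
    rewrite mul1g; have := BD _ _ (perN' x y Ny) Nx.2; congr B; zmod_eq.
  - move=> x Nx; apply: (N'P x); first by apply: (subgrpV sN) Nx.1.
    by rewrite mulgV -opprB; apply: BN Nx.2.
have [T [l l_inj]] := A_fin.
have iN' : index_finite [set: G] N'.
  apply: (index_trans (K := N)) => //.
  exists T, (l \o b) => x y Nx Ny /l_inj bxy.
  have Nxy : N (x^-1 * y)%g by apply: (subgrpM sN) => //; apply: (subgrpV sN).
  by apply: (N'P x) => //; rewrite mulVKg bxy subrr.
have [M fM MN'] := fin_index_core sN' iN'.
exists M => // x y /MN' /(perN' x); rewrite mulVKg => Bxy.
by rewrite -opprB; apply: BN.
Qed.

End Degree1.

Lemma diff1_periodic (G : groupType) (A : zmodType) (act : module_action G A)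
    (N : set G) b : finite_type A -> fin_index N ->
  (forall x m, N m -> diff1 act b x m = diff1 act b x 1%g) ->
  exists2 M, fin_index M & periodic1 M b.
Proof.
move=> A_fin fN db.
have [|||x m Nm|M fM Mb] := @diff1_periodic_mod G A act A_fin [set 0%R]%classic _ _ _ N b fN.
- by [].
- by move=> a c -> ->; rewrite /= subrr.
- by move=> x a ->; rewrite /= mact0.
- by rewrite /= db ?subrr.
by exists M => // x y /Mb /= /eqP; rewrite subr_eq0 => /eqP.
Qed.

(** * Coinduced modules, and the group extension of a 2-cocycle *)

Section Coinduced.
Local Open Scope ring_scope.
Context {G : groupType} {A : zmodType}.
Variables (act : module_action G A) (Q : finType) (s : G -> Q -> Q).
Hypothesis s1 : forall q, s 1%g q = q.
Hypothesis sM : forall x y q, s (x * y)%g q = s y (s x q).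

(** With [s x q] standing for [x^-1 q], this is the usual action [(x f)(q) = x (f (x^-1 q))] on
    functions. *)
Definition coinduced_fun x (f : {ffun Q -> A}) : {ffun Q -> A} :=
  [ffun q => act x (f (s x q))].

Lemma coinduced1 f : coinduced_fun 1%g f = f.
Proof. by apply/ffunP => q; rewrite !ffunE s1 mact1. Qed.

Lemma coinducedM x y f :
  coinduced_fun (x * y)%g f = coinduced_fun x (coinduced_fun y f).
Proof. by apply/ffunP => q; rewrite !ffunE sM mactM. Qed.

Lemma coinducedD x f g :
  coinduced_fun x (f + g) = coinduced_fun x f + coinduced_fun x g.
Proof. by apply/ffunP => q; rewrite !ffunE mactD. Qed.

Definition coinduced : module_action G {ffun Q -> A} :=
  ModuleAction coinduced1 coinducedM coinducedD.

End Coinduced.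

Section TwistedProduct.
Context {G : groupType} {A : zmodType}.
Variables (act : module_action G A) (z : G -> G -> A).
Local Open Scope ring_scope.

(** The extension of [G] by [A] with factor set [z]. The cocycle condition is a parameter of the
    type so that the group structure can be attached to it. As [z] is not normalized, the identity
    is [(- z 1 1, 1)]. *)
Definition twisted (dz : forall x y t, diff2 act z x y t = 0) : Type := (A * G)%type.

Hypothesis dz : forall x y t, diff2 act z x y t = 0.
Local Notation E := (twisted dz).
HB.instance Definition _ := Choice.on E.

Lemma cocycle_1l x : z 1%g x = z 1%g 1%g.
Proof.
have /eqP := dz 1%g 1%g x; rewrite /diff2 mact1 !mul1g subrr add0r subr_eq0.
by move/eqP.
Qed.

Lemma cocycle_1r x : z x 1%g = act x (z 1%g 1%g).
Proof.
have /eqP := dz x 1%g 1%g; rewrite /diff2 !mulg1 subrK subr_eq0.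
by move/eqP.
Qed.

Definition twisted_one : E := (- z 1%g 1%g, 1%g).
Definition twisted_mul (u v : E) : E :=
  (u.1 + act u.2 v.1 + z u.2 v.2, (u.2 * v.2)%g).
Definition twisted_inv (u : E) : E :=
  (- z 1%g 1%g - act u.2^-1%g u.1 - z u.2^-1%g u.2, u.2^-1%g).

Let mulA : associative twisted_mul.
Proof.
move=> [a x] [b y] [c t]; rewrite /twisted_mul /= mulgA; congr (_, _).
rewrite !mactD -mactM; have := dz x y t; rewrite /diff2 => /eqP.
rewrite subr_eq0 => /eqP <-; zmod_eq.
Qed.
Let mul1 : left_id twisted_one twisted_mul.
Proof.
by move=> [a x]; rewrite /twisted_mul /= mul1g mact1 cocycle_1l addrAC addNr add0r.
Qed.
Let mulr1 : right_id twisted_one twisted_mul.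
Proof.
by move=> [a x]; rewrite /twisted_mul /= mulg1 mactN (cocycle_1r x) subrK.
Qed.
Let mulV : left_inverse twisted_one twisted_inv twisted_mul.
Proof.
by move=> [a x]; rewrite /twisted_mul /twisted_inv /= mulVg; congr (_, _); zmod_eq.
Qed.
Let mulrV : right_inverse twisted_one twisted_inv twisted_mul.
Proof.
move=> [a x]; rewrite /twisted_mul /twisted_inv /= mulgV; congr (_, _).
rewrite !(mactD, mactN) mactVK.
have := dz x x^-1%g x; rewrite /diff2 mulgV mulVg (cocycle_1l x) (cocycle_1r x) => /eqP.
rewrite subr_eq0 => /eqP <-; zmod_eq.
Qed.

HB.instance Definition _ := isGroup.Build E mulA mul1 mulr1 mulV mulrV.

Lemma twisted_mulE (u v : E) :
  (u * v)%g = (u.1 + act u.2 v.1 + z u.2 v.2, (u.2 * v.2)%g) :> E.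
Proof. by []. Qed.

Definition twisted_proj (u : E) : G := u.2.

Lemma twisted_projM : {morph twisted_proj : u v / (u * v)%g}.
Proof. by []. Qed.
HB.instance Definition _ := isMultiplicative.Build E G twisted_proj twisted_projM.

End TwistedProduct.

Local Open Scope group_scope.

Lemma rf_avoid_finite (E : groupType) (F : set E) : residually_finite E ->
  finite_set F -> exists2 M, fin_index M & forall x, F x -> M x -> x = 1.
Proof.
move=> rE /finite_seqP [s ->]; elim: s => [|x s [M fM MP]].
  by exists setT; first exact: fin_indexT.
have [->|x1] := eqVneq x 1.
  by exists M => // y /=; rewrite inE => /predU1P[->|/MP].
have [N [iN xN]] := rE x x1.
have fN : fin_index [set y | y \in nsub N]%classic.
  split; last exact/quotient_index_finite.
    split=> [|y t|y] /=; [exact: gpred1|exact: gpredM|exact: gpredVr].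
  by move=> y t Ny _; apply: nsub_normal.
exists ([set y | y \in nsub N] `&` M)%classic; first exact: fin_indexI.
move=> y /=; rewrite inE => /predU1P[-> [xN' _]|ys [_ My]]; last exact: MP.
by rewrite xN' in xN.
Qed.

(** * Making cochains periodic in degrees 2 and 3 *)

Section Degree2.
Local Open Scope classical_set_scope.
Context {G : groupType}.
Hypothesis G_ext : forall (E : groupType) (p : {multiplicative E -> G}),
  (forall y, exists x, p x = y) -> finite_set [set x | p x = 1] ->
  residually_finite E.

Lemma cocycle2_periodic (A : zmodType) (act : module_action G A) z :
  finite_type A -> (forall x y t, diff2 act z x y t = 0%R) ->
  exists b N, fin_index N /\ periodic2 N (fun x y => z x y + diff1 act b x y)%R.
Proof.
move=> [T [l l_inj]] dz; pose E := twisted dz : groupType.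
pose p : {multiplicative E -> G} := @twisted_proj _ _ _ _ dz.
have kfin : finite_set [set x : E | p x = 1].
  apply: (sub_finite_set (B := (fun a => (a, 1) : E) @` setT)).
    by move=> [a x] /= px; exists a => //; rewrite -px.
  exact/finite_image/(finite_set_injective l_inj).
have rE : residually_finite E.
  by apply: (G_ext (p := p)) => // y; exists (0%R, y).
have [M fM Mker] := rf_avoid_finite rE kfin; have [sM nM [U [k kP]]] := fM.
pose N := [set x | exists2 m, M m & p m = x].
have fN : fin_index N.
  split; first split.
  - by exists 1; first exact: (subgrp1 sM).
  - by move=> _ _ [m Mm <-] [n Mn <-]; exists (m * n); [apply: (subgrpM sM)|].
  - by move=> _ [m Mm <-]; exists m^-1; [apply: (subgrpV sM)|].
  - by move=> _ y [m Mm <-] _; exists (m ^ ((0%R, y) : E)); [apply: nM|].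
  - exists U, (fun x => k ((0%R, x) : E)) => x y _ _ /kP kxy.
    by exists (((0%R, x) : E)^-1 * ((0%R, y) : E)) => //; apply: kxy.
have [Q [lab [rep [repK labP]]]] := fin_index_coset fN.
(* [sig x] depends only on the coset of [x] modulo [N] but need not lie over [x]. Correcting it by
   an element of [M] gives a section [s] that maps congruent elements modulo [N] to congruent
   elements modulo [M]. *)
pose sig x : E := (0%R, rep (lab x)).
have sP x : {y : E | p y = x & M ((sig x)^-1 * y)}.
  apply: cid2; have /labP [m Mm mE] : lab (rep (lab x)) = lab x by rewrite repK.
  exists (sig x * m); last by rewrite mulKg.
  by rewrite gmulfM mE /= mulVKg.
pose s x := s2val (sP x).
have ps x : p (s x) = x by rewrite /s; case: (sP x).
have Ms x x' : N (x^-1 * x') -> M ((s x)^-1 * s x').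
  move=> /labP xx'; rewrite /s; case: (sP x) (sP x') => y _ My [y' _ My'] /=.
  apply: (fin_index_trans (N := M) (y := sig x)) => //; first exact: fin_index_sym.
  by rewrite /sig xx'.
pose b x := (s x).1; pose w x y := (z x y + diff1 act b x y)%R.
have sE x : s x = (b x, x) by have := ps x; rewrite /b; case: (s x) => a y /= ->.
(* The shift matches the identity [(- z 1 1, 1)]. By [wE], [w] is the factor set of the section [s];
   its values are therefore determined modulo [M], and [M] meets the kernel trivially. *)
pose iota a : E := ((a - z 1%g 1%g)%R, 1).
have wE x y : iota (w x y) = s x * s y * (s (x * y))^-1.
  apply: (mulIg (s (x * y))); rewrite mulgVK !sE !twisted_mulE /= mul1g mact1.
  rewrite (cocycle_1l dz (x * y)); congr (_, _); rewrite /w /diff1; zmod_eq.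
exists b, N; split=> // x x' y y' xx /[dup] yy /Ms yy'; have xx' := Ms _ _ xx.

have fN' := fN.
have /(fin_index_mul fN xx) /Ms sxy : N (y^-1 * y') by [].
apply: (addIr (- z 1%g 1%g)%R); suff : iota (w x y) = iota (w x' y') by case.
apply: (mulgI (iota (w x y))^-1); rewrite mulVg; apply/esym/Mker.
  exact: (mulVg (1 : G)).
rewrite !wE; apply: fin_index_mul => //; first exact: fin_index_mul.
exact: fin_index_inv.
Qed.

End Degree2.

Section Degree3.
Local Open Scope classical_set_scope.
Local Open Scope ring_scope.
Context {G : groupType}.
Hypothesis G_ext : forall (E : groupType) (p : {multiplicative E -> G}),
  (forall y, exists x, p x = y) -> finite_set [set x | p x = 1%g] ->
  residually_finite E.

(** The earlier argument yields a 1-cochain [e], with values in functions on [Q], that corrects [b]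
    to something periodic; it remains to descend to [A]. Modulo constant functions the coboundary of
    [e] is periodic, hence so is [e]. Thus [e = e2 + a] with [e2] periodic and [a] valued in
    constants, and subtracting the coboundary of [a] from [b] suffices. *)
Lemma diff2_periodic (A : finZmodType) (act : module_action G A) N b :
  fin_index N -> periodic3 N (diff2 act b) ->
  exists b' M, [/\ fin_index M, periodic2 M b' &
    forall x y t, diff2 act b' x y t = diff2 act b x y t].
Proof.
move=> fN0 w_per0.
(* Shrinking [N] to act trivially on [A] lets a representative of a coset act in place of the
   element itself. *)
have fN := fin_indexI fN0 (action_kernel_fin_index act).
set N1 := N `&` _ in fN.
have act_per x x' a : N1 (x^-1 * x')%g -> act x a = act x' a.
  by move=> [_ /(_ a)]; rewrite mactM => E; rewrite -{1}E mactVK.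
have [w wE] : exists w, forall x y t, w x y t = diff2 act b x y t.
  by exists (diff2 act b).
have w_per : periodic3 N1 w.
  by move=> x x' y y' t t' [xx _] [yy _] [tt _]; rewrite !wE; apply: w_per0.
have dw x y t v : diff3 act w x y t v = 0.
  by rewrite -[RHS](diff32 act b x y t v) /diff3 !wE.
have [Q [lab [rep [repK labP]]]] := fin_index_coset fN.
have rlab x : N1 ((rep (lab x))^-1 * x)%g by apply/labP; rewrite repK.
pose s x q := lab (x^-1 * rep q)%g.
have s1 q : s 1%g q = q by rewrite /s invg1 mul1g repK.
have sM x y q : s (x * y)%g q = s y (s x q).
  rewrite /s invgM -mulgA; apply/labP; apply: fin_index_mul => //.
    exact: fin_index_refl.
  exact: fin_index_sym.
pose act' := coinduced act s1 sM.
pose cb x y : {ffun Q -> A} := [ffun => b x y].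
pose u x y : {ffun Q -> A} := [ffun q => act (rep q) (w (rep q)^-1%g x y)].
have du x y t : diff2 act' (fun x y => u x y - cb x y) x y t = 0.
  apply/ffunP => q; rewrite !ffunE /s.
  set g := rep q.
  have -> : act x (act (rep (lab (x^-1 * g)%g)) (w (rep (lab (x^-1 * g)))^-1%g y t) - b y t) =
      act g (w (g^-1 * x)%g y t) - act x (b y t).
    rewrite mactB -mactM (act_per _ g); last first.
      by rewrite invgM -mulgA; apply: rlab.
    congr (act g _ - _); apply: w_per; rewrite ?mulVg //.
    - by have := fin_index_inv fN (rlab (x^-1 * g)%g); rewrite [((x^-1 * g)^-1)%g]invgM [(x^-1^-1)%g]invgK.
    - exact: (subgrp1 (fin_index_subgrp fN)).
    - exact: (subgrp1 (fin_index_subgrp fN)).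
  have dwg : act g (w (g^-1 * x)%g y t) - act g (w g^-1%g (x * y)%g t)
      + act g (w g^-1%g x (y * t)%g) - act g (w g^-1%g x y) = w x y t.
    have /(congr1 (act g)) := dw g^-1%g x y t.
    rewrite mact0 /diff3 !(mactD, mactN) mactVK => w0.
    by rewrite -[RHS]subr0 -w0; zmod_eq.
  have bE : act x (b y t) - b (x * y)%g t + b x (y * t)%g - b x y = w x y t by rewrite wE.
  by rewrite -[RHS](subrr (w x y t)) -{1}dwg -bE; zmod_eq.
have A_fin : finite_type A by exists A, id.
have [e [N2 [fN2 e_per]]] := cocycle2_periodic G_ext (finite_type_ffun Q A_fin) du.
have u_per : periodic2 N1 u.
  move=> x x' y y' xx yy; apply/ffunP => q; rewrite !ffunE; congr (act _ _).
  by apply: w_per => //; apply: fin_index_refl.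
have act'_per x x' f : N1 (x^-1 * x')%g -> act' x f = act' x' f.
  move=> xx; apply/ffunP => q; rewrite !ffunE (act_per _ _ _ xx); congr (act _ (f _)).
  by apply/labP; apply: fin_index_mul => //; [apply: fin_index_inv|apply: fin_index_refl].
have fN12 := fin_indexI fN fN2.
set N12 := N1 `&` N2 in fN12.
have cbe_per : periodic2 N12 (fun x y => cb x y - diff1 act' e x y).
  move=> x x' y y' [xx xx'] [yy yy'].
  have cbE k l : cb k l - diff1 act' e k l
      = u k l - (u k l - cb k l + diff1 act' e k l).
    by move: (diff1 _ _ _ _) (u _ _) (cb _ _) => d1 u1 c1; zmod_eq.
  by rewrite !cbE (e_per _ _ _ _ xx' yy') (u_per _ _ _ _ xx yy).
(* [cb] has constant values, so modulo constants only the periodic part of the coboundary of [e] is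
   visible. *)
have [||||M fM e_perM] := @diff1_periodic_mod G _ act' (finite_type_ffun Q A_fin)
    [set f | forall q r, f q = f r] _ _ _ N12 e fN12.
- by move=> q r; rewrite !ffunE.
- by move=> f g fc gc q r; rewrite !ffunE (fc q r) (gc q r).
- by move=> x f fc q r; rewrite !ffunE (fc (s x q) (s x r)).
- move=> x m Nm q r.
  have cbeP : cb x m - diff1 act' e x m = cb x 1%g - diff1 act' e x 1%g.
    apply: cbe_per; first exact: fin_index_refl.
    by rewrite mulg1; apply: (subgrpV (fin_index_subgrp fN12)).
  have -> : diff1 act' e x m - diff1 act' e x 1%g = cb x m - cb x 1%g.
    move: (diff1 _ _ x m) (diff1 _ _ x 1%g) (cb x m) (cb x 1%g) cbeP => d1 d2 c1 c2 cd.
    transitivity (c1 - (c1 - d1) - d2); first by zmod_eq.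
    by rewrite cd; zmod_eq.
  by rewrite !ffunE.
pose q0 := lab 1%g.
have fM' := fin_indexI fN12 fM.
set M' := N12 `&` M in fM'.
(* [e2] is [e] evaluated at coset representatives; periodicity of [e] modulo constants makes
   [e x - e2 x] a constant function. *)
have [e2 [e2_per e2_mod]] : exists e2 : G -> {ffun Q -> A}, periodic1 M' e2 /\
    forall x q r, e x q - e2 x q = e x r - e2 x r.
  have [Q2 [lab2 [rep2 [rep2K lab2P]]]] := fin_index_coset fM'.
  exists (fun x => e (rep2 (lab2 x))); split; first by move=> x x' /lab2P ->.
  move=> x q r; have : M' (x^-1 * rep2 (lab2 x))%g by apply/lab2P; rewrite rep2K.
  by case=> _ /e_perM /(_ q r); rewrite !ffunE.
have [a eE] : exists a : G -> A, forall x q, e x q = e2 x q + a x.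
  by exists (fun x => e x q0 - e2 x q0) => x q; rewrite -(e2_mod x q q0) addrC subrK.
exists (fun x y => b x y - diff1 act a x y), M'; split=> //.
  move=> x x' y y' xx yy.
  have xy := fin_index_mul fM' xx yy.
  have e2E : diff1 act' e2 x y q0 = diff1 act' e2 x' y' q0.
    by rewrite /diff1 (e2_per _ _ xx) (e2_per _ _ yy) (e2_per _ _ xy) (act'_per x x') //; case: xx => -[].
  have bE k l : b k l - diff1 act a k l =
      (cb k l - diff1 act' e k l) q0 + diff1 act' e2 k l q0.
    rewrite /diff1 !ffunE !eE !mactD.
    by zmod_eq.
  by rewrite !bE e2E (cbe_per _ x' _ y') //; [case: xx|case: yy].
move=> x y t.
have -> : diff2 act (fun x y => b x y - diff1 act a x y) x y t =
   diff2 act b x y t - diff2 act (diff1 act a) x y t.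
  by rewrite /diff2 !mactB; move: (diff1 act a) => d; zmod_eq.
by rewrite diff21 subr0.
Qed.

End Degree3.

(** * Continuous cochains on the profinite completion *)

Section ProfiniteTopology.
Local Open Scope classical_set_scope.

Lemma initial_cvg (S : choiceType) (T : topologicalType) (f : S -> T)
    (F : set_system S) (s : S) :
  Filter F -> f @ F --> f s -> F --> (s : initial_topology f).
Proof.
move=> FF cv A /= [_ [[B Bop <-] Bfs sBA]]; apply: filterS sBA _.
by apply: cv; apply: open_nbhs_nbhs.
Qed.

Lemma prod_cvg (I : Type) (T : I -> topologicalType) (F : set_system (prod_topology T))
    (x : prod_topology T) :
  Filter F -> (forall i, (fun g : prod_topology T => g i) @ F --> x i) -> F --> x.
Proof.
by move=> FF cv; apply/cvg_sup => i; apply: (initial_cvg (f := fun g => g i)).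
Qed.

Lemma prod_proj_continuous (I : Type) (T : I -> topologicalType) i :
  continuous (fun g : prod_topology T => g i).
Proof.
move=> x; have /cvg_sup/(_ i) xi : nbhs x --> x by [].
by move=> A /(@initial_continuous _ _ (fun g : forall i, T i => g i) x) /xi.
Qed.

Lemma ultra_finite_value (J : Type) (U : set_system J) (Q : choiceType) (v : J -> Q) :
  UltraFilter U -> finite_set [set: Q] -> exists q, U [set j | v j = q].
Proof.
move=> UF /finite_seqP [s sE]; apply: contrapT => Uv.
have Us (t : seq Q) : U [set j | v j \notin t].
  elim: t => [|q t IHt]; first by apply: filterS filterT => j.
  have [Uq|Uq] := in_ultra_setVsetC [set j | v j = q] UF.
    by case: Uv; exists q.
  apply: filterS (filterI IHt Uq) => j [jt /= /eqP jq] /=.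
  by rewrite inE negb_or jq.
have [j /= js] := filter_ex (Us s).
by have : [set: Q] (v j) by []; rewrite sE /= (negPf js).
Qed.

Variable G : groupType.
Local Notation Ghat := (profinite_completion G).
Local Notation level := (finite_index_normal G).
Implicit Types N M : level.

Definition level_set N : set G := [set x | x \in nsub (sval N)].

Lemma fin_index_level N : fin_index (level_set N).
Proof.
split; last exact/quotient_index_finite/(svalP N).
  by split=> [|x y|x] /=; [exact: gpred1|exact: gpredM|exact: gpredVr].
by move=> x y Nx _; apply: nsub_normal.
Qed.

Lemma level_of_fin_index (L : set G) : fin_index L ->
  exists N, level_set N = L.
Proof.
move=> [sL nL iL].
have NE : [set x | x \in nsub (set_normal_subgroup sL nL)] = L.
  by apply/seteqP; split=> x /=; rewrite set_groupE => /asboolP.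
have fN : finite_index (set_normal_subgroup sL nL).
  by apply: index_finite_quotient; rewrite NE.
by exists (exist _ _ fN).
Qed.

Lemma levelI N M : exists L, level_set L `<=` level_set N `&` level_set M.
Proof.
have [L LE] := level_of_fin_index (fin_indexI (fin_index_level N) (fin_index_level M)).
by exists L; rewrite LE.
Qed.

Lemma profinite_proj_sub N M (x : Ghat) : level_set N `<=` level_set M ->
  quotient_map (sval M) (profinite_proj x N) = profinite_proj x M.
Proof. by move=> NM; apply: (set_valP x). Qed.

Lemma profinite_proj_le N M (x y : Ghat) : level_set N `<=` level_set M ->
  profinite_proj x N = profinite_proj y N -> profinite_proj x M = profinite_proj y M.
Proof. by move=> NM xy; rewrite -!(profinite_proj_sub _ NM) xy. Qed.

Lemma profinite_proj_continuous N :
  continuous (fun x : Ghat => (profinite_proj x N : discrete_topology _)).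
Proof.
move=> x; apply: (@continuous_comp _ _ _ (set_val : Ghat -> finite_quotients G)
  (fun g => g N)).
  exact: initial_continuous.
exact: (@prod_proj_continuous _ (fun N => discrete_topology (G / sval N)%type) N).
Qed.

Lemma profinite_cvg (J : Type) (U : set_system J) (X : J -> Ghat) (x : Ghat) :
  Filter U -> (forall N, U [set j | profinite_proj (X j) N = profinite_proj x N]) ->
  X @ U --> x.
Proof.
move=> UF Ux; apply: (initial_cvg (f := set_val)).
apply: prod_cvg => N A /= Ax; change (U [set j | A (profinite_proj (X j) N)]).
by apply: filterS (Ux N) => j /= ->; apply: nbhs_singleton Ax.
Qed.

Lemma profinite_ultra (J : Type) (U : set_system J) (X : J -> Ghat) :
  UltraFilter U ->
  exists x, forall N, U [set j | profinite_proj (X j) N = profinite_proj x N].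
Proof.
move=> UF.
have val N : {q | U [set j | profinite_proj (X j) N = q]}.
  apply: cid; apply: (@ultra_finite_value J U _ (fun j => profinite_proj (X j) N)).
  exact: (svalP N).
have cval : compatible (fun N => sval (val N)).
  move=> N M NM; case: (val N) (val M) => q Uq [q' Uq'] /=.
  have [j [/= <- <-]] := filter_ex (filterI Uq Uq').
  exact: profinite_proj_sub.
exists (mk_profinite cval) => N.
exact: (svalP (val N)).
Qed.

Definition same_level (T : Type) N (x y : T -> Ghat) := forall i,
  profinite_proj (x i) N = profinite_proj (y i) N.

Variables (A : finZmodType) (n : nat).
Implicit Type f : cochain Ghat A n.

Lemma ultra_below : exists U : set_system level,
  UltraFilter U /\ forall N, U [set M | level_set M `<=` level_set N].
Proof.
pose F := filter_from [set: level] (fun N => [set M | level_set M `<=` level_set N]).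
have FF : ProperFilter F.
  apply: filter_from_proper.
    apply: filter_from_filter.
      have [N _] := level_of_fin_index (@fin_indexT G); by exists N.
    move=> N M _ _; have [L LNM] := levelI N M.
    by exists L => // K KL; split=> x /KL /LNM [].
  by move=> N _; exists N => /= x.
have [U [UU FU]] := ultraFilterLemma FF.
by exists U; split=> // N; apply: FU; exists N.
Qed.

(** If every level failed, choose a bad pair at each one. Along an ultrafilter on levels containing
    the levels below any given one, both members of the pair converge to the same point [z]. As [f]
    is continuous with discrete values, it takes the value [f z] on both members at some level, a
    contradiction. *)
Lemma continuous_same_level f : continuous_cochains f ->
  exists N, forall x y, same_level N x y -> f x = f y.
Proof.
move=> fc; apply: contrapT => nN.
have bad N : {p | same_level N p.1 p.2 & f p.1 <> f p.2}.
  apply: cid2; apply: contrapT => nb; case: nN; exists N => x y xy.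
  by apply: contrapT => fxy; case: nb; exists (x, y).
pose X N := s2val (bad N).
have [U [UU Ub]] := ultra_below.
have [z zP] : exists z : 'I_n -> Ghat, forall i N,
    U [set M | profinite_proj ((X M).1 i) N = profinite_proj (z i) N].
  have Ez i := cid (profinite_ultra (fun M => (X M).1 i) UU).
  by exists (fun i => sval (Ez i)) => i; apply: (svalP (Ez i)).
have fU (Y : level -> 'I_n -> Ghat) :
    (forall i N, U [set M | profinite_proj (Y M i) N = profinite_proj (z i) N]) ->
    U [set M | f (Y M) = f z].
  move=> YU; have Yz : Y @ U --> (z : {ptws 'I_n -> Ghat}).
    apply: prod_cvg => i.
    by apply: (@profinite_cvg _ U (fun M => Y M i)) => N; apply: YU.
  have fz : nbhs (z : {ptws 'I_n -> Ghat}) [set y | f y = f z].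
    exact: (fc z [set f z] (@discrete_set1 (discrete_topology A) _)).
  exact: Yz fz.
have f1 := fU _ zP.
have f2 : U [set M | f (X M).2 = f z].
  apply: fU => i N; apply: filterS (filterI (zP i N) (Ub N)) => M /= [<- MN].
  apply: (profinite_proj_le MN); rewrite /X; case: (bad M) => p /= pM _.
  by rewrite pM.
have [M [/= e1 e2]] := filter_ex (filterI f1 f2).
by move: e1 e2; rewrite /X; case: (bad M) => p _ /= pf e1; rewrite -e1 => /esym.
Qed.

Lemma same_level_continuous f N :
  (forall x y, same_level N x y -> f x = f y) -> continuous_cochains f.
Proof.
move=> fN z B /= Bz.
have zN i : nbhs (z : {ptws 'I_n -> Ghat})
    [set x | profinite_proj (x i) N = profinite_proj (z i) N].
  have yi : nbhs (z i) [set y : Ghat | profinite_proj y N = profinite_proj (z i) N].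
    exact: (@profinite_proj_continuous N (z i) [set profinite_proj (z i) N]
      (@discrete_set1 (discrete_topology _) _)).
  exact: (@prod_proj_continuous _ (fun=> Ghat : topologicalType) i z _ yi).
have := filter_forall (nbhs_filter (z : {ptws 'I_n -> Ghat})) zN.
by apply: filterS => x /fN /= ->; apply: nbhs_singleton Bz.
Qed.

End ProfiniteTopology.

(** * Cohomology classes, restriction along the completion map, and comparison *)

Section CohomologyClasses.
Local Open Scope classical_set_scope.
Local Open Scope ring_scope.
Context {G : groupType} {A : zmodType}.
Variable act : module_action G A.

Lemma coboundaryB n (f g : cochain G A n) x :
  coboundary act (fun y => f y - g y) x = coboundary act f x - coboundary act g x.
Proof.
rewrite /coboundary mactB !mulrzBl (eq_bigr _ (fun j _ => mulrzBl _ _ _)) sumrB.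
by zmod_eq.
Qed.

Lemma coboundary0 n x : coboundary act ((fun=> 0) : cochain G A n) x = 0.
Proof.
rewrite /coboundary mact0 mul0rz big1 ?addr0 // => j _; exact: mul0rz.
Qed.

Variable C : forall n, set (cochain G A n).
Hypothesis C0 : forall n, C ((fun=> 0) : cochain G A n).
Hypothesis CB : forall n (f g : cochain G A n), C f -> C g -> C (fun x => f x - g x).

Lemma coboundaries0 n : coboundaries act C ((fun=> 0) : cochain G A n).
Proof.
case: n => [//|n]; exists (fun=> 0); first exact: C0.
by apply/funext => x; rewrite coboundary0.
Qed.

Lemma coboundariesB n (b b' : cochain G A n) : coboundaries act C b ->
  coboundaries act C b' -> coboundaries act C (fun x => b x - b' x).
Proof.
case: n b b' => [|n] b b'; first by move=> -> ->; apply/funext => x; rewrite subrr.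
move=> [f Cf <-] [g Cg <-]; exists (fun x => f x - g x); first exact: CB.
by apply/funext => x; rewrite coboundaryB.
Qed.

Lemma cohomology_class_refl n (z : cochain G A n) : cohomology_class act C z z.
Proof.
by exists (fun=> 0); [exact: coboundaries0|apply/funext => x; rewrite addr0].
Qed.

Lemma cohomology_class_eq n (z w : cochain G A n) :
  coboundaries act C (fun x => z x - w x) ->
  cohomology_class act C z = cohomology_class act C w.
Proof.
move=> zw; have zwN := coboundariesB (@coboundaries0 n) zw.
apply/seteqP; split=> _ [b Cb ->].
  exists (fun x => b x - (0 - (z x - w x))); first exact: coboundariesB.
  by apply/funext => x; zmod_eq.
exists (fun x => b x - (z x - w x)); first exact: coboundariesB.
by apply/funext => x; zmod_eq.
Qed.

Lemma cohomology_class_eqP n (z w : cochain G A n) :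
  cohomology_class act C z = cohomology_class act C w ->
  coboundaries act C (fun x => z x - w x).
Proof.
move=> zw; have := cohomology_class_refl z; rewrite zw => -[b Cb ->].
by congr (coboundaries _ _ _): Cb; apply/funext => x; rewrite [w x + b x]addrC addrK.
Qed.

End CohomologyClasses.

Section Restriction.
Local Open Scope classical_set_scope.
Local Open Scope ring_scope.
Variables (G : groupType) (A : finZmodType).
Local Notation Ghat := (profinite_completion G).
Variable act : module_action Ghat A.
Local Notation actG := (pullback_action (@completion_map G) act).

Definition restrict n (f : cochain Ghat A n) : cochain G A n :=
  fun x => f (fun i => completion_map (x i)).

Definition periodic n (N : set G) (g : cochain G A n) := forall x y : 'I_n -> G,
  (forall i, N ((x i)^-1 * y i)%g) -> g x = g y.

Lemma coboundary_restrict n (f : cochain Ghat A n) x :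
  coboundary actG (restrict f) x = coboundary act f (fun i => completion_map (x i)).
Proof.
rewrite /coboundary /restrict /=; congr (_ + _ + _).
apply: eq_bigr => j _; congr (f _ *~ _); apply/funext => i; rewrite /Defs.merge.
by case: ifP => // _; case: ifP => // _; rewrite gmulfM.
Qed.

Lemma completion_levelP (N : finite_index_normal G) (x y : G) :
  profinite_proj (completion_map x) N = profinite_proj (completion_map y) N <->
  level_set N (x^-1 * y)%g.
Proof. exact: quotient_eqP. Qed.

Lemma completion_repr (N : finite_index_normal G) (x : Ghat) :
  profinite_proj (completion_map (repr (profinite_proj x N))) N = profinite_proj x N.
Proof. exact: reprK. Qed.

Lemma restrict_periodic n (f : cochain Ghat A n) : continuous_cochains f ->
  exists2 N, fin_index N & periodic N (restrict f).
Proof.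
move=> /continuous_same_level [N fN]; exists (level_set N).
  exact: fin_index_level.
by move=> x y xy; apply: fN => i; apply/completion_levelP.
Qed.

Lemma periodic_extension n (g : cochain G A n) N : fin_index N -> periodic N g ->
  exists2 f, continuous_cochains f & restrict f = g.
Proof.
move=> /level_of_fin_index [M <-] gM.
exists (fun x => g (fun i => repr (profinite_proj (x i) M))).
  apply: (@same_level_continuous _ _ _ _ M) => x y xy.
  by congr g; apply/funext => i; rewrite xy.
apply/funext => x; apply: gM => i; apply/completion_levelP.
exact: completion_repr.
Qed.

(** Density of the image of [G]: it meets every coset at level [N]. *)
Lemma restrict_eq0 n (f : cochain Ghat A n) N :
  (forall x y, same_level N x y -> f x = f y) ->
  (forall x, restrict f x = 0) -> forall x, f x = 0.
Proof.
move=> fN f0 x; rewrite -(f0 (fun i => repr (profinite_proj (x i) N))).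
by apply: fN => i; rewrite completion_repr.
Qed.

Hypothesis act_cont : continuous_action act.

(** For a fixed [a], the action is a continuous 1-cochain and hence factors through a level.
    Finiteness of [A] lets one level serve all [a]. *)
Lemma action_level : exists N, forall x y : Ghat,
  profinite_proj x N = profinite_proj y N -> forall a, act x a = act y a.
Proof.
have actc a : continuous_cochains (fun x : 'I_1 -> Ghat => act (x ord0) a).
  move=> z B /= Bz; have [[P Q] /= [Pz Qa] PQ] := @act_cont (z ord0, a) B Bz.
  have zP : nbhs (z : {ptws 'I_1 -> Ghat}) [set x | P (x ord0)].
    exact: (@prod_proj_continuous _ (fun=> Ghat : topologicalType) ord0 z _ Pz).
  change (nbhs (z : {ptws 'I_1 -> Ghat}) [set x | B (act (x ord0) a)]).
  apply: (@filterS _ _ (nbhs_filter (z : {ptws 'I_1 -> Ghat})) _ _ _ zP) => x /= Px.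
  by apply: (@PQ (x ord0, a)); split=> //=; apply: nbhs_singleton Qa.
have [N NP] : exists N, forall x y : Ghat,
    profinite_proj x N = profinite_proj y N ->
    forall a, a \in enum A -> act x a = act y a.
  elim: (enum A) => [|a s [N NP]].
    have [N _] := level_of_fin_index (@fin_indexT G); by exists N.
  have [M MP] := continuous_same_level (actc a).
  have [L LNM] := levelI N M; exists L => x y xy b; rewrite inE => /predU1P[->|].
    apply: (MP (fun=> x) (fun=> y)) => i.
    by apply: profinite_proj_le xy => t /LNM [].
  by apply: NP; apply: profinite_proj_le xy => t /LNM [].
by exists N => x y /NP xy a; apply: xy; rewrite mem_enum.
Qed.

Lemma coboundary_level n (f : cochain Ghat A n) : continuous_cochains f ->
  exists N, forall x y, same_level N x y -> coboundary act f x = coboundary act f y.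
Proof.
move=> /continuous_same_level [N fN]; have [M actM] := action_level.
have [L LNM] := levelI N M; exists L => x y xy.
have xyN : same_level N x y.
  by move=> i; apply: profinite_proj_le (xy i) => t /LNM [].
rewrite /coboundary; congr (_ + _ + _).
- rewrite (actM (x ord0) (y ord0)).
    by congr (act _ _); apply: fN => i; apply: xyN.
  by apply: profinite_proj_le (xy ord0) => t /LNM [].
- apply: eq_bigr => j _; congr (_ *~ _); apply: fN => i; rewrite /Defs.merge.
  case: ifP => _; first exact: xyN.
  case: ifP => _; last exact: xyN.
  have mulE (u v : Ghat) :
    profinite_proj (u * v)%g N = (profinite_proj u N * profinite_proj v N)%g by [].
  by rewrite !mulE !xyN.
- by congr (_ *~ _); apply: fN => i; apply: xyN.
Qed.

End Restriction.

Section Comparison.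
Local Open Scope classical_set_scope.
Local Open Scope ring_scope.
Variables (G : groupType) (A : finZmodType).
Local Notation Ghat := (profinite_completion G).
Variable act : module_action Ghat A.
Hypothesis act_cont : continuous_action act.
Local Notation actG := (pullback_action (@completion_map G) act).

Definition periodic_cochains n : set (cochain G A n) :=
  [set g | exists2 N, fin_index N & periodic N g].

(** Surjectivity in degree [n] expressed by cochains on [G] alone; [coboundaries_periodic] below is
    the corresponding form of injectivity. *)
Definition cocycles_periodic n := forall z : cochain G A n,
  (forall x, coboundary actG z x = 0) ->
  exists w : cochain G A n, [/\ periodic_cochains w,
    forall x, coboundary actG w x = 0 &
    coboundaries actG (@all_cochains G A) (fun x => z x - w x)].

Definition coboundaries_periodic n := forall b : cochain G A n,
  coboundaries actG (@all_cochains G A) b -> periodic_cochains b ->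
  coboundaries actG periodic_cochains b.

Lemma continuous_cochains0 n : continuous_cochains ((fun=> 0) : cochain Ghat A n).
Proof.
have [N _] := level_of_fin_index (@fin_indexT G).
exact: (@same_level_continuous _ _ _ _ N).
Qed.

Lemma continuous_cochainsB n (f g : cochain Ghat A n) : continuous_cochains f ->
  continuous_cochains g -> continuous_cochains (fun x => f x - g x).
Proof.
move=> /continuous_same_level [N fN] /continuous_same_level [M gM].
have [L LNM] := levelI N M; apply: (@same_level_continuous _ _ _ _ L) => x y xy.
by congr (_ - _); [apply: fN|apply: gM] => i; apply: profinite_proj_le (xy i) => t /LNM [].
Qed.

Local Notation C := (@continuous_cochains G A).
Local Notation D := (@all_cochains G A).
Let C0 := continuous_cochains0.
Let CB := continuous_cochainsB.

Lemma restrict_coboundaries n (b : cochain Ghat A n) :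
  coboundaries act C b -> coboundaries actG D (restrict b).
Proof.
case: n b => [|n] b; first by move=> ->.
move=> [f _ <-]; exists (restrict f) => //.
by apply/funext => x; rewrite coboundary_restrict.
Qed.

Lemma completion_mapE n (z : cochain Ghat A n) :
  completion_cohomology_map act n (cohomology_class act C z)
  = cohomology_class actG D (restrict z).
Proof.
have zw w : cohomology_class act C z w ->
    cohomology_class actG D (restrict w) = cohomology_class actG D (restrict z).
  move=> [b Cb ->]; apply: cohomology_class_eq => //.
  congr (coboundaries _ _ _): (restrict_coboundaries Cb).
  by apply/funext => x; rewrite /restrict addrAC subrr add0r.
apply/seteqP; split=> [y [w /zw <- //]|y zy].
by exists z => //; apply: cohomology_class_refl.
Qed.

Lemma restrict_injective n (f g : cochain Ghat A n) : continuous_cochains f ->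
  continuous_cochains g -> restrict f = restrict g -> f = g.
Proof.
move=> Cf Cg fg.
have /continuous_same_level [N fgN] := CB Cf Cg.
apply/funext => x; apply/eqP; rewrite -subr_eq0; apply/eqP.
by apply: (restrict_eq0 fgN) => y; have := congr1 (@^~ y) fg; rewrite /restrict => ->; rewrite subrr.
Qed.

Lemma restrict_coboundaries_inv n (b : cochain Ghat A n) : coboundaries_periodic n ->
  continuous_cochains b -> coboundaries actG D (restrict b) -> coboundaries act C b.
Proof.
move=> In Cb Db; have [N fN bN] := restrict_periodic Cb.
have := In _ Db (ex_intro2 _ _ N fN bN).
case: n b In Cb Db N fN bN => [|n] b In Cb Db N fN bN.
  move=> b0; apply: restrict_injective => //; exact: C0.
move=> [f [M fM /(periodic_extension fM) [g Cg <-]] gb].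
exists g => //; have [L gL] := coboundary_level act_cont Cg.
apply: restrict_injective => //; first exact: (same_level_continuous gL).
by rewrite -gb; apply/funext => x; rewrite coboundary_restrict.
Qed.

Lemma completion_inj n : coboundaries_periodic n ->
  set_inj (continuous_cohomology act n) (completion_cohomology_map act n).
Proof.
move=> In c c' /set_mem [z [Cz _] <-] /set_mem [w [Cw _] <-].
rewrite !completion_mapE => /cohomology_class_eqP zw.
by apply: cohomology_class_eq => //; apply: restrict_coboundaries_inv => //; [apply: CB|apply: zw].
Qed.

Lemma completion_bij n : cocycles_periodic n -> coboundaries_periodic n ->
  set_bij (continuous_cohomology act n) (discrete_cohomology act n)
    (completion_cohomology_map act n).
Proof.
move=> Sn In; split; last 1 first.
- move=> _ [z [_ dz] <-]; have [w [[N fN wN] dw zw]] := Sn z dz.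
  have [f Cf fw] := periodic_extension fN wN.
  have [L fL] := coboundary_level act_cont Cf.
  exists (cohomology_class act C f); last first.
    by rewrite completion_mapE fw; apply/esym/cohomology_class_eq.
  exists f => //; split=> //; apply: (restrict_eq0 fL) => x.
  by rewrite -(dw x) -fw coboundary_restrict.
- move=> _ [z [Cz dz] <-]; rewrite completion_mapE; exists (restrict z) => //.
  by split=> // x; rewrite coboundary_restrict.
- exact: completion_inj.
Qed.

End Comparison.

Section LowDegrees.
Local Open Scope ring_scope.
Context {G : groupType} {A : zmodType}.
Variable act : module_action G A.

Definition vec2 (a b : G) : 'I_2 -> G := fun i => nth 1%g [:: a; b] i.
Definition vec3 (a b c : G) : 'I_3 -> G := fun i => nth 1%g [:: a; b; c] i.

Lemma vec2E (x : 'I_2 -> G) : x = vec2 (x ord0) (x (lift ord0 ord0)).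
Proof.
by apply/funext => i; rewrite /vec2; case: i => -[|[|i]] // Hi /=; congr x; apply: val_inj.
Qed.

Lemma coboundary1 (f : cochain G A 1) (x : 'I_2 -> G) : coboundary act f x =
  diff1 act (fun a => f (fun=> a)) (x ord0) (x (lift ord0 ord0)).
Proof.
rewrite /coboundary /diff1 big_ord_recl big_ord0 addr0 mulr1z expr1 mulrN1z.
by congr (_ (f _) - f _ + f _); apply/funext => -[[|i] Hi] //;
  rewrite /Defs.merge //=; try congr (_ * _)%g; congr x; apply: val_inj.
Qed.

Lemma coboundary2 (f : cochain G A 2) (x : 'I_3 -> G) : coboundary act f x =
  diff2 act (fun a b => f (vec2 a b)) (x ord0) (x (lift ord0 ord0))
    (x (lift ord0 (lift ord0 ord0))).
Proof.
rewrite /coboundary /diff2 !big_ord_recl big_ord0 addr0 /= expr1 mulrN1z.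
have -> : (-1) ^+ 2 = 1 :> int by [].
have -> : (-1) ^+ 3 = -1 :> int by [].
rewrite mulr1z mulrN1z !addrA; 
by congr (_ (f _) - f _ + f _ - f _); apply/funext => -[[|[|i]] Hi] //;
  rewrite /vec2 /Defs.merge //=; try congr (_ * _)%g; congr x; apply: val_inj.
Qed.

End LowDegrees.

(** * Periodicity in the degrees required for the class [class_A 2] *)

Section Degrees.
Local Open Scope classical_set_scope.
Local Open Scope ring_scope.
Context {G : groupType}.
Hypothesis G_ext : forall (E : groupType) (p : {multiplicative E -> G}),
  (forall y, exists x, p x = y) -> finite_set [set x | p x = 1%g] ->
  residually_finite E.

Variable A : finZmodType.
Variable act : module_action (profinite_completion G) A.
Local Notation actG := (pullback_action (@completion_map G) act).
Local Notation D := (@all_cochains G A).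

Let A_fin : finite_type A.
Proof. by exists A, id. Qed.

Lemma coboundaries_subrr n (z : cochain G A n) :
  coboundaries actG D (fun x => z x - z x).
Proof.
have D0 : coboundaries actG D ((fun=> 0) : cochain G A n) by exact: coboundaries0.
by congr (coboundaries _ _ _): D0; apply/funext => x; rewrite subrr.
Qed.

Lemma periodic0 (z : cochain G A 0) : periodic_cochains z.
Proof.
exists [set: G]; first exact: fin_indexT.
by move=> x y _; congr z; apply/funext => -[].
Qed.

Lemma periodic1_cochain (z : cochain G A 1) N : fin_index N ->
  (forall a m, N m -> coboundary actG z (vec2 a m) = coboundary actG z (vec2 a 1%g)) -> periodic_cochains z.
Proof.
move=> fN dz; have [x m Nm|M fM Mz] := diff1_periodic (act := actG) (N := N)
  (b := fun a => z (fun=> a)) A_fin fN.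
  by have := dz x m Nm; rewrite !coboundary1.
exists M => // x y xy; have Ex (t : 'I_1 -> G) : t = fun=> t ord0.
  by apply/funext => i; rewrite ord1.
by rewrite (Ex x) (Ex y); apply: Mz.
Qed.

Lemma cocycles_periodic_le2 n : (n <= 2)%N -> cocycles_periodic act n.
Proof.
case: n => [|[|[|//]]] _ z dz.
- by exists z; split=> //; [apply: periodic0|apply: coboundaries_subrr].
(* A 1-cocycle with values in a finite module is already periodic, its coboundary being zero. *)
- exists z; split=> //; last exact: coboundaries_subrr.
  by apply: (periodic1_cochain (@fin_indexT G)) => x y _; rewrite !dz.
pose z2 a b := z (vec2 a b).
have dz2 a b c : diff2 actG z2 a b c = 0.
  by have := dz (vec3 a b c); rewrite coboundary2.
have [b [N [fN wN]]] := cocycle2_periodic G_ext A_fin dz2.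
pose f : cochain G A 1 := fun x => b (x ord0).
have fE x : coboundary actG f x = diff1 actG b (x ord0) (x (lift ord0 ord0)).
  by rewrite coboundary1.
exists (fun x => z x - coboundary actG (fun x => 0 - f x) x); split.
- exists N => // x y xy; rewrite !coboundaryB !coboundary0 !fE !sub0r !opprK.
  by rewrite (vec2E x) (vec2E y); apply: wN.
- move=> x; rewrite coboundaryB dz coboundary2 /diff2 !coboundary1 sub0r.
  apply/eqP; rewrite oppr_eq0; apply/eqP.
  exact: (diff21 actG (fun a => 0 - b a)).
- exists (fun x => 0 - f x) => //; apply/funext => x.
  by rewrite opprB addrC subrK.
Qed.

Lemma coboundaries_periodic_le3 n : (n <= 3)%N -> coboundaries_periodic act n.
Proof.
case: n => [|[|[|[|//]]]] _ b; first by [].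
- by move=> [f _ <-] _; exists f => //; apply: periodic0.
(* A 1-cochain with periodic coboundary is itself periodic, so [f] is kept; only in degree 3 must
   the cochain be changed. *)
- move=> [f _ <-] [N fN dfN]; exists f => //.
  apply: (periodic1_cochain fN) => x y Ny; apply: dfN => i.
  rewrite /vec2; case: i => -[|[|i]] //= _.
    by rewrite mulVg; apply: (subgrp1 (fin_index_subgrp fN)).
  by rewrite mulg1; apply: (subgrpV (fin_index_subgrp fN)).
move=> [f _ <-] [N fN dfN].
have per3 : periodic3 N (diff2 actG (fun a b => f (vec2 a b))).
  move=> x x' y y' t t' xx yy tt.
  have := dfN (vec3 x y t) (vec3 x' y' t'); rewrite !coboundary2; apply=> i.
  by rewrite /vec3; case: i => -[|[|[|i]]].
have [b' [M [fM Mb' db']]] := diff2_periodic G_ext fN per3.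
exists (fun x => b' (x ord0) (x (lift ord0 ord0))).
  by exists M => // x y xy; apply: Mb'.
by apply/funext => x; rewrite !coboundary2 -db'.
Qed.

End Degrees.

Lemma highly_residually_finite_of_extensions (G : groupType) :
  (forall (E : groupType) (p : {multiplicative E -> G}),
    (forall y, exists x, p x = y) -> finite_set [set x | p x = 1%g]%classic ->
    residually_finite E) ->
  highly_residually_finite G.
Proof.
move=> G_ext; split.
  apply: (G_ext G idfun) => [y|]; first by exists y.
  apply: (sub_finite_set (B := [set 1%g]%classic)); [by []|exact: finite_set1].
move=> A act act_cont; split=> [i i2|].
  apply: completion_bij => //; first exact: cocycles_periodic_le2.
  by apply: coboundaries_periodic_le3 => //; apply: leq_trans i2 _.
by apply: completion_inj => //; apply: coboundaries_periodic_le3.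
Qed.

Theorem theorem4p14 (G : groupType) (r : nat) (Gs : nat -> groupClosed G)
    (Gs_series : subnormal_series r Gs)
    (Gs_factors : series_factors
       (fun Q => finite_group Q \/ free_of_finite_rank Q \/ polycyclic Q) r Gs)
    (phi : {multiplicative G -> G}) (phi_inj : injective phi)
    (phi_Gs : forall i : nat, (1 <= i <= r)%N ->
       forall x : G, x \in Gs i -> phi x \in Gs i) :
  highly_residually_finite (ascending_hnn phi).
Proof.
apply: highly_residually_finite_of_extensions => E p p_onto p_fin.
exact: (hnn_finite_extension_rf Gs_series Gs_factors phi_inj phi_Gs p_onto p_fin).
Qed.
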